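(* Let $e_5=(0,0,0,0,1)$. Up to permutations and sign changes of the coordinates, the two-dimensional proper subtori $U\subseteq\mathbb T^5$ with $D(U)=3/10$ are exactly $\langle(1,2,3,4,0),e_5\rangle_{\mathbb R}$ and $\langle(1,3,4,7,0),e_5\rangle_{\mathbb R}$. Consequently there is a finite set $E_5$ of primitive near-tight quintuples such that every primitive near-tight quintuple not in $E_5$ has $\mathrm{ML}=s/(5s+1)$ for some positive integer $s$. No quintuple with speeds at most $130$ violates this conclusion, i.e. every near-tight quintuple with all speeds at most $130$ has $\mathrm{ML}=s/(5s+1)$ for some positive integer $s$.
   Context: For real $x$, $\lVert x\rVert$ is the distance to the nearest integer. $\mathbb T^n=(\mathbb R/\mathbb Z)^n$. For a closed subset $X\subseteq\mathbb T^n$ put $\mathrm{ML}(X)=\sup_{x\in X}\min_{1\le r\le n}\lVert x_r\rVert$ and $D(X)=\tfrac12-\mathrm{ML}(X)$. For linearly independent $u,v\in\mathbb Z^n$, $\langle u,v\rangle_{\mathbb R}$ is the image in $\mathbb T^n$ of the real plane spanned by $u,v$; the two-dimensional subtori are exactly the sets of this form. A subtorus is proper if it is not contained in the union of the coordinate hyperplanes $\{x_r=0\}$. For a quintuple $v$ of distinct positive integers (the speeds), $\mathrm{ML}(v)=\max_{t\in\mathbb R}\min_{1\le i\le5}\lVert tv_i\rVert$. The quintuple is primitive if its entries have gcd $1$, and near-tight if $\mathrm{ML}(v)<1/5$. *)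

(* Defs.v *)
From HB Require Import structures.
From mathcomp Require Import all_boot all_order perm all_algebra.
From mathcomp Require Import all_classical all_reals all_analysis.

Set Implicit Arguments.
Unset Strict Implicit.
Unset Printing Implicit Defensive.

Import Order.TTheory GRing.Theory Num.Theory.
Local Open Scope classical_set_scope.
Local Open Scope quotient_scope.
Local Open Scope ring_scope.

Definition dist_int {R : realType} (x : R) : R :=
  inf [set `|x - m%:~R| | m in [set: int]].

(* R/Z *)
Definition circle (R : realType) : zmodType :=
  Quotient.quot (GRing.ZmodClosed.clone R (@Num.int_num_subdef R) _).

Definition to_circle {R : realType} (x : R) : circle R := \pi_(circle R) x.

Definition torus (R : realType) (n : nat) : Type := 'rV[circle R]_n.

Definition to_torus {R : realType} {n : nat} (x : 'rV[R]_n) : torus R n :=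
  map_mx to_circle x.

(* Independent of the representative chosen by repr: see circle_normE. *)
Definition circle_norm {R : realType} (t : circle R) : R := dist_int (repr t).

(* The values considered are distances to the nearest integer, hence at most
   1/2, so that 1/2 is neutral for their minimum. *)
Definition min_norm {R : realType} {n : nat} (f : 'I_n -> R) : R :=
  \big[Num.min/2^-1]_(r < n) f r.

(* Applied to closed nonempty X only, where the supremum is attained. *)
Definition ML {R : realType} {n : nat} (X : set (torus R n)) : R :=
  sup [set min_norm (fun r => circle_norm (x 0 r)) | x in X].

Definition D {R : realType} {n : nat} (X : set (torus R n)) : R :=
  2^-1 - ML X.

Definition real_vec (R : realType) {n : nat} (u : 'rV[int]_n) : 'rV[R]_n :=
  map_mx intr u.

Definition plane_torus (R : realType) {n : nat} (u v : 'rV[int]_n) :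
    set (torus R n) :=
  to_torus @` [set x | x \in <<[:: real_vec R u; real_vec R v]>>%VS].

Arguments plane_torus R {n} u v.

Definition subtorus2 {R : realType} {n : nat} (U : set (torus R n)) : Prop :=
  exists u v : 'rV[int]_n,
    free [:: real_vec R u; real_vec R v] /\ U = plane_torus R u v.

Definition proper_subtorus {R : realType} {n : nat} (U : set (torus R n)) :
    Prop :=
  ~ (U `<=` \bigcup_(r in [set: 'I_n]) [set x : torus R n | x 0 r = 0]).

Definition signed_perm {R : realType} {n : nat} (s : 'S_n)
    (e : {ffun 'I_n -> bool}) (x : torus R n) : torus R n :=
  \row_j (if e j then - x 0 (s j) else x 0 (s j)).

Definition row5 (t : seq int) : 'rV[int]_5 := \row_j t`_j.

Definition speeds5 (v : 5.-tuple nat) : bool :=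
  uniq v && all (fun k => 0 < k)%N v.

Definition primitive5 (v : 5.-tuple nat) : bool :=
  (\big[gcdn/0]_(i < 5) tnth v i == 1)%N.

(* The function of t is continuous and 1-periodic, so that the supremum is a
   maximum. *)
Definition ML_speeds (R : realType) (v : 5.-tuple nat) : R :=
  sup (range (fun t : R => min_norm (fun i => dist_int (t * (tnth v i)%:R)))).

Definition near_tight (R : realType) (v : 5.-tuple nat) : Prop :=
  ML_speeds R v < 5^-1.

Definition in_spectrum (R : realType) (v : 5.-tuple nat) : Prop :=
  exists s : nat, (0 < s)%N /\ ML_speeds R v = s%:R / (5 * s + 1)%:R.

Lemma dist_int_shift (R : realType) (x : R) (m : int) :
  dist_int (x + m%:~R) = dist_int x.
Proof.
rewrite /dist_int; congr inf; apply/seteqP; split=> y [k _ <-].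
  by exists (k - m) => //; rewrite rmorphB /= opprB addrA addrAC.
by exists (k + m) => //; rewrite rmorphD /= opprD addrACA subrr addr0.
Qed.

Lemma circle_normE (R : realType) (x : R) :
  circle_norm (to_circle x) = dist_int x.
Proof.
have /intrP[m xm] : repr (to_circle x) - x \in (Num.int : {pred R}).
  by rewrite Quotient.idealrBE reprK.
by rewrite /circle_norm -(subrK x (repr _)) xm addrC dist_int_shift.
Qed.

(* Main.v *)
Require Import Defs.
From HB Require Import structures.
From mathcomp Require Import all_boot all_order perm all_algebra.
From mathcomp Require Import all_classical all_reals all_analysis.
From mathcomp Require Import zify ring lra.

(** The proof studies rational planes in a torus. On the parameters of such a plane
the coordinates are linear forms, and a point is good when the values of all forms
are far from the integers.

The central result is [five_coordinates]: a plane through an integer vector without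
zero entries contains a point with all five coordinates more than 1/5 away from the
integers, unless four coordinates are proportional to 1, 2, 3, 4 or to 1, 3, 4, 7 and
the fifth one is independent of them. To see this, sort the forms by slope. If no
three of them are parallel, two forms can be chosen that become equal up to sign on a
line of the plane on which no form vanishes and such that the other three are
pairwise independent. On this line there are only four different speeds, and four
runners reach more than 1/5 except for the two extremal quadruples ([four_runners]).
In the extremal case a suitable fifth of the period has only two critical
coordinates; their forms are independent, and so both can be improved by leaving the
line ([collapsed_strict]). If three or four forms are parallel, these are treated as
runners, and the other ones are moved independently.

The result on four runners is obtained in the same way from three runners, and that
one from two: if a speed is large, the runners come close to every point of a plane
by Dirichlet's theorem ([dirichlet_plane]). The remaining finitely many triples and
quadruples are enumerated, together with times at which they are lonely.

Subtori. The condition D(U) = 3/10 excludes points with all coordinates more than 1/5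
away from the integers, so that [five_coordinates] determines U ([plane_extremal]);
conversely the two families have this value ([extremal_plane]).

Finiteness. Suppose that two nonproportional primitive near-tight quintuples have
values outside the spectrum. Their plane contains a point with all coordinates more
than 1/5 away from the integers, for otherwise the first quintuple would be one of 1,
2, 3, 4, 5s and 1, 3, 4, 7, 5s, up to order, and their values are in the spectrum
([tight_family]). By a quantitative form of Kronecker's theorem ([kronecker]) a line
comes close to that point if its direction satisfies no short integral relation other
than those satisfied by the point. Hence every further such quintuple satisfies one
of finitely many new relations, and induction on the number of independent relations
gives finiteness ([exceptional_finite]).

Speeds up to 130. An enumeration leaves, up to common factors, the two families and
thirteen sporadic quintuples ([small_quintuples]). The values of the latter are
certified by a time that attains them and by intervals of times that show that no
time does better ([certificate_spectral]). *)

Set Implicit Arguments.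
Unset Strict Implicit.
Unset Printing Implicit Defensive.
Import Order.TTheory GRing.Theory Num.Theory.
Local Open Scope classical_set_scope.
Local Open Scope ring_scope.


(** * Distance to the nearest integer *)

Section DistInt.
Context {R : realType}.
Implicit Types (x y c t : R) (m n : int).

Lemma dist_int_has_inf x :
  has_inf [set `|x - k%:~R| | k in [set: int]].
Proof.
split; first by exists `|x - 0%:~R|, 0.
by exists 0 => _ [k _ <-]; rewrite normr_ge0.
Qed.

Lemma dist_int_le x m : dist_int x <= `|x - m%:~R|.
Proof. by apply: ge_inf; [case: (dist_int_has_inf x) | exists m]. Qed.

Lemma dist_int_ge c x :
  (forall m, c <= `|x - m%:~R|) -> c <= dist_int x.
Proof.
move=> cx; apply: lb_le_inf; first by case: (dist_int_has_inf x).
by move=> _ [k _ <-].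
Qed.

Lemma dist_intP x c : reflect (forall m, c <= `|x - m%:~R|) (c <= dist_int x).
Proof.
apply: (iffP idP); last exact: dist_int_ge.
by move=> cx m; apply: le_trans (dist_int_le x m).
Qed.

Lemma floor_itv1 x :
  (Num.floor x)%:~R <= x /\ x < (Num.floor x)%:~R + 1.
Proof. by have /andP[] := floor_itv x; rewrite intrD. Qed.

Lemma dist_int_attained x : exists m, dist_int x = `|x - m%:~R|.
Proof.
have [h1 h2] := floor_itv1 x.
set k := Num.floor x in h1 h2 *.
have low m : (m <= k)%R -> x - k%:~R <= `|x - m%:~R|.
  by move=> mk; rewrite ler_normr; apply/orP; left; rewrite lerD2l lerN2 ler_int.
have high m : (k < m)%R -> k%:~R + 1 - x <= `|x - m%:~R|.
  move=> km; rewrite ler_normr; apply/orP; right.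
  have : (k + 1)%:~R <= m%:~R :> R by rewrite ler_int; lia.
  rewrite intrD; lra.
case: (lerP (x - k%:~R) (k%:~R + 1 - x)) => hx.
  exists k; apply/eqP; rewrite eq_le dist_int_le /=.
  apply: dist_int_ge => m; rewrite (ger0_norm (x := x - k%:~R)); last lra.
  by case: (lerP m k) => [/low //|/high]; apply: le_trans.
exists (k + 1); apply/eqP; rewrite eq_le dist_int_le /=.
apply: dist_int_ge => m; rewrite intrD (ler0_norm (x := x - _)); last by lra.
case: (lerP m k) => [/low hm|/high hm]; lra.
Qed.

Lemma dist_int_ge0 x : 0 <= dist_int x.
Proof. by apply: dist_int_ge. Qed.

Lemma dist_int_half x : dist_int x <= 2^-1.
Proof.
have [h1 h2] := floor_itv1 x.
have := dist_int_le x (Num.floor x + 1); have := dist_int_le x (Num.floor x).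
rewrite intrD ger0_norm ?ler0_norm; lra.
Qed.

Lemma dist_intN x : dist_int (- x) = dist_int x.
Proof.
have le y : dist_int (- y) <= dist_int y.
  have [m ->] := dist_int_attained y.
  by have := dist_int_le (- y) (- m); rewrite intrN -opprD normrN.
by apply/eqP; rewrite eq_le le /=; have := le (- x); rewrite opprK.
Qed.

Lemma dist_int_lip x y : dist_int x <= dist_int y + `|x - y|.
Proof.
have [m ->] := dist_int_attained y; apply: le_trans (dist_int_le x m) _.
have -> : x - m%:~R = (y - m%:~R) + (x - y) by lra.
exact: ler_normD.
Qed.

(** Loneliness at level c is used as membership in one of the intervals between
consecutive integers, shortened by c at both ends. *)
Lemma dist_int_itv x c : c <= 2^-1 ->
  (c <= dist_int x) <-> exists m, m%:~R + c <= x /\ x <= m%:~R + 1 - c.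
Proof.
move=> c2; split=> [/dist_intP cx | [m [mx xm]]].
  exists (Num.floor x).
  have [h1 h2] := floor_itv1 x.
  have := cx (Num.floor x + 1); have := cx (Num.floor x).
  rewrite intrD ger0_norm ?ler0_norm; lra.
apply: dist_int_ge => k; rewrite ler_normr.
case: (lerP k m) => km.
  have : k%:~R <= m%:~R :> R by rewrite ler_int.
  move=> ?; apply/orP; left; lra.
have : (m + 1)%:~R <= k%:~R :> R by rewrite ler_int; lia.
rewrite intrD => ?; apply/orP; right; lra.
Qed.

Lemma dist_int_itv_lt x c : c < 2^-1 ->
  (c < dist_int x) <-> exists m, m%:~R + c < x /\ x < m%:~R + 1 - c.
Proof.
move=> c2; split=> [cx | [m [mx xm]]].
  have [m [h1 h2]] := (dist_int_itv _ (dist_int_half x)).1 (lexx _).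
  by exists m; split; lra.
(* A level d above c at which the weak version applies. *)
set d := Num.min (2^-1) (Num.min (x - m%:~R) (m%:~R + 1 - x)).
have cd : c < d by rewrite !lt_min; apply/and3P; split; lra.
apply: lt_le_trans cd _; apply/dist_int_itv; first by rewrite ge_min lexx.
have d1 : d <= x - m%:~R by rewrite !ge_min lexx /= orbT.
have d2 : d <= m%:~R + 1 - x by rewrite !ge_min lexx !orbT.
by exists m; split; lra.
Qed.

Lemma dist_int_ratio (a q : nat) : (0 < q)%N ->
  dist_int (a%:R / q%:R : R) = (minn (a %% q) (q - a %% q))%:R / q%:R.
Proof.
move=> q0; have q0' : 0 < q%:R :> R by rewrite ltr0n.
have aE : a%:R / q%:R = (a %% q)%:R / q%:R + (a %/ q)%:Z%:~R :> R.
  rewrite [in LHS](divn_eq a q) natrD natrM mulrDl mulfK ?gt_eqF //.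
  by rewrite addrC.
rewrite aE dist_int_shift.
have rq := ltn_pmod a q0; set r := (a %% q)%N in rq *.
have r0 : 0 <= r%:R / q%:R :> R by rewrite divr_ge0.
have r1 : r%:R / q%:R <= 1 :> R by rewrite ler_pdivrMr // mul1r ler_nat ltnW.
have qr : (q - r)%:R / q%:R = 1 - r%:R / q%:R :> R.
  by rewrite natrB 1?ltnW // mulrBl divff ?gt_eqF.
apply/eqP; rewrite eq_le; apply/andP; split.
  case: (leqP r (q - r)) => h.
    by have := dist_int_le (r%:R / q%:R) 0; rewrite subr0 ger0_norm.
  have := dist_int_le (r%:R / q%:R) 1; rewrite qr ler0_norm; last lra.
  lra.
have m1 : (minn r (q - r))%:R / q%:R <= r%:R / q%:R :> R.
  by rewrite ler_pM2r ?invr_gt0 // ler_nat geq_minl.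
have m2 : (minn r (q - r))%:R / q%:R <= 1 - r%:R / q%:R :> R.
  by rewrite -qr ler_pM2r ?invr_gt0 // ler_nat geq_minr.
apply/dist_int_itv; first lra.
by exists 0; split; rewrite ?add0r //; lra.
Qed.

Lemma nearest x : exists m, `|x - m%:~R| <= 2^-1.
Proof.
by have [m mE] := dist_int_attained x; exists m; rewrite -mE dist_int_half.
Qed.

End DistInt.

Section Hit.
Context {R : realType}.

(** Modulo one the line through the origin with coprime slopes a and b meets
each vertical circle in a translate of the subgroup of order a. *)
Lemma hit_vertical (a b : int) (x c : R) : 0 < a -> coprimez a b ->
  exists t : R, exists m : int, exists n : int,
    t * a%:~R = x + m%:~R /\ `|t * b%:~R - c - n%:~R| <= (2 * a%:~R)^-1.
Proof.
move=> a0 /coprimezP[[u v] /= uv].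
have a0' : 0 < a%:~R :> R by rewrite ltr0z.
have [r hr] := nearest (a%:~R * (c - x * b%:~R / a%:~R)).
pose m := r * v; exists ((x + m%:~R) / a%:~R), m, (- (r * u)).
split; first by rewrite divfK ?gt_eqF.
have bE : v%:~R * b%:~R = 1 - u%:~R * a%:~R :> R.
  by rewrite -!intrM -[1]/(1%:~R) -intrB; congr _%:~R; lia.
have -> : (x + m%:~R) / a%:~R * b%:~R - c - (- (r * u))%:~R
   = - (a%:~R * (c - x * b%:~R / a%:~R) - r%:~R) / a%:~R :> R.
  have -> : (x + m%:~R) / a%:~R * b%:~R =
            x / a%:~R * b%:~R + r%:~R * (v%:~R * b%:~R) / a%:~R :> R.
    by rewrite /m intrM; field; rewrite gt_eqF.
  by rewrite bE intrN intrM; field; rewrite gt_eqF.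
rewrite normrM normrN normfV (gtr0_norm a0') invfM ler_pM2r ?invr_gt0 //.
Qed.

End Hit.

(** * Lonely runners *)

(** Speeds are considered as lists of natural numbers: order, repetitions and
signs do not influence the loneliness that can be reached. *)
Section Lonely.
Context {R : realType}.
Implicit Types (c t : R) (s : seq nat).

Definition lonely c s := exists t : R, {in s, forall v : nat, c <= dist_int (t * v%:R)}.
Definition strictly_lonely c s :=
  exists t : R, {in s, forall v : nat, c < dist_int (t * v%:R)}.

Lemma dist_int_absz t (z : int) : dist_int (t * `|z|%N%:R) = dist_int (t * z%:~R).
Proof.
rewrite natr_absz intr_norm.
case: (lerP 0 (z%:~R : R)) => z0; first by rewrite ger0_norm.
by rewrite ltr0_norm // mulrN dist_intN.
Qed.

Lemma lonely_sub c s s' : {subset s <= s'} -> lonely c s' -> lonely c s.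
Proof. by move=> ss [t ht]; exists t => v /ss/ht. Qed.

Lemma strictly_lonely_sub c s s' :
  {subset s <= s'} -> strictly_lonely c s' -> strictly_lonely c s.
Proof. by move=> ss [t ht]; exists t => v /ss/ht. Qed.

Lemma lonely_le c c' s : c' <= c -> lonely c s -> lonely c' s.
Proof. by move=> cc [t ht]; exists t => v /ht; apply: le_trans. Qed.

Lemma lonely_strict c c' s : c' < c -> lonely c s -> strictly_lonely c' s.
Proof. by move=> cc [t ht]; exists t => v /ht; apply: lt_le_trans. Qed.

Lemma lonely_scale c s (g : nat) : (0 < g)%N ->
  lonely c s -> lonely c [seq (g * v)%N | v <- s].
Proof.
move=> g0 [t ht]; exists (t / g%:R) => _ /mapP[v vs ->].
by rewrite natrM mulrA divfK ?ht // pnatr_eq0 -lt0n.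
Qed.

Lemma strictly_lonely_scale c s (g : nat) : (0 < g)%N ->
  strictly_lonely c s -> strictly_lonely c [seq (g * v)%N | v <- s].
Proof.
move=> g0 [t ht]; exists (t / g%:R) => _ /mapP[v vs ->].
by rewrite natrM mulrA divfK ?ht // pnatr_eq0 -lt0n.
Qed.

End Lonely.

Definition gcds (s : seq nat) := foldr gcdn 0%N s.

Lemma gcds_dvd s v : v \in s -> (gcds s %| v)%N.
Proof.
elim: s => //= a s IH; rewrite inE => /orP[/eqP->|/IH]; first exact: dvdn_gcdl.
exact/dvdn_trans/dvdn_gcdr.
Qed.

Lemma dvd_gcds s d : (d %| gcds s)%N = all (fun v => d %| v)%N s.
Proof. by elim: s => [|a s IH] //=; rewrite ?dvdn0 // dvdn_gcd IH. Qed.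

Lemma gcds_map s g : gcds [seq (g * v)%N | v <- s] = (g * gcds s)%N.
Proof. by elim: s => [|a s IH] //=; rewrite ?muln0 // IH muln_gcdr. Qed.

Lemma gcds_perm s s' : perm_eq s s' -> gcds s = gcds s'.
Proof.
move=> ss; apply/eqP; rewrite eqn_dvd !dvd_gcds.
apply/andP; split; apply/allP => v; first by rewrite -(perm_mem ss); apply: gcds_dvd.
by rewrite (perm_mem ss); apply: gcds_dvd.
Qed.

Lemma primitive_part s : s != [::] -> all (fun v => 0 < v)%N s ->
  exists g s', [/\ (0 < g)%N, s = [seq (g * v)%N | v <- s'],
    all (fun v => 0 < v)%N s' & gcds s' = 1%N].
Proof.
move=> s0 sp; set g := gcds s.
have g0 : (0 < g)%N.
  case: s s0 sp @g => //= a s _ /andP[a0 _].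
  by rewrite gcdn_gt0 a0.
exists g, [seq v %/ g | v <- s]%N.
have sE : s = [seq (g * v)%N | v <- [seq v %/ g | v <- s]%N].
  rewrite -map_comp -[LHS]map_id; apply/eq_in_map => v vs /=.
  by rewrite mulnC divnK // gcds_dvd.
split=> //.
  apply/allP => _ /mapP[v vs ->].
  by rewrite divn_gt0 // dvdn_leq ?gcds_dvd // (allP sp).
have : gcds s = (g * gcds [seq v %/ g | v <- s])%N by rewrite {1}sE gcds_map.
by rewrite -/g => /eqP; rewrite -{1}[g]muln1 eqn_pmul2l // => /eqP.
Qed.

Section TwoRunners.
Context {R : realType}.

(** After division by the common factor let N be the sum of the speeds. At the
times with integral N t the runners are opposite to each other, and the positions
of one of them are the multiples of 1 / N; if N is at least 3, one of these lies
between 1/3 and 2/3. *)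
Lemma two_runners (a b : nat) : (0 < a)%N -> (0 < b)%N ->
  lonely (3^-1 : R) [:: a; b].
Proof.
move=> a0 b0.
have [] // := @primitive_part [:: a; b]; first by rewrite /= a0 b0.
move=> g [[|p [|q [|? ?]]] [g0 // [-> ->] /and3P[p0 q0 _]]].
rewrite /gcds /= gcdn0 => pq; apply: (lonely_scale (s := [:: p; q]) g0) => {a b a0 b0}.
have N0 : 0 < (p + q)%N%:Z by lia.
have pN : coprimez (p + q)%N p.
  by rewrite /coprimez /gcdz /= gcdnC gcdnDl pq.
have [N2|N3] : (p + q = 2 \/ 3 <= p + q)%N by lia.
  have [-> ->] : p = 1%N /\ q = 1%N by lia.
  exists 2^-1 => v; rewrite !inE orbb => /eqP ->; rewrite mulr1.
  by apply/dist_int_itv; [lra | exists 0; split; lra].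
have [t [m [n [tN tp]]]] := hit_vertical (0 : R) 2^-1 N0 pN.
have N3' : 3%:R <= (p + q)%N%:Z%:~R :> R by rewrite -[_%:~R]/(_%:R) ler_nat.
have iN : (2 * (p + q)%N%:Z%:~R)^-1 <= 6^-1 :> R by rewrite lef_pV2 ?posrE; lra.
have tp3 : 3^-1 <= dist_int (t * p%:R).
  apply/dist_int_itv; first lra.
  by exists n; move: tp; rewrite ler_norml => /andP[? ?]; split; lra.
exists t => v; rewrite !inE => /orP[/eqP -> //|/eqP ->].
have -> : t * q%:R = - (t * p%:R) + m%:~R.
  by move: tN; rewrite -[_%:~R]/(_%:R) natrD; lra.
by rewrite dist_int_shift dist_intN.
Qed.

End TwoRunners.

(** * Planes and Dirichlet's theorem *)

(** A rational plane in n-space is described by the n linear forms that it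
induces on the coordinates; it contains, for each vector g, the line on which
the forms take the values det f g. *)
Definition form : Type := (int * int)%type.
Definition det (f g : form) : int := f.1 * g.2 - g.1 * f.2.

Section Planes.
Context {R : realType}.
Implicit Types (c x y t : R) (f g : form) (s : seq form).

Definition value x y f : R := x * f.1%:~R + y * f.2%:~R.

Definition plane_lonely c s :=
  exists x y : R, {in s, forall f, c <= dist_int (value x y f)}.
Definition plane_strictly_lonely c s :=
  exists x y : R, {in s, forall f, c < dist_int (value x y f)}.

Lemma value_det t f g : value (t * g.2%:~R) (- t * g.1%:~R) f = t * (det f g)%:~R.
Proof. by rewrite /value /det intrB !intrM; ring. Qed.

Lemma plane_lonely_line c s g :
  lonely c [seq `|det f g|%N | f <- s] -> plane_lonely c s.
Proof.
move=> [t ht]; exists (t * g.2%:~R), (- t * g.1%:~R) => f fs.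
by rewrite value_det -dist_int_absz; apply/ht/map_f.
Qed.

Lemma plane_strictly_lonely_line c s g :
  strictly_lonely c [seq `|det f g|%N | f <- s] -> plane_strictly_lonely c s.
Proof.
move=> [t ht]; exists (t * g.2%:~R), (- t * g.1%:~R) => f fs.
by rewrite value_det -dist_int_absz; apply/ht/map_f.
Qed.

(** Dirichlet: a line with a large speed M comes back close to the origin, and
so it runs densely in a plane. The times m / M are distributed over the boxes
of side 1 / h; two of them lie in the same box, and their difference q / M is
the return time. The forms record the speeds and the windings of the return;
since the speeds have gcd 1 and q < M, these two vectors are independent. *)
Lemma dirichlet_plane (M : nat) (us : seq nat) (h : nat) :
  (0 < h)%N -> (h ^ size us < M)%N -> all (fun u => 0 < u)%N us ->
  gcds (M :: us) = 1%N ->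
  exists s : seq form,
    [/\ [seq f.1 | f <- s] = [seq u%:Z | u <- M :: us],
        exists f g, [/\ f \in s, g \in s & det f g != 0] &
        forall c, plane_lonely c s -> lonely (c - (2 * h%:R)^-1) (M :: us)].
Proof.
move=> h0 hM us0 gcd1; have M0 : (0 < M)%N by apply: leq_ltn_trans hM.
pose cell (m : 'I_M) : (size us).-tuple 'I_h :=
  map_tuple (fun u => Ordinal (ltn_pmod ((m * u %% M) * h %/ M) h0)) (in_tuple us).
have [m [m' [mm' cells]]] : exists m m', m != m' /\ cell m = cell m'.
  have /injectivePn[m [m' mm' cells]] : ~~ injectiveb cell.
    apply/negP => /injectiveP/leq_card.
    by rewrite card_ord card_tuple card_ord leqNgt hM.
  by exists m, m'.
wlog mlt : m m' mm' cells / (m' < m)%N.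
  move=> H; case: (ltngtP m' m) => [|lt|/val_inj e]; first exact: H mm' cells.
    by apply: H lt; rewrite 1?eq_sym.
  by rewrite e eqxx in mm'.
pose q := (m - m')%N; pose w u : int := (m * u %/ M)%N%:Z - (m' * u %/ M)%N%:Z.
have qM : (0 < q < M)%N by have := ltn_ord m; rewrite /q; lia.
have close u : u \in M :: us -> `|h%:Z * (q%:Z * u%:Z - M%:Z * w u)| <= M%:Z.
  move=> uM; have mE := divn_eq (m * u) M; have mE' := divn_eq (m' * u) M.
  have -> : q%:Z * u%:Z - M%:Z * w u = (m * u %% M)%N%:Z - (m' * u %% M)%N%:Z.
    have -> : q%:Z * u%:Z = (m * u)%N%:Z - (m' * u)%N%:Z.
      by rewrite -PoszM mulnBl subzn // leq_mul2r (ltnW mlt) orbT.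
    by rewrite [in LHS]mE [in LHS]mE' /w; lia.
  move: uM; rewrite inE => /orP[/eqP->|]; first by rewrite !modnMl subrr mulr0.
  case/(nthP 0%N) => i iu uE.
  have: tnth (cell m) (Ordinal iu) = tnth (cell m') (Ordinal iu) by rewrite cells.
  rewrite !tnth_map (tnth_nth 0%N) /= uE => /(congr1 val) /=.
  have small z : (z %% M * h %/ M < h)%N.
    by rewrite ltn_divLR // mulnC ltn_pmul2l // ltn_pmod.
  rewrite (modn_small (small _)) (modn_small (small _)) => eq.
  have d1 := divn_eq (m * u %% M * h) M; have d2 := divn_eq (m' * u %% M * h) M.
  have r1 := ltn_pmod (m * u %% M * h) M0; have r2 := ltn_pmod (m' * u %% M * h) M0.
  by rewrite eq in d1; lia.
exists [seq (u%:Z, w u) | u <- M :: us]; split.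
- by rewrite -map_comp.
- have wM : w M = q%:Z by rewrite /w !mulnK // /q; lia.
  apply: contrapT => par.
  have dvd u : u \in M :: us -> (M %| q * u)%N.
    move=> uM; apply: contrapT => ndvd; apply: par.
    exists (u%:Z, w u), (M%:Z, q%:Z); split; first exact: (map_f (fun u => (u%:Z, w u))).
      by rewrite -wM; apply: (map_f (fun u => (u%:Z, w u))); rewrite mem_head.
    apply/eqP; rewrite /det /= => e; apply: ndvd.
    have : (M%:Z %| (q * u)%N%:Z)%Z.
      by apply/dvdzP; exists (w u); rewrite PoszM; lia.
    by [].
  have : (M %| gcds [seq (q * u)%N | u <- M :: us])%N.
    by rewrite dvd_gcds; apply/allP => _ /mapP[u uM ->]; apply: dvd.
  by rewrite gcds_map gcd1 muln1 => /dvdn_leq; lia.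
- move=> c [x [y xy]]; have [k hk] := nearest y; pose r := y - k%:~R.
  have M0' : 0 < M%:R :> R by rewrite ltr0n.
  have h0' : 0 < h%:R :> R by rewrite ltr0n.
  exists (x + r * (q%:R / M%:R)) => u uM.
  have := xy (u%:Z, w u) (map_f (fun u => (u%:Z, w u)) uM).
  pose d : R := q%:R / M%:R * u%:R - (w u)%:~R.
  have -> : value x y (u%:Z, w u) =
      ((x + r * (q%:R / M%:R)) * u%:R - r * d) + (k * w u)%:~R.
    by rewrite /value /= intrM /d /r; ring.
  rewrite dist_int_shift => cd; have := le_trans cd (dist_int_lip _ ((x + r * (q%:R / M%:R)) * u%:R)).
  rewrite -lerBlDr; apply: le_trans; rewrite lerD2l lerN2.
  have dle : `|d| <= h%:R^-1.
    have := close u uM; rewrite -(ler_int R) !intr_norm !rmorphM rmorphB !rmorphM /=.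
    have -> : h%:Z%:~R * (q%:Z%:~R * u%:Z%:~R - M%:Z%:~R * (w u)%:~R) = h%:R * M%:R * d :> R.
      by rewrite /d -!pmulrn; field; rewrite gt_eqF.
    rewrite !normrM (gtr0_norm h0') (gtr0_norm M0') -pmulrn => le.
    rewrite -(ler_pM2l (mulr_gt0 h0' M0')).
    by apply: le_trans le _; rewrite [X in _ <= X]mulrAC divff ?gt_eqF // mul1r.
  have -> : (x + r * (q%:R / M%:R)) * u%:R - r * d - (x + r * (q%:R / M%:R)) * u%:R = - (r * d).
    by ring.
  rewrite normrN normrM invfM; apply: ler_pM => //.
Qed.

End Planes.

(** * Tuples that block given times *)

(** A time t = p / q is blocked by a speed v when v is too close to an integer
multiple at that time. A tuple without a good time blocks every time of a
chosen list, and the tuples of bounded speeds that do so are enumerated: some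
member blocks the first time that is not yet blocked. A row is a speed with the
list of truth values saying which of the remaining times it blocks. Members chosen
later on come after the earlier ones among the candidates for the same time, or do
not block that time, so that a set of speeds is not met in all its orders. *)
Definition row : Type := (nat * bitseq)%type.

Fixpoint keep_open (d r : bitseq) : bitseq :=
  match d, r with
  | b :: d', c :: r' => if b then keep_open d' r' else c :: keep_open d' r'
  | _, _ => [::]
  end.

Fixpoint covers (d r : bitseq) : bool :=
  match d, r with
  | b :: d', c :: r' =>
      if b then covers d' r' else if c then covers d' r' else false
  | _, _ => true
  end.

Fixpoint blockers (rs : seq row) : seq row :=
  match rs with
  | (v, c :: r) :: rs' => if c then (v, r) :: blockers rs' else blockers rs'
  | _ => [::]
  end.

Fixpoint nonblockers (rs : seq row) : seq row :=
  match rs with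
  | (v, c :: r) :: rs' => if c then nonblockers rs' else (v, r) :: nonblockers rs'
  | _ => [::]
  end.

Fixpoint drop_first (rs : seq row) : seq row :=
  match rs with
  | (v, _ :: r) :: rs' => (v, r) :: drop_first rs'
  | _ => [::]
  end.

(** Only the length of fuel matters: it is the number of remaining times. *)
Fixpoint blockers_by_time (fuel : bitseq) (rs : seq row) : seq (seq row) :=
  if fuel is _ :: f then blockers rs :: blockers_by_time f (drop_first rs) else [::].

Fixpoint reduce (d : bitseq) (rs acc : seq row) : seq row :=
  if rs is (v, r) :: rs' then (v, keep_open d r) :: reduce d rs' acc else acc.

Section Search.
Context (P : seq nat -> bool).

Fixpoint last_speed (d : bitseq) (c : seq row) acc : bool :=
  if c is (e, r) :: c' then
    if covers d r then P (e :: acc) && last_speed d c' acc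
    else last_speed d c' acc
  else true.

Fixpoint leaf (d : bitseq) (cs : seq (seq row)) acc : bool :=
  match d, cs with
  | true :: d', _ :: cs' => leaf d' cs' acc
  | false :: d', c :: cs' => last_speed d' c acc
  | _, _ => false
  end.

Fixpoint pairs (h : seq row) (cs : seq (seq row)) acc : bool :=
  if h is (v, r) :: h' then
    if leaf r cs (v :: acc) then pairs h' cs acc else false
  else true.

Fixpoint choices (next : seq row -> seq nat -> bool) (z : seq row) acc
    (h : seq row) : bool :=
  if h is (v, r) :: h' then
    if next (reduce r h' (reduce r z [::])) (v :: acc)
    then choices next z acc h' else false
  else true.

(* The last two speeds are found together: the candidates for the last one are
   listed once for all choices of the other one. *)
Fixpoint search (k : nat) (rs : seq row) (acc : seq nat) : bool :=
  match k with
  | 0 => (match rs with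
         | (_, _ :: f) :: _ => pairs (blockers rs) (blockers_by_time f (drop_first rs)) acc
         | [::] => true
         | _ => false
         end)
  | k'.+1 => (match rs with
         | (_, _ :: f) :: _ =>
           choices (search k') (nonblockers rs) acc (blockers rs)
         | [::] => true
         | _ => false
         end)
  end.

Definition behead_row (x : row) : row := (x.1, behead x.2).
Definition blocks (x : row) : bool := head false x.2.

Fixpoint blocked (d : bitseq) (l : seq row) : bool :=
  if d is b :: d' then
    (b || has blocks l) && blocked d' [seq behead_row x | x <- l]
  else true.

Lemma blocked_mem d l l' : l =i l' -> blocked d l = blocked d l'.
Proof.
elim: d l l' => //= b d IH l l' ll; congr (_ && _).
  by rewrite (eq_has_r ll).
by apply: IH => x; apply: eq_mem_map.
Qed.

Lemma blocked_cons v r l :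
  blocked (nseq (size r) false) ((v, r) :: l) -> blocked r l.
Proof.
elim: r l => //= b r IH l /andP[h1 h2].
by rewrite IH // andbT; case: b h1 h2.
Qed.

Lemma blocked_keep_open r l : all (fun x : row => size x.2 == size r) l ->
  blocked r l ->
  blocked (nseq (count negb r) false) [seq (x.1, keep_open r x.2) | x <- l].
Proof.
elim: r l => //= b r IH l szl /andP[h1 h2].
have szl' : all (fun x : row => size x.2 == size r) [seq behead_row x | x <- l].
  rewrite all_map; apply: sub_all szl => -[v x] /= /eqP xs.
  by rewrite size_behead xs.
have := IH _ szl' h2; rewrite -map_comp.
case: b h1 => /= h1.
  rewrite add0n; congr (blocked _ _ = true); apply/eq_in_map => -[v x] xl /=.
  by have := allP szl _ xl => /=; case: x {xl}.
move=> h3; apply/andP; split.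
  case/hasP: h1 => -[v x] xl; rewrite /blocks /= => hx.
  apply/hasP; exists (v, keep_open (false :: r) x).
    by apply/mapP; exists (v, x).
  by have := allP szl _ xl => /=; case: x hx {xl} => //= c x ->.
move: h3; rewrite -map_comp; congr (blocked _ _ = true); apply/eq_in_map => -[v x] xl /=.
by rewrite /behead_row /=; have := allP szl _ xl => /=; case: x {xl}.
Qed.

Lemma covers_blocked e d r : size r = size d -> blocked d [:: (e, r)] -> covers d r.
Proof.
elim: d r => //= b d IH [|c r] //= [sz] /andP[].
by rewrite /blocks /= orbF => bc /(IH _ sz) ->; case: b c bc => [] [].
Qed.

Lemma mem_drop_first rs x : all (fun y : row => 0 < size y.2)%N rs ->
  x \in rs -> behead_row x \in drop_first rs.
Proof.
elim: rs => // -[v [|c r]] rs IH //= /IH IH'.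
by rewrite !inE => /orP[/eqP->|/IH' ->]; rewrite ?eqxx ?orbT.
Qed.

Lemma mem_blockers rs x : all (fun y : row => 0 < size y.2)%N rs ->
  x \in rs -> blocks x -> behead_row x \in blockers rs.
Proof.
elim: rs => // -[v [|c r]] rs IH //= /IH IH'.
rewrite !inE => /orP[/eqP->|xr bx]; first by rewrite /blocks /= => ->; rewrite mem_head.
by case: c; rewrite ?inE IH' ?orbT.
Qed.

Lemma mem_blockers_nonblockers rs x : all (fun y : row => 0 < size y.2)%N rs ->
  x \in rs -> behead_row x \in blockers rs ++ nonblockers rs.
Proof.
elim: rs => // -[v [|c r]] rs IH //= /IH IH'.
rewrite inE => /orP[/eqP->|/IH' ].
  by case: c; rewrite ?mem_cat ?mem_head ?orbT.
by rewrite !mem_cat => /orP[]; case: c; rewrite ?inE => ->; rewrite ?orbT.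
Qed.

Lemma sizes_blockers rs T : all (fun y : row => size y.2 == T.+1) rs ->
  all (fun y : row => size y.2 == T) (blockers rs) /\
  all (fun y : row => size y.2 == T) (nonblockers rs) /\
  all (fun y : row => size y.2 == T) (drop_first rs).
Proof.
elim: rs => // -[v [|c r]] rs IH //=; rewrite eqSS => /andP[rT /IH[h1 [h2 h3]]].
by case: c => /=; rewrite rT h1 h2 h3.
Qed.

Lemma last_speedP d c acc e r : last_speed d c acc -> (e, r) \in c ->
  covers d r -> P (e :: acc).
Proof.
elim: c => // -[e' r'] c IH /=; rewrite inE => H /orP[/eqP[-> ->] cr|ec cr].
  by move: H; rewrite cr => /andP[].
by apply: IH ec cr; move: H; case: covers => // /andP[].
Qed.

Lemma leafP d f rs acc x : leaf d (blockers_by_time f rs) acc ->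
  all (fun y : row => size y.2 == size d) rs ->
  x \in rs -> blocked d [:: x] -> P (x.1 :: acc).
Proof.
elim: d f rs x => [|b d IH] [|c f] rs x //=; first by case: b.
move=> H sz xr; have [_ [_ sz3]] := sizes_blockers sz.
have pos : all (fun y : row => 0 < size y.2)%N rs.
  by apply: sub_all sz => y /eqP ->.
rewrite orbF => /andP[bx hx].
case: b H bx => /= H bx; first exact: IH H sz3 (mem_drop_first pos xr) hx.
have xh := mem_blockers pos xr bx.
apply: (last_speedP (r := behead x.2) H); first by move: xh; rewrite /behead_row.
apply: covers_blocked hx.
by rewrite size_behead (eqP (allP sz _ xr)).
Qed.

Lemma pairsP h cs acc v r : pairs h cs acc -> (v, r) \in h -> leaf r cs (v :: acc).
Proof.
elim: h => // -[v' r'] h IH /=; rewrite inE; case: ifP => // lf ph.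
by case/orP=> [/eqP[-> ->]|/(IH ph)].
Qed.

Lemma reduceE d rs acc : reduce d rs acc = [seq (x.1, keep_open d x.2) | x <- rs] ++ acc.
Proof. by elim: rs => // -[v r] rs IH /=; rewrite IH. Qed.

Lemma size_keep_open d r : size r = size d -> size (keep_open d r) = count negb d.
Proof. by elim: d r => [|b d IH] [|c r] //= [/IH <-]; case: b. Qed.

Lemma search_pairsP T rs acc x1 x2 : search 0 rs acc ->
  all (fun y : row => size y.2 == T) rs -> x1 \in rs -> x2 \in rs ->
  blocked (nseq T false) [:: x1; x2] -> blocks x1 ->
  P [:: x2.1, x1.1 & acc].
Proof.
case: rs => [|[v0 [|c0 f]] rs0] //; set rs := _ :: rs0 => H sz x1r x2r bl b1.
have TE : T = (size f).+1 by have /eqP := allP sz _ (mem_head _ _).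
subst T; have [sz1 [_ sz3]] := sizes_blockers sz.
have pos : all (fun y : row => 0 < size y.2)%N rs.
  by apply: sub_all sz => y /eqP ->.
have x1h := mem_blockers pos x1r b1.
have sz1' : size (behead x1.2) = size f by rewrite (eqP (allP sz1 _ x1h)).
apply: (leafP (x := behead_row x2) (pairsP H x1h)).
- by rewrite sz1'.
- exact: mem_drop_first pos x2r.
- apply: (@blocked_cons x1.1); rewrite sz1'.
  by move: bl => /= /andP[].
Qed.

(** Some member blocks the first open time, and the search branches over the
candidates for it. The candidates treated before are removed, since the tuples that
contain one of them have been met already. *)
Lemma searchP k T rs acc (l : seq row) : search k rs acc ->
  all (fun y : row => size y.2 == T) rs -> size l = k.+2 ->
  uniq [seq x.1 | x <- l] -> {subset l <= rs} -> blocked (nseq T false) l ->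
  exists2 l' : seq nat, perm_eq l' ([seq x.1 | x <- l] ++ acc) & P l'.
Proof.
elim: k T rs acc l => [|k IH] T rs acc l.
  case: l => [|x1 [|x2 [|? ?]]] // H sz _ _ sub bl.
  have x1r : x1 \in rs by apply: sub; rewrite mem_head.
  have x2r : x2 \in rs by apply: sub; rewrite !inE eqxx orbT.
  have T0 : exists T', T = T'.+1.
    by case: T sz bl => [|T' _ _]; [case: rs H {sub} x1r x2r => [|[? [|? ?]]] | exists T'].
  have : has blocks [:: x1; x2] by case: T0 bl {sz} => T' -> /= /andP[].
  rewrite /= orbF => /orP[b1|b2].
    exists [:: x2.1, x1.1 & acc]; first exact: (permEl (perm_catCA [:: x2.1] [:: x1.1] acc)).
    exact: (search_pairsP H sz).
  exists [:: x1.1, x2.1 & acc]; first exact: perm_refl.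
  apply: (search_pairsP H sz) => //.
  by rewrite -(blocked_mem _ (l := [:: x1; x2])) // => z; rewrite !inE orbC.
case: rs => [|[v0 [|c0 f]] rs0] //.
  by move=> _ _; case: l => // x l _ _ sub; have := sub _ (mem_head _ _).
set rs := _ :: rs0 => H sz szl ul sub bl.
have TE : T = (size f).+1 by have /eqP := allP sz _ (mem_head _ _).
subst T; have [sz1 [sz2 _]] := sizes_blockers sz.
have pos : all (fun y : row => 0 < size y.2)%N rs.
  by apply: sub_all sz => y /eqP ->.
move: H; rewrite [search _ _ _]/(choices (search k) (nonblockers rs) acc (blockers rs)) => H.
set z := nonblockers _ in sz2 H *.
have loopP h lt : choices (search k) z acc h -> all (fun y : row => size y.2 == size f) h ->
    {subset lt <= h ++ z} -> uniq [seq x.1 | x <- lt] -> size lt = k.+3 ->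
    has (mem h) lt -> blocked (nseq (size f) false) lt ->
    exists2 l' : seq nat, perm_eq l' ([seq x.1 | x <- lt] ++ acc) & P l'.
  elim: h => [|[v r] h IHh] /=; first by move=> _ _ _ _ _ /hasP[].
  case: ifP => // Hs Hl /andP[/eqP rf hf] sublt ult szlt hlt blt.
  have [vlt|vlt] := boolP ((v, r) \in lt); last first.
    apply: IHh => //.
      move=> x xl; have := sublt _ xl; rewrite inE => /orP[/eqP xE|//].
      by rewrite xE (negPf vlt) in xl.
    case/hasP: hlt => x xl; rewrite inE => /orP[/eqP xE|xh].
      by rewrite xE (negPf vlt) in xl.
    by apply/hasP; exists x.
  have pl := perm_to_rem vlt; set lt' := rem _ lt in pl.
  have sublt' : {subset lt' <= h ++ z}.
    move=> x xl; have := sublt x; rewrite (perm_mem pl) inE xl orbT inE.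
    move=> /(_ isT)/orP[/eqP xE|//]; move: ult.
    rewrite (perm_uniq (perm_map _ pl)) /= => /andP[/negP[]].
    by apply/mapP; exists x; rewrite // xE.
  have szlt' : all (fun x : row => size x.2 == size r) lt'.
    apply/allP => x /sublt'; rewrite mem_cat rf => /orP[xh|xz].
      exact: (allP hf).
    exact: (allP sz2).
  pose lu := [seq (x.1, keep_open r x.2) | x <- lt'].
  have luE : [seq x.1 | x <- lu] = [seq x.1 | x <- lt'].
    by rewrite -map_comp.
  have [||||| l' pl' Pl'] := IH (count negb r) _ _ lu Hs.
  - rewrite !reduceE cats0 -map_cat all_map; apply/allP => x.
    rewrite mem_cat => /orP[xh|xz] /=; rewrite size_keep_open // rf.
      exact/eqP/(allP hf).
    exact/eqP/(allP sz2).
  - by rewrite size_map; move: szlt; rewrite (perm_size pl) => -[].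
  - rewrite luE; move: ult.
    by rewrite (perm_uniq (perm_map _ pl)) /= => /andP[].
  - move=> _ /mapP[x /sublt' xl ->]; rewrite !reduceE cats0 -map_cat.
    exact: (map_f (fun x : row => (x.1, keep_open r x.2))).
  - apply: blocked_keep_open => //; apply: (@blocked_cons v).
    by rewrite rf -(blocked_mem _ (perm_mem pl)).
  exists l' => //; apply: (perm_trans pl'); rewrite luE.
  rewrite perm_sym; have := perm_map (@fst nat bitseq) pl => pl1.
  rewrite (perm_trans (perm_cat pl1 (perm_refl acc))) //=.
  by rewrite -cat1s -[_ ++ v :: acc]/(_ ++ ([:: v] ++ acc)) perm_catCA.
have lE : [seq x.1 | x <- [seq behead_row x | x <- l]] = [seq x.1 | x <- l].
  by rewrite -map_comp.
rewrite -lE; apply: (loopP (blockers rs)) => //.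
- by move=> _ /mapP[x /sub xr ->]; apply: mem_blockers_nonblockers.
- by rewrite lE.
- by rewrite size_map.
- move: bl => /= /andP[/hasP[x xl bx] _]; apply/hasP; exists (behead_row x).
    exact: map_f.
  exact: mem_blockers (sub _ xl) bx.
- by move: bl => /= /andP[].
Qed.

End Search.

Definition tick (s : nat * nat * nat) : nat * nat * nat :=
  let: (p, q, r) := s in
  (p, q, let r' := (r + p)%N in if (q <= r')%N then (r' - q)%N else r').

Section Times.
Context (bad : nat -> nat -> bool).

(* The residues of p v modulo q are updated from one v to the next one. *)
Fixpoint rows (n v : nat) (st : seq (nat * nat * nat)) : seq row :=
  if n is n'.+1 then
    (v, [seq bad s.1.2 s.2 | s <- st]) :: rows n' v.+1 [seq tick s | s <- st]
  else [::].

Definition all_rows n (times : seq (nat * nat)) : seq row :=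
  rows n 1 [seq (s.1, s.2, s.1) | s <- times].

Lemma rowsE n v times : all (fun s : nat * nat => s.1 < s.2)%N times ->
  rows n v [seq (s.1, s.2, ((s.1 * v) %% s.2)%N) | s <- times] =
  [seq (u, [seq bad s.2 ((s.1 * u) %% s.2)%N | s <- times]) | u <- iota v n].
Proof.
move=> lt; elim: n v => //= n IH v; rewrite -IH -!map_comp /=; congr ((_, _) :: rows n _ _).
apply/eq_in_map => -[p q] /(allP lt) /= pq; congr (_, _).
have q0 : (0 < q)%N by lia.
have rq := ltn_pmod (p * v) q0.
have -> : ((p * v.+1) %% q = ((p * v) %% q + p) %% q)%N.
  by rewrite mulnS addnC modnDml.
case: leqP => h; last by rewrite (modn_small h).
by rewrite -[X in _ = (X %% _)%N](subnK h) modnDr [RHS]modn_small //; lia.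
Qed.

Lemma search_times P k n times (l : seq nat) :
  search P k (all_rows n times) [::] ->
  all (fun s : nat * nat => 0 < s.1 < s.2)%N times ->
  uniq l -> size l = k.+2 -> all (fun v => 0 < v <= n)%N l ->
  (exists2 s, s \in times & {in l, forall v, ~~ bad s.2 ((s.1 * v) %% s.2)}) \/
  exists2 l' : seq nat, perm_eq l' l & P l'.
Proof.
move=> H tpos ul szl ln.
have [[s st sg]|nogood] := pselect (exists2 s, s \in times &
    {in l, forall v, ~~ bad s.2 ((s.1 * v) %% s.2)}).
  by left; exists s.
right.
have tlt : all (fun s : nat * nat => s.1 < s.2)%N times.
  by apply: sub_all tpos => s /andP[].
pose mk v : row := (v, [seq bad s.2 ((s.1 * v) %% s.2)%N | s <- times]).
have rE : all_rows n times = [seq mk v | v <- iota 1 n].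
  rewrite -rowsE //; congr rows; apply/eq_in_map => s st.
  by rewrite muln1 modn_small // (allP tlt).
have lE : [seq x.1 | x <- [seq mk v | v <- l]] = l.
  by rewrite -map_comp map_id_in.
have [||||| l' pl' Pl'] := @searchP P k (size times) _ _ [seq mk v | v <- l] H.
- by rewrite rE all_map; apply/allP => v _ /=; rewrite size_map.
- by rewrite size_map.
- by rewrite lE.
- rewrite rE => _ /mapP[v vl ->]; apply: map_f.
  by rewrite mem_iota; have := allP ln _ vl; lia.
- rewrite /mk; elim: times nogood {H tpos tlt rE lE mk} => // s times IH ng /=.
  apply/andP; split.
    rewrite has_map; apply: contrapT => nb; apply: ng; exists s; first exact: mem_head.
    by move=> v vl; apply/negP => bv; apply: nb; apply/hasP; exists v.
  rewrite -map_comp; apply: IH => -[s' st' g]; apply: ng.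
  by exists s' => //; rewrite inE st' orbT.
by exists l' => //; rewrite -lE -[X in perm_eq _ X]cats0.
Qed.

End Times.

(** * Tuples of small speeds *)

(** The blocking relation for the thresholds num / den; the two versions aim at
weak and at strict loneliness. *)
Definition blocked_lt (num den q r : nat) := (den * minn r (q - r) < num * q)%N.
Definition blocked_le (num den q r : nat) := (den * minn r (q - r) <= num * q)%N.

(* The only requirement on the following three lists of times is that the searches
   below succeed. *)
Definition times3 : seq (nat * nat) := [::
  (1,168); (1,170); (1,164); (2,7); (1,161); (1,7); (3,7); (1,14); (1,2);
  (3,10); (3,14); (1,6); (1,10); (1,21); (5,17); (2,13); (1,3); (5,14);
  (2,21); (1,31); (2,129); (7,59); (3,76); (19,42); (8,143); (3,133);
  (15,31); (49,142); (4,51); (19,56); (62,147); (29,63); (9,28); (10,21);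
  (16,49); (3,17); (4,21); (9,38); (6,35); (8,21); (8,63); (4,35); (17,77);
  (25,63); (25,79); (13,35); (5,21); (19,52); (8,35); (12,35); (11,69);
  (18,37); (16,35); (1,24); (22,59); (24,77); (33,79); (8,17); (30,91);
  (23,94); (6,31); (5,38); (17,38); (5,28); (8,41); (24,97); (2,31); (1,35);
  (3,35); (1,55); (4,27); (11,35)]%N.

Definition times4 : seq (nat * nat) := [::
  (1,269); (1,271); (1,264); (1,254); (1,249); (1,244); (179,359); (1,3);
  (1,9); (2,9); (4,9); (1,119); (1,239); (2,239); (2,241); (2,243);
  (174,349); (1,14); (3,14); (5,14); (2,19); (4,19); (5,19); (6,19); (7,19);
  (1,19); (3,19); (8,19); (9,19); (1,8); (3,8); (1,24); (5,24); (7,24);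
  (11,24); (1,13); (6,13); (2,13); (3,13); (4,13); (5,13); (2,23); (1,18);
  (1,74); (20,49); (56,129); (13,69); (34,101); (16,43); (19,39); (17,42);
  (6,49); (15,76); (26,119); (11,23); (16,99); (31,88); (7,18); (15,52);
  (9,23); (9,122); (5,42); (26,147); (23,72); (55,112); (49,149); (1,29);
  (43,118); (2,123); (32,109); (38,117); (40,143); (9,29); (1,4); (7,109);
  (12,89); (4,29); (15,62); (45,103); (13,59); (5,34); (9,77); (15,38);
  (11,73); (15,89); (14,43); (1,88); (8,39); (60,139); (12,79); (2,59); (4,27)]%N.

Definition times5 : seq (nat * nat) := [::
  (1,5); (1,4); (1,163); (1,160); (1,155); (1,10); (3,10); (1,150); (1,15);
  (7,15); (1,145); (2,145); (107,215); (1,3); (1,9); (2,9); (4,9); (2,15);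
  (4,15); (1,75); (1,20); (3,20); (7,20); (9,20); (3,14); (5,14); (1,19);
  (3,25); (4,25); (6,25); (8,25); (9,25); (11,25); (1,14); (2,19); (3,19);
  (8,19); (9,19); (2,25); (7,25); (12,25); (1,50); (3,50); (3,8); (4,19);
  (5,19); (6,19); (7,19); (13,50); (37,75); (49,100); (1,8); (1,25); (7,50);
  (9,50); (11,50); (19,50); (8,75); (17,75); (32,75); (3,100); (33,100);
  (1,13); (2,13); (4,13); (5,13); (2,75); (4,75); (13,75); (29,75); (13,125);
  (14,125); (16,125); (18,125); (13,30); (14,29); (23,65); (6,29); (2,35);
  (22,75); (37,80); (3,35); (8,43); (14,55); (19,70); (28,69); (2,45);
  (17,39); (29,149); (74,149); (17,35); (23,50); (48,115); (9,95); (11,34);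
  (9,145); (11,40); (17,40); (11,80); (13,55); (2,59); (38,125); (29,64);
  (26,75); (6,35); (31,75); (13,38); (31,85); (37,130); (12,65); (11,95);
  (16,85); (8,45); (27,85); (11,24); (31,115); (41,100); (13,45); (9,29);
  (17,50); (9,59); (41,125); (19,65); (13,100); (26,85); (12,49); (9,44);
  (12,95); (23,139); (22,149); (3,40); (16,55); (13,80); (19,40); (1,44);
  (21,55); (26,55); (13,43); (21,50); (3,115); (10,29); (9,35); (19,45);
  (34,115); (21,58); (21,107); (9,115); (49,125); (17,45); (27,65); (12,145);
  (6,65); (12,89); (2,23); (5,23); (11,23); (12,43); (1,60); (19,61);
  (27,62); (71,145); (2,27); (13,29); (19,44); (7,155); (4,155); (3,155);
  (2,155)]%N.

(** Tuples with a common factor are skipped, since they are multiples of smaller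
ones. *)
Definition accept (tab : pred (seq nat)) (l : seq nat) :=
  (gcds l != 1%N) || tab (sort leq l).

Definition table3 : pred (seq nat) := pred1 [:: 1; 2; 3]%N.
Definition tight4 : pred (seq nat) := pred2 [:: 1; 2; 3; 4]%N [:: 1; 3; 4; 7]%N.
(** With [tight4], the primitive quintuples of speeds at most 130 without a time of
loneliness 1/5; the last condition of [table5] describes two infinite families. *)
Definition sporadic5 : seq (seq nat) := [::
  [:: 1; 2; 3; 5; 8]; [:: 1; 3; 4; 5; 7]; [:: 1; 3; 4; 5; 9];
  [:: 1; 3; 4; 5; 11]; [:: 1; 3; 4; 5; 18]; [:: 1; 3; 4; 5; 27];
  [:: 1; 4; 5; 6; 7]; [:: 1; 4; 5; 6; 27]; [:: 1; 7; 8; 9; 15];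
  [:: 2; 3; 5; 8; 19]; [:: 2; 5; 7; 8; 9]; [:: 3; 5; 8; 9; 13];
  [:: 3; 5; 8; 11; 13]]%N.
Definition table5 : pred (seq nat) := fun s =>
  (s \in sporadic5) || (tight4 (take 4 s) && (5 %| nth 0 s 4))%N.

(* The bounds 121 = 11^2 and 216 = 6^3 leave the larger speeds to Dirichlet's
   theorem. *)
Lemma search3 :
  search (accept table3) 1 (all_rows (blocked_lt 2 7) 121 times3) [::].
Proof. by vm_cast_no_check (erefl true). Qed.

Lemma search4 :
  search (accept tight4) 2 (all_rows (blocked_le 1 5) 216 times4) [::].
Proof. by vm_cast_no_check (erefl true). Qed.

Lemma search5 :
  search (accept table5) 3 (all_rows (blocked_lt 1 5) 130 times5) [::].
Proof. by vm_cast_no_check (erefl true). Qed.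

Section GoodTimes.
Context {R : realType}.

Lemma good_le num den p q v : (0 < q)%N -> (0 < den)%N ->
  ~~ blocked_lt num den q ((p * v) %% q) ->
  num%:R / den%:R <= dist_int (p%:R / q%:R * v%:R : R).
Proof.
move=> q0 den0; rewrite /blocked_lt -leqNgt => h.
have -> : p%:R / q%:R * v%:R = (p * v)%N%:R / q%:R :> R by rewrite natrM mulrAC.
rewrite dist_int_ratio // ler_pdivrMr ?ltr0n // mulrAC ler_pdivlMr ?ltr0n //.
by rewrite -!natrM ler_nat [X in (_ <= X)%N]mulnC.
Qed.

Lemma good_lt num den p q v : (0 < q)%N -> (0 < den)%N ->
  ~~ blocked_le num den q ((p * v) %% q) ->
  num%:R / den%:R < dist_int (p%:R / q%:R * v%:R : R).
Proof.
move=> q0 den0; rewrite /blocked_le -ltnNge => h.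
have -> : p%:R / q%:R * v%:R = (p * v)%N%:R / q%:R :> R by rewrite natrM mulrAC.
rewrite dist_int_ratio // ltr_pdivrMr ?ltr0n // mulrAC ltr_pdivlMr ?ltr0n //.
by rewrite -!natrM ltr_nat [X in (_ < X)%N]mulnC.
Qed.

Lemma accept_table tab (l l' : seq nat) : gcds l = 1%N -> perm_eq l' l ->
  accept tab l' -> tab (sort leq l).
Proof.
move=> g1 pl; rewrite /accept (gcds_perm pl) g1 eqxx /=.
have -> // : sort leq l' = sort leq l.
by apply/perm_sortP; [exact: leq_total | exact: leq_trans | exact: anti_leq | ].
Qed.

Lemma small_triples (l : seq nat) : uniq l -> size l = 3 -> gcds l = 1%N ->
  all (fun v => 0 < v <= 121)%N l ->
  lonely (2%:R / 7%:R : R) l \/ perm_eq l [:: 1; 2; 3]%N.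
Proof.
move=> ul sl gl ln.
case: (search_times search3 _ ul sl ln) => // [[[p q] st good]|[l' pl /(accept_table gl pl)/eqP e]].
  left; exists (p%:R / q%:R) => v vl; apply: good_le (good v vl) => //.
  by have := allP (erefl : all (fun s : nat * nat => 0 < s.2)%N times3) _ st.
by right; rewrite -e perm_sym perm_sort.
Qed.

Lemma small_quadruples (l : seq nat) : uniq l -> size l = 4 -> gcds l = 1%N ->
  all (fun v => 0 < v <= 216)%N l ->
  strictly_lonely (1%:R / 5%:R : R) l \/
  perm_eq l [:: 1; 2; 3; 4]%N \/ perm_eq l [:: 1; 3; 4; 7]%N.
Proof.
move=> ul sl gl ln.
case: (search_times search4 _ ul sl ln) => // [[[p q] st good]|[l' pl /(accept_table gl pl)]].
  left; exists (p%:R / q%:R) => v vl; apply: good_lt (good v vl) => //.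
  by have := allP (erefl : all (fun s : nat * nat => 0 < s.2)%N times4) _ st.
by case/orP => /eqP e; right; [left | right]; rewrite -e perm_sym perm_sort.
Qed.

Lemma small_quintuples (l : seq nat) : uniq l -> size l = 5 -> gcds l = 1%N ->
  all (fun v => 0 < v <= 130)%N l ->
  lonely (1%:R / 5%:R : R) l \/ table5 (sort leq l).
Proof.
move=> ul sl gl ln.
case: (search_times search5 _ ul sl ln) => // [[[p q] st good]|[l' pl /(accept_table gl pl) e]].
  left; exists (p%:R / q%:R) => v vl; apply: good_le (good v vl) => //.
  by have := allP (erefl : all (fun s : nat * nat => 0 < s.2)%N times5) _ st.
by right.
Qed.

End GoodTimes.

(** * Three runners *)

Definition ratio123 (x y z : nat) : Prop :=
  (y = 2 * x /\ z = 3 * x \/ z = 2 * x /\ y = 3 * x \/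
   x = 2 * y /\ z = 3 * y \/ z = 2 * y /\ x = 3 * y \/
   x = 2 * z /\ y = 3 * z \/ y = 2 * z /\ x = 3 * z)%N.

Definition fadd (f g : form) : form := (f.1 + g.1, f.2 + g.2).
Definition fsub (f g : form) : form := (f.1 - g.1, f.2 - g.2).

Lemma det_fadd f a b : det f (fadd a b) = det f a + det f b.
Proof. by rewrite /det /=; ring. Qed.
Lemma det_fsub f a b : det f (fsub a b) = det f a - det f b.
Proof. by rewrite /det /=; ring. Qed.
Lemma detC f g : det f g = - det g f.
Proof. by rewrite /det; ring. Qed.
Lemma detff f : det f f = 0.
Proof. by rewrite /det; ring. Qed.
Lemma det_cramer f g k : det f g * k.1 = det f k * g.1 - det g k * f.1.
Proof. by rewrite /det; ring. Qed.

(** Forms with a positive first coefficient are ordered by slope, so that the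
sign of det is decided by the positions. *)
Definition slope (f : form) : rat := f.2%:~R / f.1%:~R.

Lemma det_slope f g : 0 < f.1 -> 0 < g.1 ->
  (slope f < slope g -> 0 < det f g) /\ (slope f = slope g -> det f g = 0).
Proof.
move=> f0 g0; rewrite /slope /det.
have f0' : 0 < f.1%:~R :> rat by rewrite ltr0z.
have g0' : 0 < g.1%:~R :> rat by rewrite ltr0z.
split.
  rewrite ltr_pdivrMr // mulrAC ltr_pdivlMr // -!intrM ltr_int subr_gt0.
  by rewrite mulrC [g.2 * _]mulrC.
move/eqP; rewrite (eqr_div _ _ (lt0r_neq0 f0') (lt0r_neq0 g0')) => /eqP.
rewrite -!intrM => /intr_inj e.
by rewrite mulrC -e mulrC subrr.
Qed.

Lemma slope_sort (s : seq form) :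
  exists s', perm_eq s s' /\ pairwise (fun f g => slope f <= slope g) s'.
Proof.
have tr : transitive (fun f g : form => slope f <= slope g).
  by move=> g f h; apply: le_trans.
exists (sort (fun f g => slope f <= slope g) s); split.
  by rewrite perm_sym perm_sort.
rewrite -sorted_pairwise //; apply: sort_sorted => f g; exact: le_total.
Qed.

Section Collapse.
Context {R : realType}.

(** This is how the number of runners is reduced: on the line g two coordinates
whose forms have the same absolute value at g count once. *)
Lemma plane_lonely_collapse (c : R) s a b r g : perm_eq s (a :: b :: r) ->
  `|det a g|%N = `|det b g|%N ->
  lonely c [seq `|det f g|%N | f <- a :: r] -> plane_lonely c s.
Proof.
move=> ps ab L; apply: (plane_lonely_line (g := g)); apply: lonely_sub L.
move=> _ /mapP[f fs ->]; move: fs; rewrite (perm_mem ps) !inE.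
case/or3P => [/eqP->|/eqP->|fr]; rewrite ?eqxx -?ab ?eqxx //.
by rewrite (map_f (fun f => `|det f g|%N)) ?orbT.
Qed.

Lemma plane_strictly_lonely_collapse (c : R) s a b r g : perm_eq s (a :: b :: r) ->
  `|det a g|%N = `|det b g|%N ->
  strictly_lonely c [seq `|det f g|%N | f <- a :: r] -> plane_strictly_lonely c s.
Proof.
move=> ps ab L; apply: (plane_strictly_lonely_line (g := g)).
apply: strictly_lonely_sub L.
move=> _ /mapP[f fs ->]; move: fs; rewrite (perm_mem ps) !inE.
case/or3P => [/eqP->|/eqP->|fr]; rewrite ?eqxx -?ab ?eqxx //.
by rewrite (map_f (fun f => `|det f g|%N)) ?orbT.
Qed.

(** Two independent forms take any two values, and the forms parallel to a are
multiples of it. *)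
Lemma parallel_extend (a d : form) (t u : R) : a.1 != 0 -> det a d != 0 ->
  exists x y : R, (forall f, det f a = 0 -> value x y f = t * f.1%:~R) /\
                  value x y d = u.
Proof.
move=> a0 ad; have a0' : a.1%:~R != 0 :> R by rewrite intr_eq0.
have ad' : (det a d)%:~R != 0 :> R by rewrite intr_eq0.
pose y := (u - t * d.1%:~R) * a.1%:~R / (det a d)%:~R.
exists (t - y * (a.2%:~R / a.1%:~R)), y; split.
  move=> f /eqP; rewrite /det subr_eq0 => /eqP /(congr1 (fun z : int => z%:~R : R)).
  rewrite !intrM => fa; rewrite /value.
  have -> : f.2%:~R = a.2%:~R / a.1%:~R * f.1%:~R :> R.
    by rewrite mulrAC -[X in _ = X / _]mulrC fa mulrC mulrA mulVf ?mul1r.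
  by ring.
rewrite /value /y /det intrB !intrM; move: ad'; rewrite /det intrB !intrM => ad'.
by field; rewrite a0' ad'.
Qed.

(** If a speed exceeds 121 = 11^2, the runners come within 1/22 of every point of
a plane. On the line of the plane along which two neighbouring forms are opposite,
only two speeds remain, and they reach 1/3, which exceeds 2/7 + 1/22. *)
Lemma three_runners_primitive (l : seq nat) : uniq l -> size l = 3 ->
  gcds l = 1%N -> all (fun v => 0 < v)%N l ->
  lonely (2%:R / 7%:R : R) l \/ perm_eq l [:: 1; 2; 3]%N.
Proof.
move=> ul sl gl l0.
have [small|] := boolP (all (fun v => v <= 121)%N l).
  apply: small_triples => //; apply/allP => v vl.
  by rewrite (allP l0 _ vl) (allP small _ vl).
rewrite -has_predC => /hasP[M Ml /= M121]; left.
have pl := perm_to_rem Ml; set us := rem M l in pl.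
have sus : size us = 2 by have := perm_size pl; rewrite sl => -[].
have us0 : all (fun u => 0 < u)%N us.
  by move: l0; rewrite (perm_all _ pl) => /andP[].
have [] // := @dirichlet_plane R M us 11; first by rewrite sus; lia.
  by rewrite -(gcds_perm pl).
move=> s [sE [f0 [g0 [f0s g0s fg0]]] dl].
apply: (lonely_sub (s' := M :: us)); first by move=> v; rewrite (perm_mem pl).
apply: (@lonely_le _ (3^-1 - (2 * 11%:R)^-1)); first lra.
apply: dl.
have s0 : all (fun f : form => 0 < f.1) s.
  have : all (fun k : int => 0 < k) [seq f.1 | f <- s].
    rewrite sE; apply/allP => _ /mapP[u uM ->]; rewrite ltz_nat.
    by apply: (allP l0); rewrite (perm_mem pl).
  by rewrite all_map.
have ss : size s = 3 by rewrite -(size_map fst) sE size_map /= sus.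
have [s' [ps pw]] := slope_sort s.
have ss' := perm_size ps; rewrite ss in ss'.
move: s0 f0s g0s; rewrite (perm_all _ ps) !(perm_mem ps).
case: s' ps pw ss' => [|f1 [|f2 [|f3 [|? ?]]]] // ps /=.
rewrite !andbT => /andP[/andP[l12 l13] l23] _ /and3P[p1 p2 p3] f0s g0s.
have [d12 e12] := det_slope p1 p2; have [d13 e13] := det_slope p1 p3.
have [d23 e23] := det_slope p2 p3.
have [h12|h12] : slope f1 < slope f2 \/ slope f1 = slope f2.
  by move: l12; rewrite le_eqVlt => /orP[/eqP|]; [right | left].
(* Two neighbouring forms with different slopes are used, so that the third form
   does not vanish on the line either. *)
- have h13 := lt_le_trans h12 l23.
  have {}d12 := d12 h12; have {}d13 := d13 h13.
  have d23' : 0 <= det f2 f3.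
    by move: l23; rewrite le_eqVlt => /orP[/eqP /e23 ->|/d23/ltW].
  apply: (plane_lonely_collapse (g := fadd f1 f2) ps).
    by rewrite !det_fadd !detff [det f2 f1]detC add0r addr0 abszN.
  by apply: two_runners; rewrite !det_fadd ?detff ?[det f3 f1]detC ?[det f3 f2]detC;
    clear - d12 d13 d23'; lia.
- have h23 : slope f2 < slope f3.
    move: l23; rewrite le_eqVlt => /orP[/eqP h23|//].
    have h13 : slope f1 = slope f3 by rewrite h12.
    have {}e12 := e12 h12; have {}e13 := e13 h13; have {}e23 := e23 h23.
    case/negP: fg0; apply/eqP; move: f0s g0s; rewrite !inE.
    by case/or3P => /eqP -> /or3P[] /eqP ->; rewrite ?detff // [LHS]detC ?e12 ?e13 ?e23 ?oppr0 // -detC ?e12 ?e13 ?e23.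
  have h13 : slope f1 < slope f3 by rewrite h12.
  have {}d13 := d13 h13; have {}d23 := d23 h23; have {}e12 := e12 h12.
  have ps' : perm_eq s [:: f2; f3; f1].
    by apply: (perm_trans ps); rewrite -(perm_rot 1).
  apply: (plane_lonely_collapse (g := fadd f2 f3) ps').
    by rewrite !det_fadd !detff [det f3 f2]detC add0r addr0 abszN.
  by apply: two_runners; rewrite !det_fadd ?detff; clear - d13 d23 e12; lia.
Qed.

Lemma lonely_undup (c : R) (l : seq nat) : lonely c (undup l) -> lonely c l.
Proof. by apply: lonely_sub => v; rewrite mem_undup. Qed.

(** The value 2/7 is what the argument for four runners needs; the triple 1, 2, 3
reaches only 1/4. *)
Lemma three_runners (a b c : nat) : (0 < a)%N -> (0 < b)%N -> (0 < c)%N ->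
  lonely (2%:R / 7%:R : R) [:: a; b; c] \/ ratio123 a b c.
Proof.
move=> a0 b0 c0.
have two p q : (0 < p)%N -> (0 < q)%N -> lonely (2%:R / 7%:R : R) [:: p; q].
  by move=> p0 q0; apply: lonely_le (two_runners p0 q0); lra.
have [u|] := boolP (uniq [:: a; b; c]); last first.
  rewrite /= !inE andbT negb_and !negbK => /orP[/orP[]|] /eqP e; left;
    [apply: lonely_sub (two b c b0 c0) | apply: lonely_sub (two b c b0 c0)
    |apply: lonely_sub (two a c a0 c0)];
    by move=> v; rewrite !inE -?e => /or3P[] ->; rewrite ?orbT.
have [] // := @primitive_part [:: a; b; c]; first by rewrite /= a0 b0 c0.
move=> g [s [g0 sE s0 gs]].
have us : uniq s by move: u; rewrite sE => /map_uniq.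
have ss : size s = 3 by rewrite -(size_map (muln g)) -sE.
have [L|ps] := three_runners_primitive us ss gs s0.
  by left; rewrite sE; apply: lonely_scale.
right; move: u; have : perm_eq [:: a; b; c] [seq (g * v)%N | v <- [:: 1; 2; 3]%N].
  by rewrite sE perm_map.
move=> pabc; have := mem_head a [:: b; c].
have : b \in [:: a; b; c] by rewrite !inE eqxx orbT.
have : c \in [:: a; b; c] by rewrite !inE eqxx !orbT.
rewrite !(perm_mem pabc) /= !inE => /or3P[] /eqP -> /or3P[] /eqP -> /or3P[] /eqP ->.
all: rewrite /= ?inE ?eqn_pmul2l //= => _; clear; rewrite /ratio123; lia.
Qed.

Lemma three_runners_quarter (l : seq nat) : (size (undup l) <= 3)%N ->
  all (fun v => 0 < v)%N l -> lonely (4^-1 : R) l.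
Proof.
move=> sl l0; apply: lonely_undup.
have : all (fun v => 0 < v)%N (undup l).
  by apply/allP => v; rewrite mem_undup => /(allP l0).
have three a b c : (0 < a)%N -> (0 < b)%N -> (0 < c)%N ->
    lonely (4^-1 : R) [:: a; b; c].
  move=> a0 b0 c0; have [L|r] := three_runners a0 b0 c0.
    by apply: lonely_le L; lra.
  have [m [m0 sub]] : exists m, (0 < m)%N /\
      {subset [:: a; b; c] <= [seq (m * v)%N | v <- [:: 1; 2; 3]%N]}.
    by case: r => [[-> ->]|[[-> ->]|[[-> ->]|[[-> ->]|[[-> ->]|[-> ->]]]]]];
      [exists a | exists a | exists b | exists b | exists c | exists c];
      split=> // v; rewrite !inE => /or3P[] /eqP ->; lia.
  apply: lonely_sub sub _; apply: lonely_scale m0 _; exists 4^-1 => v.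
  rewrite !inE => /or3P[] /eqP ->; apply/dist_int_itv; try lra;
    by exists 0; split; lra.
case: (undup l) sl => [|a [|b [|c [|? ?]]]] //= _.
- by exists 0.
- by move=> /andP[a0 _]; apply: lonely_sub (three a a a a0 a0 a0) => v; rewrite !inE => ->.
- move=> /and3P[a0 b0 _]; apply: lonely_sub (three a b b a0 b0 b0) => v.
  by rewrite !inE => /orP[] ->; rewrite ?orbT.
- by move=> /and4P[a0 b0 c0 _]; apply: three.
Qed.

End Collapse.

(** * Four runners *)

Lemma parallel_equal f g h k : det f g = 0 -> det f h = det g h ->
  det f h != 0 -> det f k = det g k.
Proof.
move=> fg eq h0; have := det_cramer f g h; have := det_cramer f g k.
rewrite fg !mul0r eq => ek /esym/eqP.
rewrite subr_eq0 -eq => /eqP/(mulfI h0) e1.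
have : (det f h)%R * (g.2 - f.2) = 0.
  have z1 : f.1 * (g.2 - f.2) = 0 by move: fg; rewrite /det e1 mulrBr.
  have z2 : h.1 * (g.2 - f.2) = 0.
    move: eq; rewrite /det e1 => /addrI/oppr_inj e2.
    by rewrite mulrBr e2 subrr.
  have -> : det f h * (g.2 - f.2) =
      h.2 * (f.1 * (g.2 - f.2)) - f.2 * (h.1 * (g.2 - f.2)).
    by rewrite /det; ring.
  by rewrite z1 z2 !mulr0 subrr.
by move/eqP; rewrite mulf_eq0 (negPf h0) /= subr_eq0 => /eqP e2; rewrite /det e1 e2.
Qed.

Lemma absz_addp (x y : int) : 0 < x -> 0 < y -> `|(x + y)%R|%N = (`|x|%N + `|y|%N)%N.
Proof. lia. Qed.

(** Here a, ..., f stand for the determinants of the pairs 12, 13, 14, 23, 24, 34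
of forms. The ratios on the lines f1 = -f2, f2 = -f3, f3 = -f4 and f4 = f1 determine
the six determinants of four forms up to a factor, with two solutions. *)
Lemma four_ratios (a b c d e f : nat) :
  (0 < a)%N -> (0 < b)%N -> (0 < c)%N -> (0 < d)%N -> (0 < e)%N -> (0 < f)%N ->
  ratio123 a (b + d) (c + e) -> ratio123 d (a + b) (e + f) ->
  ratio123 f (b + c) (d + e) -> ratio123 c (e + a) (f + b) ->
  [/\ b = a, c = a, d = a, e = (2 * a)%N & f = a] \/
  [/\ b = (2 * a)%N, c = a, d = a, e = a & f = a].
Proof.
move=> a0 b0 c0 d0 e0 f0.
case=> [|[|[|[|[|]]]]] [h1 h2]; case=> [|[|[|[|[|]]]]] [h3 h4]; try (exfalso; lia).
all: case=> [|[|[|[|[|]]]]] [h5 h6]; try (exfalso; lia).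
all: case=> [|[|[|[|[|]]]]] [h7 h8]; try (exfalso; lia).
all: first [left; split; lia | right; split; lia].
Qed.

Section FourForms.
Context {R : realType}.

Lemma collapse_three s a b c d g : perm_eq s [:: a; b; c; d] ->
  `|det a g|%N = `|det b g|%N -> det a g != 0 -> det c g != 0 -> det d g != 0 ->
  plane_lonely (2%:R / 7%:R : R) s \/
  ratio123 `|det a g|%N `|det c g|%N `|det d g|%N.
Proof.
move=> ps ab a0 c0 d0.
case: (@three_runners R `|det a g|%N `|det c g|%N `|det d g|%N);
  rewrite ?absz_gt0 // => L; [left | by right].
exact: plane_lonely_collapse ps ab L.
Qed.

(** The coordinates of the two exceptional planes in four dimensions: one
contains a triple 1, 2, 3; in the other one three coordinates form an arithmetic
progression whose difference is the fourth one. *)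
Definition triple_plane (s : seq form) := exists a b c d : form,
  perm_eq s [:: a; b; c; d] /\ ratio123 `|a.1|%N `|b.1|%N `|c.1|%N.
Definition progression_plane (s : seq form) := exists x z : int,
  perm_eq [seq `|f.1|%N | f <- s] [seq `|k|%N | k <- [:: x; z - x; z; z + x]].

(** Three coordinates with parallel forms are as good as three runners, and the
fourth one can be put at 1/2. *)
Lemma parallel_three s a b c d : perm_eq s [:: a; b; c; d] ->
  a.1 != 0 -> b.1 != 0 -> c.1 != 0 ->
  det b a = 0 -> det c a = 0 -> det a d != 0 ->
  plane_lonely (2%:R / 7%:R : R) s \/ triple_plane s.
Proof.
move=> ps a0 b0 c0 ba ca ad.
case: (@three_runners R `|a.1|%N `|b.1|%N `|c.1|%N); rewrite ?absz_gt0 //.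
  move=> [t ht]; left.
  have [x [y [xy xyd]]] := parallel_extend t (2^-1 : R) a0 ad.
  exists x, y => f; rewrite (perm_mem ps) !inE.
  case/or4P => /eqP ->.
  - by rewrite xy ?detff // -dist_int_absz; apply: ht; rewrite !inE eqxx.
  - by rewrite xy // -dist_int_absz; apply: ht; rewrite !inE eqxx ?orbT.
  - by rewrite xy // -dist_int_absz; apply: ht; rewrite !inE eqxx ?orbT.
  - by rewrite xyd; apply/dist_int_itv; [lra | exists 0; split; lra].
by move=> r; right; exists a, b, c, d.
Qed.

Ltac perm_list := apply/seq.permP => ? /=; clear; lia.

(** Between two neighbouring slopes a and b lies the slope of a + b, so that no
form vanishes on the line where a = -b; there at most three speeds remain. If
these have the ratios 1 : 2 : 3 on all such lines and on the line where the first and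
the last form agree, then the plane is known. *)
Lemma four_forms s : size s = 4 -> all (fun f : form => 0 < f.1) s ->
  (exists f g, [/\ f \in s, g \in s & det f g != 0]) ->
  plane_lonely (2%:R / 7%:R : R) s \/ triple_plane s \/ progression_plane s.
Proof.
move=> ss s0 [f0 [g0 [f0s g0s fg0]]].
have [s' [ps pw]] := slope_sort s.
have ss' := perm_size ps; rewrite ss in ss'.
move: s0 f0s g0s; rewrite (perm_all _ ps) !(perm_mem ps).
case: s' ps pw ss' => [|f1 [|f2 [|f3 [|f4 [|? ?]]]]] // ps /=.
rewrite !andbT => /and3P[/and3P[l12 _ _] /andP[l23 _] l34] _ /and4P[p1 p2 p3 p4] f0s g0s.
have cmp f g : slope f <= slope g -> slope f = slope g \/ slope f < slope g.
  by rewrite le_eqVlt => /orP[/eqP|]; [left | right].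
have [D12 E12] := det_slope p1 p2; have [D13 E13] := det_slope p1 p3.
have [D14 E14] := det_slope p1 p4; have [D23 E23] := det_slope p2 p3.
have [D24 E24] := det_slope p2 p4; have [D34 E34] := det_slope p3 p4.
have C21 := detC f2 f1; have C31 := detC f3 f1; have C41 := detC f4 f1.
have C32 := detC f3 f2; have C42 := detC f4 f2; have C43 := detC f4 f3.
have detE := (det_fadd, det_fsub, detff, C21, C31, C41, C32, C42, C43).
have n0 (f : form) : 0 < f.1 -> f.1 != 0 by move=> h; rewrite gt_eqF.
case: (cmp _ _ l12) => h12; case: (cmp _ _ l23) => h23; case: (cmp _ _ l34) => h34.
- exfalso; case/negP: fg0; apply/eqP.
  have h13 : slope f1 = slope f3 by rewrite h12.
  have h14 : slope f1 = slope f4 by rewrite h13.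
  have h24 : slope f2 = slope f4 by rewrite h23.
  have z := (E12 h12, E13 h13, E14 h14, E23 h23, E24 h24, E34 h34).
  by move: f0s g0s; rewrite !inE => /or4P[] /eqP -> /or4P[] /eqP ->;
    rewrite ?detE ?z ?oppr0.
- have h13 : slope f1 = slope f3 by rewrite h12.
  have h14 : slope f1 < slope f4 by rewrite h13.
  have [|||L|T] := parallel_three ps (n0 _ p1) (n0 _ p2) (n0 _ p3).
  + by rewrite C21 E12 // oppr0.
  + by rewrite C31 E13 // oppr0.
  + by rewrite gt_eqF // D14.
  + by left.
  + by right; left.
- have h13 : slope f1 < slope f3 by rewrite h12.
  have h14 : slope f1 < slope f4 by rewrite -h34.
  have h24 : slope f2 < slope f4 by rewrite -h34.
  have {E12}e12 := E12 h12; have {D13}d13 := D13 h13; have {D14}d14 := D14 h14.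
  have {D23}d23 := D23 h23; have {D24}d24 := D24 h24; have {E34}e34 := E34 h34.
  have ps1 : perm_eq s [:: f2; f3; f1; f4] by apply: (perm_trans ps); perm_list.
  have ps2 : perm_eq s [:: f1; f3; f2; f4] by apply: (perm_trans ps); perm_list.
  have [||||L|H1] := collapse_three (g := fadd f2 f3) ps1; rewrite ?detE ?e12 ?e34; try (clear - d13 d14 d23 d24; lia).
  + by left.
  have [||||L|H2] := collapse_three (g := fadd f1 f3) ps2; rewrite ?detE ?e12 ?e34; try (clear - d13 d14 d23 d24; lia).
  + by left.
  exfalso; move: H1 H2; rewrite ?detE ?e12 ?e34 => H1 H2.
  have e : det f1 f4 = det f2 f4 by clear - d13 d14 d23 d24 H1 H2; rewrite /ratio123 in H1 H2; lia.
  have e' := parallel_equal f3 e12 e (lt0r_neq0 d14).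
  by clear - d13 d23 H1 e'; rewrite /ratio123 in H1; lia.
- have h13 : slope f1 < slope f3 by rewrite h12.
  have h14 : slope f1 < slope f4 by apply: lt_trans h34.
  have h24 : slope f2 < slope f4 by apply: lt_trans h34.
  have {E12}e12 := E12 h12; have {D13}d13 := D13 h13; have {D14}d14 := D14 h14.
  have {D23}d23 := D23 h23; have {D24}d24 := D24 h24; have {D34}d34 := D34 h34.
  have ps1 : perm_eq s [:: f2; f3; f1; f4] by apply: (perm_trans ps); perm_list.
  have ps2 : perm_eq s [:: f1; f3; f2; f4] by apply: (perm_trans ps); perm_list.
  have [||||L|H1] := collapse_three (g := fadd f2 f3) ps1; rewrite ?detE ?e12; try (clear - d13 d14 d23 d24 d34; lia).
  + by left.
  have [||||L|H2] := collapse_three (g := fadd f1 f3) ps2; rewrite ?detE ?e12; try (clear - d13 d14 d23 d24 d34; lia).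
  + by left.
  exfalso; move: H1 H2; rewrite ?detE ?e12 => H1 H2.
  have e : det f1 f4 = det f2 f4 by clear - d13 d14 d23 d24 d34 H1 H2; rewrite /ratio123 in H1 H2; lia.
  have e' := parallel_equal f3 e12 e (lt0r_neq0 d14).
  by clear - d13 d23 H1 e'; rewrite /ratio123 in H1; lia.
- have h13 : slope f1 < slope f3 by rewrite -h23.
  have h14 : slope f1 < slope f4 by rewrite -h34.
  have h24 : slope f2 = slope f4 by rewrite h23.
  have ps1 : perm_eq s [:: f2; f3; f4; f1] by apply: (perm_trans ps); perm_list.
  have [|||L|T] := parallel_three ps1 (n0 _ p2) (n0 _ p3) (n0 _ p4).
  + by rewrite C32 E23 // oppr0.
  + by rewrite C42 E24 // oppr0.
  + by rewrite C21 oppr_eq0 gt_eqF // D12.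
  + by left.
  + by right; left.
- have h13 : slope f1 < slope f3 by rewrite -h23.
  have h14 : slope f1 < slope f4 by apply: lt_trans h34.
  have h24 : slope f2 < slope f4 by rewrite h23.
  have {D12}d12 := D12 h12; have {D13}d13 := D13 h13; have {D14}d14 := D14 h14.
  have {E23}e23 := E23 h23; have {D24}d24 := D24 h24; have {D34}d34 := D34 h34.
  have ps2 : perm_eq s [:: f1; f3; f2; f4] by apply: (perm_trans ps); perm_list.
  have [||||L|H1] := collapse_three (g := fadd f1 f2) ps; rewrite ?detE ?e23; try (clear - d12 d13 d14 d24 d34; lia).
  + by left.
  have [||||L|H2] := collapse_three (g := fadd f1 f3) ps2; rewrite ?detE ?e23; try (clear - d12 d13 d14 d24 d34; lia).
  + by left.
  exfalso; move: H1 H2; rewrite ?detE ?e23 => H1 H2.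
  have e : det f2 f4 = det f3 f4 by clear - d12 d13 d14 d24 d34 H1 H2; rewrite /ratio123 in H1 H2; lia.
  have := parallel_equal f1 e23 e (lt0r_neq0 d24); rewrite C21 C31 => e'.
  by clear - d12 d13 H1 e'; rewrite /ratio123 in H1; lia.
- have h13 : slope f1 < slope f3 by apply: lt_trans h23.
  have h14 : slope f1 < slope f4 by rewrite -h34.
  have h24 : slope f2 < slope f4 by rewrite -h34.
  have {D12}d12 := D12 h12; have {D13}d13 := D13 h13; have {D14}d14 := D14 h14.
  have {D23}d23 := D23 h23; have {D24}d24 := D24 h24; have {E34}e34 := E34 h34.
  have ps1 : perm_eq s [:: f2; f3; f1; f4] by apply: (perm_trans ps); perm_list.
  have ps2 : perm_eq s [:: f2; f4; f1; f3] by apply: (perm_trans ps); perm_list.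
  have [||||L|H1] := collapse_three (g := fadd f2 f3) ps1; rewrite ?detE ?e34; try (clear - d12 d13 d14 d23 d24; lia).
  + by left.
  have [||||L|H2] := collapse_three (g := fadd f2 f4) ps2; rewrite ?detE ?e34; try (clear - d12 d13 d14 d23 d24; lia).
  + by left.
  exfalso; move: H1 H2; rewrite ?detE ?e34 => H1 H2.
  have e : det f3 f1 = det f4 f1 by rewrite C31 C41; clear - d12 d13 d14 d23 d24 H1 H2; rewrite /ratio123 in H1 H2; lia.
  have n31 : det f3 f1 != 0 by rewrite C31 oppr_eq0 gt_eqF.
  have := parallel_equal f2 e34 e n31; rewrite C32 C42 => e'.
  by clear - d23 d24 H1 e'; rewrite /ratio123 in H1; lia.
- have h13 : slope f1 < slope f3 by apply: lt_trans h23.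
  have h24 : slope f2 < slope f4 by apply: lt_trans h34.
  have h14 : slope f1 < slope f4 by apply: lt_trans h24.
  have {D12}d12 := D12 h12; have {D13}d13 := D13 h13; have {D14}d14 := D14 h14.
  have {D23}d23 := D23 h23; have {D24}d24 := D24 h24; have {D34}d34 := D34 h34.
  have ps1 : perm_eq s [:: f2; f3; f1; f4] by apply: (perm_trans ps); perm_list.
  have ps2 : perm_eq s [:: f3; f4; f1; f2] by apply: (perm_trans ps); perm_list.
  have ps3 : perm_eq s [:: f4; f1; f2; f3] by apply: (perm_trans ps); perm_list.
  have [||||L|H1] := collapse_three (g := fadd f1 f2) ps; rewrite ?detE; try (clear - d12 d13 d14 d23 d24 d34; lia).
  + by left.
  have [||||L|H2] := collapse_three (g := fadd f2 f3) ps1; rewrite ?detE; try (clear - d12 d13 d14 d23 d24 d34; lia).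
  + by left.
  have [||||L|H3] := collapse_three (g := fadd f3 f4) ps2; rewrite ?detE; try (clear - d12 d13 d14 d23 d24 d34; lia).
  + by left.
  have [||||L|H4] := collapse_three (g := fsub f4 f1) ps3; rewrite ?detE; try (clear - d12 d13 d14 d23 d24 d34; lia).
  + by left.
  right; right; move: H1 H2 H3 H4; rewrite ?detE ?add0r ?sub0r ?opprK -?opprD ?abszN.
  rewrite (absz_addp d13 d23) (absz_addp d14 d24) (absz_addp d12 d13) (absz_addp d24 d34).
  rewrite (absz_addp d13 d14) (absz_addp d23 d24) (absz_addp d24 d12) (absz_addp d34 d13).
  move=> H1 H2 H3 H4.
  have c3 := det_cramer f1 f2 f3; have c4 := det_cramer f1 f2 f4.
  have [[e1 [e2 [e3 [e4 e5]]]]|[e1 [e2 [e3 [e4 e5]]]]] :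
    (det f1 f3 = det f1 f2 /\ det f1 f4 = det f1 f2 /\ det f2 f3 = det f1 f2 /\
     det f2 f4 = 2 * det f1 f2 /\ det f3 f4 = det f1 f2) \/
    (det f1 f3 = 2 * det f1 f2 /\ det f1 f4 = det f1 f2 /\ det f2 f3 = det f1 f2 /\
     det f2 f4 = det f1 f2 /\ det f3 f4 = det f1 f2).
  + case: (@four_ratios `|det f1 f2| `|det f1 f3| `|det f1 f4| `|det f2 f3|
      `|det f2 f4| `|det f3 f4|); rewrite ?absz_gt0 ?gt_eqF // => -[e1 e2 e3 e4 e5].
      by left; clear - d12 d13 d14 d23 d24 d34 e1 e2 e3 e4 e5; lia.
    by right; clear - d12 d13 d14 d23 d24 d34 e1 e2 e3 e4 e5; lia.
  + rewrite e1 e3 -mulrBr in c3; have {}c3 := mulfI (lt0r_neq0 d12) c3.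
    have {}c4 : f4.1 = f2.1 - 2 * f1.1.
      by apply: (mulfI (lt0r_neq0 d12)); rewrite c4 e2 e4; ring.
    exists f1.1, (f2.1 - f1.1); apply: (perm_trans (perm_map _ ps)) => /=.
    rewrite c3 c4 subrK [f2.1 - f1.1 - f1.1](_ : _ = f2.1 - 2 * f1.1); last by ring.
    move: `|f1.1|%N `|f2.1|%N `|(f2.1 - f1.1)%R|%N `|(f2.1 - 2 * f1.1)%R|%N => i j k l.
    by perm_list.
  + have {}c3 : f3.1 = 2 * f2.1 - f1.1.
      by apply: (mulfI (lt0r_neq0 d12)); rewrite c3 e1 e3; ring.
    rewrite e2 e4 -mulrBr in c4; have {}c4 := mulfI (lt0r_neq0 d12) c4.
    exists f2.1, (f2.1 - f1.1); apply: (perm_trans (perm_map _ ps)) => /=.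
    rewrite c3 c4 [f2.1 - f1.1 - f2.1](_ : _ = - f1.1); last by ring.
    rewrite abszN [f2.1 - f1.1 + f2.1](_ : _ = 2 * f2.1 - f1.1); last by ring.
    move: `|f1.1|%N `|f2.1|%N `|(f2.1 - f1.1)%R|%N `|(2 * f2.1 - f1.1)%R|%N => i j k l.
    by perm_list.
Qed.

(** The speeds of a line in a triple plane: if m is at least 2, then m is put at
1/4 and b can be moved close enough to 1/2; if m = 1 and b is large, then b is put
at 1/2 and m can be moved close to 1/4. *)
Lemma triple_strict (m b : nat) (l : seq nat) : (0 < m)%N -> (0 < b)%N ->
  coprime m b -> (1 < m)%N || (30 < b)%N ->
  {subset l <= [:: m; 2 * m; 3 * m; b]%N} -> strictly_lonely (5^-1 : R) l.
Proof.
move=> m0 b0 mb big sub; apply: strictly_lonely_sub sub _.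
have [m1|m1] := ltnP 1 m.
  have cop : coprimez m b by rewrite /coprimez /gcdz /= (eqP mb).
  have m0' : 0 < m%:Z by lia.
  have [t [k [n [tm tb]]]] := hit_vertical (4^-1 : R) 2^-1 m0' cop.
  have m2 : 2%:R <= m%:Z%:~R :> R by rewrite -[_%:~R]/(_%:R) ler_nat.
  have im : (2 * m%:Z%:~R)^-1 <= 4^-1 :> R by rewrite lef_pV2 ?posrE; lra.
  rewrite -[m%:Z%:~R]/(m%:R) in tm; rewrite -[b%:Z%:~R]/(b%:R) in tb.
  exists t => v; rewrite !inE ?natrM => /or4P[] /eqP ->.
  - by apply/dist_int_itv_lt; [lra | exists k; split; lra].
  - apply/dist_int_itv_lt; [lra | exists (2 * k)].
    by rewrite natrM intrM; split; lra.
  - apply/dist_int_itv_lt; [lra | exists (3 * k)].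
    by rewrite natrM intrM; split; lra.
  - apply/dist_int_itv_lt; [lra | exists n].
    by move: tb; rewrite ler_norml => /andP[? ?]; split; lra.
have {}m1 : m = 1%N by lia.
have b30 : (30 < b)%N by move: big; rewrite m1.
rewrite m1.
have cop : coprimez b 1%N by rewrite /coprimez /gcdz /= gcdn1.
have b0' : 0 < b%:Z by lia.
have [t [k [n [tb tm]]]] := hit_vertical (2^-1 : R) 4^-1 b0' cop.
have b2 : 30%:R < b%:Z%:~R :> R by rewrite -[_%:~R]/(_%:R) ltr_nat.
have im : (2 * b%:Z%:~R)^-1 < 60^-1 :> R by rewrite ltf_pV2 ?posrE; lra.
rewrite -[b%:Z%:~R]/(b%:R) in tb; rewrite mulr1 in tm.
move: tm; rewrite ler_norml => /andP[tm1 tm2].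
exists t => v; rewrite !inE ?muln1 => /or4P[] /eqP ->.
- by apply/dist_int_itv_lt; [lra | exists n; split; lra].
- apply/dist_int_itv_lt; [lra | exists (2 * n)].
  by rewrite intrM; split; lra.
- apply/dist_int_itv_lt; [lra | exists (3 * n)].
  by rewrite intrM; split; lra.
- by apply/dist_int_itv_lt; [lra | exists k; split; lra].
Qed.

(** The speeds of a line in a progression plane: with x close to 1/4 and z close to
1/2, the speeds z - x and z + x are close to 1/4 and 3/4. *)
Lemma progression_strict (x z : nat) (l : seq nat) : (0 < x)%N -> (0 < z)%N ->
  coprime x z -> (10 < x)%N || (10 < z)%N ->
  {subset l <= [:: x; `|z%:Z - x%:Z|; z; z + x]%N} ->
  strictly_lonely (5^-1 : R) l.
Proof.
move=> x0 z0 xz big sub; apply: strictly_lonely_sub sub _.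
have concl (t : R) (k n : int) e : `|e| < 20^-1 ->
    (t * x%:R = 4^-1 + e + k%:~R /\ t * z%:R = 2^-1 + n%:~R) \/
    (t * x%:R = 4^-1 + k%:~R /\ t * z%:R = 2^-1 + e + n%:~R) ->
    strictly_lonely (5^-1 : R) [:: x; `|z%:Z - x%:Z|; z; z + x]%N.
  rewrite ltr_norml => /andP[e1 e2] H.
  exists t => v; rewrite !inE => /or4P[] /eqP ->.
  - apply/dist_int_itv_lt; first lra.
    by exists k; case: H => -[? ?]; split; lra.
  - rewrite dist_int_absz intrB mulrBr -[x%:Z%:~R]/(x%:R) -[z%:Z%:~R]/(z%:R).
    apply/dist_int_itv_lt; first lra.
    by exists (n - k); rewrite intrB; case: H => -[? ?]; split; lra.
  - apply/dist_int_itv_lt; first lra.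
    by exists n; case: H => -[? ?]; split; lra.
  - rewrite natrD mulrDr; apply/dist_int_itv_lt; first lra.
    by exists (n + k); rewrite intrD; case: H => -[? ?]; split; lra.
have small (p : nat) : (10 < p)%N -> (2 * p%:Z%:~R)^-1 < 20^-1 :> R.
  move=> p10; have p10' : 10%:R < p%:Z%:~R :> R by rewrite -[_%:~R]/(_%:R) ltr_nat.
  by rewrite ltf_pV2 ?posrE; lra.
case/orP: big => /small big.
  have cop : coprimez x z by rewrite /coprimez /gcdz /= (eqP xz).
  have x0' : 0 < x%:Z by lia.
  have [t [k [n [tx tz]]]] := hit_vertical (4^-1 : R) 2^-1 x0' cop.
  apply: (concl t k n (t * z%:R - 2^-1 - n%:~R)).
    exact: le_lt_trans tz big.
  by right; split; [exact: tx | ring].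
have cop : coprimez z x by rewrite /coprimez /gcdz /= gcdnC (eqP xz).
have z0' : 0 < z%:Z by lia.
have [t [k [n [tz tx]]]] := hit_vertical (2^-1 : R) 4^-1 z0' cop.
apply: (concl t n k (t * x%:R - 4^-1 - n%:~R)).
  exact: le_lt_trans tx big.
by left; split; [ring | exact: tz].
Qed.

(** The extremal quadruples, up to a common factor. *)
Definition tight_quadruple (l : seq nat) := exists m : nat, (0 < m)%N /\
  (perm_eq l [seq (m * v)%N | v <- [:: 1; 2; 3; 4]%N] \/
   perm_eq l [seq (m * v)%N | v <- [:: 1; 3; 4; 7]%N]).

(** If a speed exceeds 216 = 6^3, the runners come within 1/12 of every point of a
plane, and 2/7 - 1/12 exceeds 1/5; the two exceptional kinds of planes are treated
directly. *)
Lemma large_quadruples (l : seq nat) M : size l = 4 -> gcds l = 1%N ->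
  all (fun v => 0 < v)%N l -> M \in l -> (216 < M)%N ->
  strictly_lonely (5^-1 : R) l.
Proof.
move=> sl gl l0 Ml M216; have pl := perm_to_rem Ml; set us := rem M l in pl.
have sus : size us = 3 by have := perm_size pl; rewrite sl => -[].
have us0 : all (fun u => 0 < u)%N us.
  by move: l0; rewrite (perm_all _ pl) => /andP[].
have [] // := @dirichlet_plane R M us 6; first by rewrite sus; lia.
  by rewrite -(gcds_perm pl).
move=> s [sE ns dl].
have s0 : all (fun f : form => 0 < f.1) s.
  have : all (fun k : int => 0 < k) [seq f.1 | f <- s].
    rewrite sE; apply/allP => _ /mapP[u uM ->]; rewrite ltz_nat.
    by apply: (allP l0); rewrite (perm_mem pl).
  by rewrite all_map.
have ss : size s = 4 by rewrite -(size_map fst) sE size_map /= sus.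
have lE : perm_eq l [seq `|f.1|%N | f <- s].
  rewrite (perm_trans pl) // -[X in perm_eq X](map_id _).
  have -> : [seq `|f.1|%N | f <- s] = [seq `|k|%N | k <- [seq f.1 | f <- s]].
    by rewrite -map_comp.
  by rewrite sE -map_comp.
have dvd d : (forall v, v \in l -> (d %| v)%N) -> d = 1%N.
  move=> dl'; have : (d %| gcds l)%N by rewrite dvd_gcds; apply/allP.
  by rewrite gl dvdn1 => /eqP.
have [L|[[a [b [c [d [ps r]]]]]|[x [z pxz]]]] := four_forms ss s0 ns.
- apply: (strictly_lonely_sub (s' := M :: us)).
    by move=> v; rewrite (perm_mem pl).
  by apply: lonely_strict (dl _ L); lra.
- have {}lE : perm_eq l [:: `|a.1|; `|b.1|; `|c.1|; `|d.1|]%N.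
    by apply: (perm_trans lE); apply: (perm_trans (perm_map _ ps)).
  have [m [subm mM]] : exists m, {subset [:: `|a.1|; `|b.1|; `|c.1|]%N <= [:: m; 2 * m; 3 * m]%N}
      /\ m \in [:: `|a.1|; `|b.1|; `|c.1|]%N.
    case: r => [[-> ->]|[[-> ->]|[[-> ->]|[[-> ->]|[[-> ->]|[-> ->]]]]]];
    [exists `|a.1|%N | exists `|a.1|%N | exists `|b.1|%N | exists `|b.1|%N
    |exists `|c.1|%N | exists `|c.1|%N];
    by split; [move=> v; rewrite !inE => /or3P[] -> | rewrite !inE eqxx]; rewrite ?orbT.
  set D := `|d.1|%N in lE.
  have sub : {subset l <= [:: m; 2 * m; 3 * m; D]%N}.
    move=> v; rewrite (perm_mem lE) -[X in v \in X -> _]/([:: _; _; _] ++ [:: _]).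
    rewrite mem_cat => /orP[/subm|]; rewrite !inE; first by case/or3P => ->; rewrite ?orbT.
    by move=> ->; rewrite !orbT.
  have ml : m \in l.
    rewrite (perm_mem lE) -[X in m \in X]/([:: _; _; _] ++ [:: _]).
    by rewrite mem_cat mM.
  have Dl : D \in l by rewrite (perm_mem lE) !inE eqxx !orbT.
  have m0 := allP l0 _ ml; have D0 := allP l0 _ Dl.
  apply: (triple_strict m0 D0 _ _ sub).
    apply/eqP; apply: dvd => v /sub; rewrite !inE.
    by case/or4P => /eqP ->; rewrite ?dvdn_mull ?dvdn_gcdl ?dvdn_gcdr.
  by move: (sub _ Ml); rewrite !inE; clear - M216; lia.
- have {}lE := perm_trans lE pxz.
  have sub : {subset l <= [:: `|x|; `|(`|x|%N%:Z - `|z|%N%:Z)%R|; `|z|; `|z| + `|x|]%N}.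
    move=> v; rewrite (perm_mem lE) /= !inE => /or4P[] /eqP ->; clear; lia.
  have xl : `|x|%N \in l by rewrite (perm_mem lE) mem_head.
  have zl : `|z|%N \in l by rewrite (perm_mem lE) !inE eqxx !orbT.
  have x0 := allP l0 _ xl; have z0 := allP l0 _ zl.
  apply: (progression_strict x0 z0).
  + apply/eqP; apply: dvd => v /sub; rewrite !inE.
    case/or4P => /eqP ->; rewrite ?dvdn_add ?dvdn_gcdl ?dvdn_gcdr //.
    by case: (leqP `|x| `|z|) => h; [rewrite distnEr // | rewrite distnEl ?(ltnW h) //];
      rewrite dvdn_sub ?dvdn_gcdl ?dvdn_gcdr.
  + by move: (sub _ Ml); rewrite !inE; clear - M216; lia.
  + by move=> v /sub; rewrite !inE distnC.
Qed.

(** Large speeds are dealt with by [large_quadruples] and small ones by the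
search; a repeated speed leaves at most three runners, which reach 1/4. *)
Lemma four_runners (l : seq nat) : size l = 4 -> all (fun v => 0 < v)%N l ->
  strictly_lonely (5^-1 : R) l \/ tight_quadruple l.
Proof.
move=> sl l0; have [ul|nul] := boolP (uniq l); last first.
  left; have [t ht] : lonely (4^-1 : R) l.
    apply: three_runners_quarter => //.
    by have := ltn_size_undup l; rewrite nul sl.
  by exists t => v /ht; apply: lt_le_trans; lra.
have [|//|g [s [g0 sE s0 gs]]] := @primitive_part l; first by case: l sl {ul l0}.
have us : uniq s by move: ul; rewrite sE => /map_uniq.
have ss : size s = 4 by rewrite -(size_map (muln g)) -sE.
have [small|] := boolP (all (fun v => v <= 216)%N s); last first.
  rewrite -has_predC => /hasP[M Ms /= M216]; left.
  rewrite sE; apply: strictly_lonely_scale g0 _.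
  by apply: (large_quadruples ss gs s0 Ms); rewrite ltnNge.
have [||||L|ps] := @small_quadruples R s => //.
- by apply/allP => v vs; rewrite (allP s0 _ vs) (allP small _ vs).
- by left; rewrite sE; apply: strictly_lonely_scale g0 _; move: L; rewrite div1r.
- by right; exists g; rewrite g0 sE; case: ps => ps; split=> //; [left | right]; apply: perm_map.
Qed.

End FourForms.

(** * Five coordinates on a plane *)

Section FiveForms.
Context {R : realType}.

Lemma far_in_interval (w1 w2 : R) : w1 + 2^-1 <= w2 ->
  exists w, w1 <= w <= w2 /\ 5^-1 < dist_int w.
Proof.
move=> w12; have [h1 h2] := floor_itv1 w1; set m := Num.floor w1 in h1 h2.
have [f1|f1] := lerP w1 (m%:~R + 4^-1).
  exists (m%:~R + 4^-1); split; first by lra.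
  by apply/dist_int_itv_lt; [lra | exists m; split; lra].
have [f2|f2] := lerP w1 (m%:~R + 3%:R / 4%:R).
  exists w1; split; first by lra.
  by apply/dist_int_itv_lt; [lra | exists m; split; lra].
exists (m%:~R + 5%:R / 4%:R); split; first by lra.
apply/dist_int_itv_lt; first lra.
by exists (m + 1); rewrite intrD; split; lra.
Qed.

(** The slower one of two runners stays in a good interval long enough for the
other one to leave its bad interval, whatever the starting points are. *)
Lemma two_shifted (p q c d : R) : p != 0 -> q != 0 ->
  exists y, 5^-1 < dist_int (c + y * p) /\ 5^-1 < dist_int (d + y * q).
Proof.
wlog pq : p q c d / `|q| <= `|p|.
  move=> W p0 q0; case: (lerP `|q| `|p|) => [/W|/ltW/W]; first exact.
  by move=> /(_ d c q0 p0) [y [? ?]]; exists y.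
move=> p0 q0; pose f z := c + (z - d) / q * p.
have fq z : d + (z - d) / q * q = z by rewrite divfK // addrC subrK.
have mid z : 4^-1 <= z <= 3%:R / 4%:R -> 5^-1 < dist_int z.
  by move=> zz; apply/dist_int_itv_lt; [lra | exists 0; split; lra].
have len : 1 <= `|p / q| by rewrite normf_div ler_pdivlMr ?normr_gt0 // mul1r.
have fE z : f z = f 4^-1 + (z - 4^-1) * (p / q) by rewrite /f; field.
have nz : p / q != 0 by rewrite mulf_neq0 ?invr_neq0.
have [r0|r0] := lerP 0 (p / q).
  rewrite (ger0_norm r0) in len.
  have [|w [wf wd]] := @far_in_interval (f 4^-1) (f (3%:R / 4%:R)).
    by rewrite (fE (3%:R / 4%:R)); lra.
  pose z := 4^-1 + (w - f 4^-1) / (p / q).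
  have zw : f z = w by rewrite fE /z [4^-1 + _]addrC addrK divfK // addrC subrK.
  exists ((z - d) / q); rewrite fq -/(f z) zw; split=> //; apply: mid.
  have r1 : 0 < p / q by lra.
  move: wf; rewrite (fE (3%:R / 4%:R)) => /andP[w1 w2].
  rewrite /z; apply/andP; split.
    by rewrite lerDl divr_ge0 ?subr_ge0.
  rewrite -lerBrDl ler_pdivrMr //; lra.
rewrite (ltr0_norm r0) in len.
have [|w [wf wd]] := @far_in_interval (f (3%:R / 4%:R)) (f 4^-1).
  by rewrite (fE (3%:R / 4%:R)); lra.
pose z := 4^-1 + (w - f 4^-1) / (p / q).
have zw : f z = w by rewrite fE /z [4^-1 + _]addrC addrK divfK // addrC subrK.
exists ((z - d) / q); rewrite fq -/(f z) zw; split=> //; apply: mid.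
move: wf; rewrite (fE (3%:R / 4%:R)) => /andP[w1 w2].
rewrite /z; apply/andP; split.
  by rewrite lerDl; apply: mulr_le0; rewrite ?subr_le0 // invr_le0 ltW.
rewrite -lerBrDl ler_ndivrMr //; lra.
Qed.

(** The three coordinates with parallel forms are lonely along a line; moving in
their common direction changes only the other two. *)
Lemma three_parallel_strict s a b c d e : perm_eq s [:: a; b; c; d; e] ->
  a.1 != 0 -> b.1 != 0 -> c.1 != 0 -> det a b = 0 -> det a c = 0 ->
  det a d != 0 -> det a e != 0 -> plane_strictly_lonely (5^-1 : R) s.
Proof.
move=> ps a0 b0 c0 ab ac ad ae.
have [t ht] : lonely (4^-1 : R) [:: `|a.1|; `|b.1|; `|c.1|]%N.
  apply: three_runners_quarter; first exact: size_undup.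
  by rewrite /= !absz_gt0 a0 b0 c0.
have nz f : det a f != 0 -> (det a f)%:~R != 0 :> R by rewrite intr_eq0.
have [y [yd ye]] := two_shifted (t * d.1%:~R) (t * e.1%:~R) (nz _ ad) (nz _ ae).
have valE f : value (t - y * a.2%:~R) (y * a.1%:~R) f =
    t * f.1%:~R + y * (det a f)%:~R.
  by rewrite /value /det intrB !intrM; ring.
exists (t - y * a.2%:~R), (y * a.1%:~R) => f; rewrite valE (perm_mem ps) !inE.
have par k : det a k = 0 -> `|k.1|%N \in [:: `|a.1|; `|b.1|; `|c.1|]%N ->
    5^-1 < dist_int (t * k.1%:~R + y * (det a k)%:~R).
  move=> -> kin; rewrite mulr0 addr0 -dist_int_absz.
  by apply: lt_le_trans (ht _ kin); lra.
case/or4P => [/eqP->|/eqP->|/eqP->|/orP[/eqP->|/eqP->]] //.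
- by apply: par; rewrite ?detff // !inE eqxx.
- by apply: par; rewrite // !inE eqxx ?orbT.
- by apply: par; rewrite // !inE eqxx ?orbT.
Qed.

Lemma four_parallel s a b c d e : perm_eq s [:: a; b; c; d; e] ->
  a.1 != 0 -> b.1 != 0 -> c.1 != 0 -> d.1 != 0 ->
  det b a = 0 -> det c a = 0 -> det d a = 0 -> det a e != 0 ->
  plane_strictly_lonely (5^-1 : R) s \/
  tight_quadruple [:: `|a.1|; `|b.1|; `|c.1|; `|d.1|]%N.
Proof.
move=> ps a0 b0 c0 d0 ba ca da ae.
case: (@four_runners R [:: `|a.1|; `|b.1|; `|c.1|; `|d.1|]%N) => //.
- by rewrite /= !absz_gt0 a0 b0 c0 d0.
- move=> [t ht]; left.
  have [x [y [xy xye]]] := parallel_extend t (2^-1 : R) a0 ae.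
  have par k : det k a = 0 -> `|k.1|%N \in [:: `|a.1|; `|b.1|; `|c.1|; `|d.1|]%N ->
      5^-1 < dist_int (value x y k).
    by move=> ka kin; rewrite xy // -dist_int_absz; apply: ht.
  exists x, y => f; rewrite (perm_mem ps) !inE.
  case/or4P => [/eqP->|/eqP->|/eqP->|/orP[/eqP->|/eqP->]].
  + by apply: par; rewrite ?detff // !inE eqxx.
  + by apply: par; rewrite // !inE eqxx ?orbT.
  + by apply: par; rewrite // !inE eqxx ?orbT.
  + by apply: par; rewrite // !inE eqxx ?orbT.
  + by rewrite xye; apply/dist_int_itv_lt; [lra | exists 0; split; lra].
- by right.
Qed.

(* The direction u leads towards the middle between two integers. *)
Lemma push_away (v : R) : 5^-1 <= dist_int v ->
  exists2 u : R, `|u| = 1 & forall h, 0 < h <= 10^-1 -> 5^-1 < dist_int (v + h * u).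
Proof.
move/(dist_int_itv _ (ltac:(lra) : 5^-1 <= 2^-1 :> R)) => [m [m1 m2]].
have [vh|vh] := lerP v (m%:~R + 2^-1).
  exists 1; first by rewrite normr1.
  by move=> h hh; apply/dist_int_itv_lt; [lra | exists m; split; lra].
exists (-1); first by rewrite normrN1.
by move=> h hh; apply/dist_int_itv_lt; [lra | exists m; split; lra].
Qed.

(** The two critical coordinates have independent forms, so that they can be moved in
any two directions; a small move does no harm to coordinates at distance 2/5. *)
Lemma perturb s k l n a b (x0 y0 : R) : perm_eq s [:: k; l; n; a; b] ->
  det k l != 0 ->
  5^-1 <= dist_int (value x0 y0 k) -> 5^-1 <= dist_int (value x0 y0 l) ->
  2%:R / 5%:R <= dist_int (value x0 y0 n) ->
  2%:R / 5%:R <= dist_int (value x0 y0 a) ->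
  2%:R / 5%:R <= dist_int (value x0 y0 b) ->
  plane_strictly_lonely (5^-1 : R) s.
Proof.
move=> ps kl /push_away[u u1 hu] /push_away[w w1 hw] dn da db.
have kl' : (det k l)%:~R != 0 :> R by rewrite intr_eq0.
pose dx : R := (u * l.2%:~R - w * k.2%:~R) / (det k l)%:~R.
pose dy : R := (w * k.1%:~R - u * l.1%:~R) / (det k l)%:~R.
have dk : value dx dy k = u.
  by move: kl'; rewrite /value /dx /dy /det intrB !intrM => kl'; field.
have dl : value dx dy l = w.
  by move: kl'; rewrite /value /dx /dy /det intrB !intrM => kl'; field.
pose S := 1 + `|value dx dy n| + `|value dx dy a| + `|value dx dy b|.
have S1 : 1 <= S.
  by rewrite /S -!addrA lerDl !addr_ge0.
pose h := (10%:R * S)^-1.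
have S0 : 0 < S by lra.
have h0 : 0 < h by rewrite invr_gt0 mulr_gt0.
have h10 : h <= 10^-1 by rewrite lef_pV2 ?posrE; lra.
have vE f : value (x0 + h * dx) (y0 + h * dy) f = value x0 y0 f + h * value dx dy f.
  by rewrite /value; ring.
have room f : `|value dx dy f| <= S -> 2%:R / 5%:R <= dist_int (value x0 y0 f) ->
    5^-1 < dist_int (value x0 y0 f + h * value dx dy f).
  move=> fS d2; have := dist_int_lip (value x0 y0 f) (value x0 y0 f + h * value dx dy f).
  have -> : value x0 y0 f - (value x0 y0 f + h * value dx dy f) = - (h * value dx dy f).
    by ring.
  rewrite normrN normrM (gtr0_norm h0).
  have : h * `|value dx dy f| <= h * S by rewrite ler_pM2l.
  have -> : h * S = 10^-1 by rewrite /h invfM mulfVK // gt_eqF.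
  by lra.
exists (x0 + h * dx), (y0 + h * dy) => f; rewrite vE (perm_mem ps) !inE.
have n0 (z : R) := normr_ge0 z.
case/or4P => [/eqP->|/eqP->|/eqP->|/orP[/eqP->|/eqP->]].
- by rewrite dk; apply: hu; rewrite h0.
- by rewrite dl; apply: hw; rewrite h0.
- apply: room => //; rewrite /S.
  by have := n0 (value dx dy a); have := n0 (value dx dy b); lra.
- apply: room => //; rewrite /S.
  by have := n0 (value dx dy n); have := n0 (value dx dy b); lra.
- apply: room => //; rewrite /S.
  by have := n0 (value dx dy a); have := n0 (value dx dy n); lra.
Qed.

(* The residues modulo 5 that are critical at the times 1/5 and 4/5. *)
Definition unit5 (m v : nat) := ((v %/ m) %% 5)%N \in [:: 1; 4]%N.

Lemma tight_residues (l : seq nat) : tight_quadruple l ->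
  exists m, [/\ (0 < m)%N, count (unit5 m) l = 2,
    {in l, forall v, (m %| v)%N} &
    {in l, forall v, ~~ unit5 m v -> ((v %/ m) %% 5)%N \in [:: 2; 3]%N}].
Proof.
move=> [m [m0 H]]; exists m; split=> //.
- case: H => pl; rewrite (seq.permP pl) count_map; last first.
    by rewrite /= /unit5 !mulKn.
  by rewrite /= /unit5 !mulKn.
- by case: H => pl v; rewrite (perm_mem pl) => /mapP[u _ ->]; rewrite dvdn_mulr.
- case: H => pl v; rewrite (perm_mem pl) => /mapP[u us ->]; rewrite /unit5 mulKn //;
  by move: us; rewrite !inE => /or4P[] /eqP ->.
Qed.

Lemma dist_fifth (m j v : nat) : (0 < m)%N -> (m %| v)%N ->
  dist_int (j%:R / (5 * m)%:R * v%:R : R) =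
  (minn ((j * (v %/ m %% 5)) %% 5) (5 - (j * (v %/ m %% 5)) %% 5))%N%:R / 5%:R.
Proof.
move=> m0 /divnK vE; rewrite -{1}vE.
have -> : j%:R / (5 * m)%:R * (v %/ m * m)%:R = (j * (v %/ m))%N%:R / 5%:R :> R.
  rewrite !natrM; field.
  by rewrite pnatr_eq0 -lt0n.
by rewrite dist_int_ratio // modnMmr.
Qed.

(** If the line with a = b or a = -b carries an extremal quadruple, then at a
suitable fifth of the period the two critical coordinates are not a and b. *)
Lemma collapsed_strict s a b c d e g : perm_eq s [:: a; b; c; d; e] ->
  `|det a g|%N = `|det b g|%N ->
  det a g != 0 -> det c g != 0 -> det d g != 0 -> det e g != 0 ->
  det c d != 0 -> det c e != 0 -> det d e != 0 ->
  plane_strictly_lonely (5^-1 : R) s.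
Proof.
move=> ps abg a0 c0 d0 e0 cd ce de.
case: (@four_runners R [:: `|det a g|; `|det c g|; `|det d g|; `|det e g|]%N) => //.
- by rewrite /= !absz_gt0 a0 c0 d0 e0.
- exact: (plane_strictly_lonely_collapse ps abg).
move=> /tight_residues[m [m0 cnt dvd nonunit]].
set l := [:: _; _; _; _] in cnt dvd nonunit.
pose x0 j : R := j%:R / (5 * m)%:R * g.2%:~R.
pose y0 j : R := - (j%:R / (5 * m)%:R) * g.1%:~R.
have vE j f : `|det f g|%N \in l -> dist_int (value (x0 j) (y0 j) f) =
    (minn ((j * (`|det f g|%N %/ m %% 5)) %% 5) (5 - (j * (`|det f g|%N %/ m %% 5)) %% 5))%N%:R / 5%:R.
  by move=> fl; rewrite value_det -dist_int_absz dist_fifth // dvd.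
have nU f : `|det f g|%N \in l -> ~~ unit5 m `|det f g|%N ->
    5^-1 <= dist_int (value (x0 2%N) (y0 2%N) f) /\
    2%:R / 5%:R <= dist_int (value (x0 1%N) (y0 1%N) f).
  move=> fl /(nonunit _ fl); rewrite !vE //.
  by rewrite !inE => /orP[] /eqP -> /=; split; rewrite ?div1r.
have U f : `|det f g|%N \in l -> unit5 m `|det f g|%N ->
    5^-1 <= dist_int (value (x0 1%N) (y0 1%N) f) /\
    2%:R / 5%:R <= dist_int (value (x0 2%N) (y0 2%N) f).
  move=> fl; rewrite /unit5 !vE //.
  by rewrite !inE => /orP[] /eqP -> /=; split; rewrite ?div1r.
have al : `|det a g|%N \in l by rewrite mem_head.
have bl : `|det b g|%N \in l by rewrite -abg.
have cl : `|det c g|%N \in l by rewrite !inE eqxx !orbT.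
have dl : `|det d g|%N \in l by rewrite !inE eqxx !orbT.
have el : `|det e g|%N \in l by rewrite !inE eqxx !orbT.
have p1 : perm_eq s [:: c; d; e; a; b].
  by apply: (perm_trans ps); rewrite -(perm_rot 2).
have p2 : perm_eq s [:: c; e; d; a; b].
  by apply: (perm_trans p1); rewrite perm_cons (perm_catCA [:: d] [:: e]).
have p3 : perm_eq s [:: d; e; c; a; b].
  by apply: (perm_trans p1); rewrite (perm_catCA [:: c] [:: d; e]).
move: cnt; rewrite /= addn0.
case: (boolP (unit5 m `|det a g|%N)) => ua.
  have ub : unit5 m `|det b g|%N by rewrite -abg.
  case: (boolP (unit5 m `|det c g|%N)) => uc;
  case: (boolP (unit5 m `|det d g|%N)) => ud;
  case: (boolP (unit5 m `|det e g|%N)) => ue // _.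
  + by apply: (perturb p3 de (nU _ dl ud).1 (nU _ el ue).1 (U _ cl uc).2 (U _ al ua).2 (U _ bl ub).2).
  + by apply: (perturb p2 ce (nU _ cl uc).1 (nU _ el ue).1 (U _ dl ud).2 (U _ al ua).2 (U _ bl ub).2).
  + by apply: (perturb p1 cd (nU _ cl uc).1 (nU _ dl ud).1 (U _ el ue).2 (U _ al ua).2 (U _ bl ub).2).
have ub : ~~ unit5 m `|det b g|%N by rewrite -abg.
case: (boolP (unit5 m `|det c g|%N)) => uc;
case: (boolP (unit5 m `|det d g|%N)) => ud;
case: (boolP (unit5 m `|det e g|%N)) => ue // _.
+ by apply: (perturb p1 cd (U _ cl uc).1 (U _ dl ud).1 (nU _ el ue).2 (nU _ al ua).2 (nU _ bl ub).2).
+ by apply: (perturb p2 ce (U _ cl uc).1 (U _ el ue).1 (nU _ dl ud).2 (nU _ al ua).2 (nU _ bl ub).2).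
+ by apply: (perturb p3 de (U _ dl ud).1 (U _ el ue).1 (nU _ cl uc).2 (nU _ al ua).2 (nU _ bl ub).2).
Qed.

Lemma eq_lt_chain (x y z : rat) : x = y -> y < z -> x < z.
Proof. by move=> ->. Qed.
Lemma lt_eq_chain (x y z : rat) : x < y -> y = z -> x < z.
Proof. by move=> h <-. Qed.

Ltac chain H H1 H2 :=
  first [have H := etrans H1 H2 | have H := lt_trans H1 H2
        |have H := eq_lt_chain H1 H2 | have H := lt_eq_chain H1 H2].
Ltac order_det h D E :=
  first [have {}D := D h; clear E | have {}D := E h; clear E].

(* The sign of each determinant is known, so that sums of them are nonzero. *)
Ltac signs :=
  repeat match goal with
  | H : is_true (0 < det _ _) |- _ => revert H
  | H : det _ _ = 0 |- _ => revert H
  end; clear; lia.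

Definition tight_plane (s : seq form) := exists a b c d e,
  [/\ perm_eq s [:: a; b; c; d; e],
      det b a = 0, det c a = 0, det d a = 0 &
      tight_quadruple [:: `|a.1|; `|b.1|; `|c.1|; `|d.1|]%N].

(** If no three forms are parallel, two forms of cyclically neighbouring slopes can be
removed such that three different directions remain. The removed forms agree up to
sign on the line given by their sum, or by their difference in the case of the first
and the last slope, and no form vanishes there. *)
Lemma five_forms s : size s = 5 -> all (fun f : form => 0 < f.1) s ->
  (exists f g, [/\ f \in s, g \in s & det f g != 0]) ->
  plane_strictly_lonely (5^-1 : R) s \/ tight_plane s.
Proof.
move=> ss s0 [f0 [g0 [f0s g0s fg0]]].
have [s' [ps pw]] := slope_sort s.
have ss' := perm_size ps; rewrite ss in ss'.
move: s0 f0s g0s; rewrite (perm_all _ ps) !(perm_mem ps).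
case: s' ps pw ss' => [|f1 [|f2 [|f3 [|f4 [|f5 [|? ?]]]]]] // ps /=.
rewrite !andbT => /and4P[/and4P[l12 _ _ _] /and3P[l23 _ _] /andP[l34 _] l45] _.
move=> /and5P[p1 p2 p3 p4 p5] f0s g0s.
have cmp f g : slope f <= slope g -> slope f = slope g \/ slope f < slope g.
  by rewrite le_eqVlt => /orP[/eqP|]; [left | right].
have [D12 E12] := det_slope p1 p2; have [D13 E13] := det_slope p1 p3.
have [D14 E14] := det_slope p1 p4; have [D15 E15] := det_slope p1 p5.
have [D23 E23] := det_slope p2 p3; have [D24 E24] := det_slope p2 p4.
have [D25 E25] := det_slope p2 p5; have [D34 E34] := det_slope p3 p4.
have [D35 E35] := det_slope p3 p5; have [D45 E45] := det_slope p4 p5.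
have C21 := detC f2 f1; have C31 := detC f3 f1; have C41 := detC f4 f1.
have C51 := detC f5 f1; have C32 := detC f3 f2; have C42 := detC f4 f2.
have C52 := detC f5 f2; have C43 := detC f4 f3; have C53 := detC f5 f3.
have C54 := detC f5 f4.
have detE := (det_fadd, det_fsub, detff, C21, C31, C41, C51, C32, C42, C52, C43, C53, C54).
have {p1}n1 : f1.1 != 0 by rewrite gt_eqF.
have {p2}n2 : f2.1 != 0 by rewrite gt_eqF.
have {p3}n3 : f3.1 != 0 by rewrite gt_eqF.
have {p4}n4 : f4.1 != 0 by rewrite gt_eqF.
have {p5}n5 : f5.1 != 0 by rewrite gt_eqF.
have four a b c d e : perm_eq s [:: a; b; c; d; e] ->
    a.1 != 0 -> b.1 != 0 -> c.1 != 0 -> d.1 != 0 ->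
    det b a = 0 -> det c a = 0 -> det d a = 0 -> det a e != 0 ->
    plane_strictly_lonely (5^-1 : R) s \/ tight_plane s.
  move=> qs a0 b0 c0 d0 ba ca da ae.
  have [L|T] := four_parallel qs a0 b0 c0 d0 ba ca da ae; first by left.
  by right; exists a, b, c, d, e.
have reorder a b c d e : (forall p : pred form, p f1 + (p f2 + (p f3 + (p f4 + (p f5 + 0)))) =
    p a + (p b + (p c + (p d + (p e + 0)))))%N -> perm_eq s [:: a; b; c; d; e].
  by move=> H; apply: (perm_trans ps); apply/seq.permP.
case: (cmp _ _ l12) => h12; case: (cmp _ _ l23) => h23;
case: (cmp _ _ l34) => h34; case: (cmp _ _ l45) => h45;
chain h13 h12 h23; chain h14 h13 h34; chain h15 h14 h45;
chain h24 h23 h34; chain h25 h24 h45; chain h35 h34 h45;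
order_det h12 D12 E12; order_det h13 D13 E13; order_det h14 D14 E14;
order_det h15 D15 E15; order_det h23 D23 E23; order_det h24 D24 E24;
order_det h25 D25 E25; order_det h34 D34 E34; order_det h35 D35 E35;
order_det h45 D45 E45;
clear cmp l12 l23 l34 l45 h12 h13 h14 h15 h23 h24 h25 h34 h35 h45.
- exfalso; case/negP: fg0; apply/eqP.
  move: f0s g0s; rewrite !inE => /or4P[/eqP->|/eqP->|/eqP->|/orP[]/eqP->];
  by move=> /or4P[/eqP->|/eqP->|/eqP->|/orP[]/eqP->];
    rewrite ?detE ?D12 ?D13 ?D14 ?D15 ?D23 ?D24 ?D25 ?D34 ?D35 ?D45 ?oppr0.
- by apply: (four f1 f2 f3 f4 f5); rewrite // ?detE; signs.
- left; apply: (three_parallel_strict (a := f1) (b := f2) (c := f3) ps);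
    rewrite // ?detE; signs.
- left; apply: (three_parallel_strict (a := f1) (b := f2) (c := f3) ps);
    rewrite // ?detE; signs.
- left; apply: (three_parallel_strict (a := f3) (b := f4) (c := f5) (d := f1) (e := f2));
    rewrite // ?detE; try signs.
  by apply: reorder => p; clear; lia.
- left; apply: (collapsed_strict (a := f1) (b := f3) (c := f2) (d := f4) (e := f5) (g := fadd f1 f3));
    rewrite // ?detE; try signs.
  by apply: reorder => p; clear; lia.
- left; apply: (collapsed_strict (a := f1) (b := f4) (c := f2) (d := f3) (e := f5) (g := fsub f4 f1));
    rewrite // ?detE; try signs.
  by apply: reorder => p; clear; lia.
- left; apply: (collapsed_strict (a := f1) (b := f3) (c := f2) (d := f4) (e := f5) (g := fadd f1 f3));
    rewrite // ?detE; try signs.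
  by apply: reorder => p; clear; lia.
- apply: (four f2 f3 f4 f5 f1); rewrite // ?detE; try signs.
  by apply: reorder => p; clear; lia.
- left; apply: (three_parallel_strict (a := f2) (b := f3) (c := f4) (d := f1) (e := f5));
    rewrite // ?detE; try signs.
  by apply: reorder => p; clear; lia.
- left; apply: (collapsed_strict (a := f2) (b := f4) (c := f1) (d := f3) (e := f5) (g := fadd f2 f4));
    rewrite // ?detE; try signs.
  by apply: reorder => p; clear; lia.
- left; apply: (collapsed_strict (a := f1) (b := f2) (c := f3) (d := f4) (e := f5) (g := fadd f1 f2));
    rewrite // ?detE; try signs.
- left; apply: (three_parallel_strict (a := f3) (b := f4) (c := f5) (d := f1) (e := f2));
    rewrite // ?detE; try signs.
  by apply: reorder => p; clear; lia.
- left; apply: (collapsed_strict (a := f4) (b := f5) (c := f1) (d := f2) (e := f3) (g := fadd f4 f5));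
    rewrite // ?detE; try signs.
  by apply: reorder => p; clear; lia.
- left; apply: (collapsed_strict (a := f3) (b := f4) (c := f1) (d := f2) (e := f5) (g := fadd f3 f4));
    rewrite // ?detE; try signs.
  by apply: reorder => p; clear; lia.
- left; apply: (collapsed_strict (a := f1) (b := f2) (c := f3) (d := f4) (e := f5) (g := fadd f1 f2));
    rewrite // ?detE; try signs.
Qed.

Lemma perm_map_inv (T1 T2 : eqType) (F : T1 -> T2) (r : seq T1) (t : seq T2) :
  perm_eq t (map F r) -> exists2 r', perm_eq r' r & t = map F r'.
Proof.
case: r => [|x0 r]; first by move=> /perm_nilP ->; exists [::].
move/(perm_iotaP (F x0)) => [Is pIs ->]; rewrite size_map in pIs.
exists [seq nth x0 (x0 :: r) i | i <- Is].
  by rewrite -[X in perm_eq _ X](mkseq_nth x0); apply: perm_map.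
rewrite -map_comp; apply/eq_in_map => i.
by rewrite (perm_mem pIs) mem_iota => /andP[_ il]; exact: (nth_map x0).
Qed.

Definition positive_form (f : form) : form :=
  if f.1 < 0 then (- f.1, - f.2) else f.

(** The plane spanned by u and w is described by the forms (u i, w i). Replacing a
form by its opposite does not affect distances to the integers, so that the first
coefficients may be taken positive. *)
Lemma five_coordinates (u w : 'I_5 -> int) : (forall i, u i != 0) ->
  (exists i j, u i * w j != u j * w i) ->
  (exists x y : R, forall i, 5^-1 < dist_int (x * (u i)%:~R + y * (w i)%:~R)) \/
  exists i, (forall j k, j != i -> k != i -> u j * w k = u k * w j) /\
    tight_quadruple [seq `|u j|%N | j <- rem i (enum 'I_5)].
Proof.
move=> u0 [i0 [j0 ij]]; pose F i := positive_form (u i, w i).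
have FE i : F i = (u i, w i) \/ F i = (- u i, - w i).
  by rewrite /F /positive_form /=; case: ifP => _; [right | left].
have F1 i : `|(F i).1|%N = `|u i|%N by case: (FE i) => -> //=; rewrite abszN.
have Fp i : 0 < (F i).1.
  rewrite /F /positive_form /=; case: ifP => /= h; first by rewrite oppr_gt0.
  by rewrite lt_def u0 leNgt h.
have Fd i j : det (F i) (F j) = 0 <-> u i * w j = u j * w i.
  rewrite /det; case: (FE i) => ->; case: (FE j) => -> /=.
  - by split=> h; lia.
  - by split=> h; lia.
  - by split=> h; lia.
  - by split=> h; lia.
have [||| [x [y xy]]|[a [b [c [d [e [pe ba ca da tq]]]]]]] :=
    @five_forms [seq F i | i <- enum 'I_5].
- by rewrite size_map size_enum_ord.
- by apply/allP => _ /mapP[i _ ->]; apply: Fp.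
- exists (F i0), (F j0); rewrite !map_f ?mem_enum //; split=> //.
  by apply: contra_neq ij => /Fd.
- left; exists x, y => i; have := xy (F i) (map_f F (mem_enum 'I_5 i)).
  rewrite /value; case: (FE i) => -> //=.
  by rewrite !intrN !mulrN -opprD dist_intN.
- right; move: pe; rewrite perm_sym => /perm_map_inv[[|i1 [|i2 [|i3 [|i4 [|i5 [|? ?]]]]]] // pr].
  case=> ae be ce de ee.
  have prem : perm_eq (rem i5 (enum 'I_5)) [:: i1; i2; i3; i4].
    rewrite -(perm_cons i5) -(permPl (perm_to_rem (mem_enum _ i5))).
    by rewrite perm_sym (perm_trans _ pr) // -(perm_rot 1).
  have par j : j != i5 -> u j * w i1 = u i1 * w j.
    move=> ji; apply/Fd.
    have : j \in rem i5 (enum 'I_5) by rewrite mem_rem_uniq ?enum_uniq // inE ji mem_enum.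
    rewrite (perm_mem prem) !inE => /or4P[] /eqP ->.
    + by rewrite detff.
    + by rewrite -be -ae.
    + by rewrite -ce -ae.
    + by rewrite -de -ae.
  exists i5; split.
    move=> j k /par hj /par hk; apply: (mulfI (u0 i1)).
    by rewrite mulrCA -hk mulrCA [RHS]mulrCA [u i1 * w j](esym hj); ring.
  move: tq; rewrite ae be ce de !F1 => -[m [m0 H]]; exists m; split=> //.
  by case: H => H; [left | right]; apply: perm_trans H;
    apply: (perm_trans (perm_map _ prem)).
Qed.

End FiveForms.

(** * A quantitative Kronecker theorem *)

Section Kronecker.
Context {R : realType} {n : nat}.
Implicit Types (k e : {ffun 'I_n -> int}) (L : seq {ffun 'I_n -> int}).

Definition dot k (th : 'I_n -> R) : R := \sum_i (k i)%:~R * th i.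
Definition cos_sum L th : R := \sum_(k <- L) cos (dot k th).

Lemma dotD k e th : dot (k + e) th = dot k th + dot e th.
Proof. by rewrite /dot -big_split; apply: eq_bigr => i _; rewrite ffunE intrD mulrDl. Qed.

Lemma dotN k th : dot (- k) th = - dot k th.
Proof. by rewrite /dot -sumrN; apply: eq_bigr => i _; rewrite ffunE intrN mulNr. Qed.

Lemma dot0 th : dot 0 th = 0.
Proof. by rewrite /dot big1 // => i _; rewrite ffunE mul0r. Qed.

Definition unit_vec (i : 'I_n) : {ffun 'I_n -> int} := [ffun j => (j == i)%:Z].

Lemma dot_unit i th : dot (unit_vec i) th = th i.
Proof.
rewrite /dot (bigD1 i) //= ffunE eqxx mul1r big1 ?addr0 // => j ji.
by rewrite ffunE (negPf ji) mul0r.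
Qed.

(** The steps of a lazy random walk on the integer lattice. Its K-th power has
the trigonometric polynomial (2 sum_i (1 + cos th_i))^K, which is concentrated at
the origin and has nonnegative coefficients. *)
Definition steps : seq {ffun 'I_n -> int} :=
  flatten [seq [:: 0; 0; unit_vec i; - unit_vec i] | i <- enum 'I_n].

Definition walk K : seq {ffun 'I_n -> int} :=
  iter K (fun L => [seq k + e | k <- L, e <- steps]) [:: 0].

(** The step distribution as a function of the angles: its maximum 4n is attained
only at the origin modulo 2 pi. *)
Definition kernel (th : 'I_n -> R) : R := \sum_i (2 + 2 * cos (th i)).

Lemma cos_sum_walk K th : cos_sum (walk K) th = kernel th ^+ K.
Proof.
elim: K => [|K IH]; first by rewrite /cos_sum big_seq1 dot0 cos0 expr0.
rewrite exprSr -IH /walk iterS -/(walk K) /cos_sum big_allpairs_dep /= mulr_suml.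
apply: eq_bigr => k _; rewrite /steps big_flatten big_map /kernel mulr_sumr.
rewrite big_enum; apply: eq_bigr => i _.
rewrite !big_cons big_nil !dotD !dot0 dotN dot_unit /= !addr0.
by rewrite (cosD (dot k th)) (cosB (dot k th)); ring.
Qed.

Lemma size_walk K : size (walk K) = ((4 * n) ^ K)%N.
Proof.
elim: K => // K IH; rewrite /walk iterS -/(walk K) size_allpairs IH expnSr.
congr (_ * _)%N; rewrite /steps size_flatten /shape -map_comp.
rewrite (eq_map (g := fun=> 4%N)) //.
by rewrite sumnE big_map big_enum /= sum_nat_const card_ord mulnC.
Qed.

Lemma walk_bound K k i : k \in walk K -> (`|k i| <= K)%N.
Proof.
elim: K k => [|K IH] k.
  by rewrite inE => /eqP ->; rewrite ffunE.
rewrite /walk iterS -/(walk K) => /allpairsP[[k' e] /= [/IH kK es ->]].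
have e1 : (`|e i| <= 1)%N.
  case/flattenP: es => _ /mapP[j _ ->].
  rewrite !inE => /or4P[] /eqP ->; rewrite !ffunE ?abszN //; by case: (i == j).
by move: kK e1; rewrite ffunE; move: (k' i) (e i) => a b; lia.
Qed.

(** After K steps the walk occupies at most (2K+1)^n places, so that one of them
is reached often. *)
Lemma walk_peak K : (0 < n)%N -> exists2 k, k \in walk K &
  ((4 * n) ^ K <= (2 * K + 1) ^ n * count_mem k (walk K))%N.
Proof.
move=> n0; rewrite -size_walk; set L := walk K; set B := ((2 * K + 1) ^ n)%N.
have sumL : (\sum_(k <- undup L) count_mem k L = size L)%N.
  rewrite -sum1_size -[RHS]big_undup_iterop_count; apply: eq_bigr => k _.
  by rewrite Monoid.iteropE iter_addn_0 mul1n.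
have sizeB : (size (undup L) <= B)%N.
  pose code k : {ffun 'I_n -> 'I_(2 * K).+1} := [ffun i => inord `|k i + K%:Z|].
  have inj : {in undup L &, injective code}.
    move=> k e; rewrite !mem_undup => kL eL /ffunP ke; apply/ffunP => i.
    have := walk_bound i kL; have := walk_bound i eL.
    have := congr1 val (ke i); rewrite !ffunE /=.
    move: (k i) (e i) => a b; move=> ab h1 h2; move: ab.
    by rewrite !inordK; lia.
  rewrite -(size_map code) -(card_uniqP _).
    by apply: leq_trans (max_card _) _; rewrite card_ffun !card_ord /B addn1.
  by rewrite map_inj_in_uniq ?undup_uniq.
apply: contrapT => H.
have small k : k \in undup L -> (B * count_mem k L < size L)%N.
  rewrite mem_undup => kL; rewrite ltnNge; apply/negP => h.
  by apply: H; exists k.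
have s0 : (0 < size L)%N by rewrite size_walk expn_gt0 muln_gt0 n0.
have B0 : (0 < B)%N by rewrite expn_gt0 addn1.
have : (B * size L <= B * (size L).-1)%N.
  rewrite -{1}sumL big_distrr /=.
  apply: (@leq_trans (\sum_(k <- undup L) (size L).-1)).
    rewrite big_seq [X in (X <= _)%N]big_seq; apply: leq_sum => k /small.
    by move=> h; rewrite -ltnS prednK.
  by rewrite big_const_seq count_predT iter_addn_0 mulnC leq_mul2r sizeB orbT.
by rewrite leq_pmul2l // -ltnS prednK // ltnn.
Qed.

Lemma periodic_int (f : R -> R) T : periodic f T -> forall (m : int) a, f (a + T * m%:~R) = f a.
Proof.
move=> fT [m|m] a.
  by rewrite -[m%:Z%:~R]/(m%:R) mulr_natr periodicn.
rewrite NegzE intrN mulrN -[m.+1%:Z%:~R]/(m.+1%:R) mulr_natr.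
by rewrite -(periodicn fT m.+1 (a - T *+ m.+1)) subrK.
Qed.

(** Multiplied by 2 sin h, with h half of the angle between consecutive terms, the
sum telescopes. *)
Lemma sum_cos_period (M : nat) (m : int) (phi : R) : m != 0 -> (`|m| < M)%N ->
  \sum_(j < M) cos (2 * pi * (j%:R / M%:R * m%:~R) + phi) = 0.
Proof.
move=> m0 mM; have M0 : 0 < M%:R :> R by rewrite ltr0n; lia.
pose h : R := pi * m%:~R / M%:R.
have sh : sin h != 0.
  have pi0 := pi_gt0 R.
  have habs : 0 < `|h| < pi.
    rewrite /h !normrM normfV (gtr0_norm M0) (gtr0_norm pi0) -mulrA.
    have m1 : 0 < `|m%:~R| / M%:R :> R by rewrite divr_gt0 ?normr_gt0 ?intr_eq0.
    have m2 : `|m%:~R| / M%:R < 1 :> R.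
      by rewrite ltr_pdivrMr // mul1r -intr_norm -natr_absz ltr_nat.
    by rewrite mulr_gt0 //= -[X in _ < X]mulr1 ltr_pM2l.
  have := sin_gt0_pi habs; case: (lerP 0 h) => h0.
    by rewrite ger0_norm // => /gt_eqF ->.
  by rewrite ltr0_norm // sinN oppr_gt0 => /lt_eqF ->.
pose G (j : nat) : R := sin (2 * h * j%:R - h + phi).
have step (j : nat) : 2 * sin h * cos (2 * pi * (j%:R / M%:R * m%:~R) + phi) = G j.+1 - G j.
  have -> : 2 * pi * (j%:R / M%:R * m%:~R) + phi = 2 * h * j%:R + phi.
    by rewrite /h; field; rewrite gt_eqF.
  rewrite /G -[j.+1%:R]natr1.
  have -> : 2 * h * (j%:R + 1) - h + phi = (2 * h * j%:R + phi) + h by ring.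
  have -> : 2 * h * j%:R - h + phi = (2 * h * j%:R + phi) - h by ring.
  by rewrite sinD sinB; ring.
apply: (mulfI (mulf_neq0 (lt0r_neq0 (ltr0Sn R 1)) sh)).
rewrite mulr0 mulr_sumr -(big_mkord xpredT (fun j => 2 * sin h * cos (2 * pi * (j%:R / M%:R * m%:~R) + phi))).
rewrite (eq_bigr (fun j => G j.+1 - G j)) => [|j _]; last exact: step.
rewrite telescope_sumr // /G mulr0 add0r.
have -> : 2 * h * M%:R - h + phi = (- h + phi) + pi *+ 2 * m%:~R.
  by rewrite /h; field; rewrite gt_eqF.
by rewrite (periodic_int (@sinD2pi R)) subrr.
Qed.

Lemma cos_far (d x : R) : 0 <= d -> d <= dist_int x -> cos (2 * pi * x) <= cos (2 * pi * d).
Proof.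
move=> d0 dx; have [m xm] := dist_int_attained x.
have -> : cos (2 * pi * x) = cos (2 * pi * dist_int x).
  have -> : 2 * pi * x = 2 * pi * (x - m%:~R) + pi *+ 2 * m%:~R by ring.
  rewrite (periodic_int (@cosD2pi R)) xm -[LHS]cos_norm normrM.
  by rewrite (ger0_norm (x := 2 * pi)) // mulr_ge0 // pi_ge0.
have pi0 := pi_gt0 R; have h := dist_int_half x.
have itv (z : R) : 0 <= z -> z <= 2^-1 -> 2 * pi * z \in `[0, pi].
  move=> z0 z1; rewrite in_itv /=; apply/andP; split.
    by rewrite !mulr_ge0 // ltW.
  by have := ler_wpM2l (ltW pi0) z1; lra.
have d2 := le_trans dx h.
move: dx; rewrite le_eqVlt => /orP[/eqP -> //|dx]; apply: ltW.
rewrite ltr_cos ?itv ?dist_int_ge0 // ltr_pM2l // mulr_gt0 //.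
Qed.

(** A power of K is beaten by a geometric sequence: by Bernoulli's inequality
(1 + rho)^m is at least m rho, and this is used n + 1 times. *)
Lemma poly_geometric (rho : R) : 0 < rho -> rho < 1 ->
  exists K : nat, 2 * (2 * K + 1)%:R ^+ n * (1 - rho) ^+ K < 1.
Proof.
move=> r0 r1.
pose A : R := 2 * (2 * n + 3)%:R ^+ n / rho ^+ n.+1.
have A0 : 0 <= A by rewrite divr_ge0 ?mulr_ge0 ?exprn_ge0 // ltW.
pose m := (Num.truncn A).+1; have Am : A < m%:R by rewrite /m truncnS_gt.
have m0 : 0 < m%:R :> R by rewrite ltr0n.
exists (n.+1 * m)%N.
have base : (1 - rho) * (1 + rho) <= 1.
  have : 0 <= rho ^+ 2 by rewrite exprn_ge0 // ltW.
  have -> : (1 - rho) * (1 + rho) = 1 - rho ^+ 2 by ring.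
  lra.
have bern (j : nat) : 1 + j%:R * rho <= (1 + rho) ^+ j.
  elim: j => [|j IH]; first by rewrite mul0r addr0 expr0.
  rewrite exprSr; apply: (@le_trans _ _ ((1 + j%:R * rho) * (1 + rho))).
    rewrite -natr1 -subr_ge0.
    have -> : (1 + j%:R * rho) * (1 + rho) - (1 + (j%:R + 1) * rho) = j%:R * rho ^+ 2.
      by ring.
    by rewrite mulr_ge0 // exprn_ge0 // ltW.
  by rewrite ler_pM2r //; lra.
have big : (m%:R * rho) ^+ n.+1 <= (1 + rho) ^+ (n.+1 * m).
  rewrite mulnC exprM lerXn2r ?nnegrE ?mulr_ge0 ?exprn_ge0 //; try lra.
  by apply: le_trans (bern m); lra.
have poly : (2 * (n.+1 * m) + 1)%:R ^+ n <= (2 * n + 3)%:R ^+ n * m%:R ^+ n :> R.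
  rewrite -exprMn -natrM lerXn2r ?nnegrE // ler_nat /m; nia.
have key : 2 * (2 * (n.+1 * m) + 1)%:R ^+ n < (1 + rho) ^+ (n.+1 * m).
  apply: lt_le_trans big; rewrite exprMn exprSr.
  apply: (@le_lt_trans _ _ (2 * ((2 * n + 3)%:R ^+ n * m%:R ^+ n))).
    by rewrite ler_pM2l.
  rewrite -[X in _ < X]mulrA mulrA [X in _ < X]mulrC [X in X < _]mulrC.
  rewrite -[X in _ < X]mulrA [X in _ < X]mulrC mulrC.
  rewrite [X in _ < X]mulrAC ltr_pM2r ?exprn_gt0 //.
  by move: Am; rewrite /A ltr_pdivrMr ?exprn_gt0 // [X in _ < X]mulrC.
have p0 : 0 < (1 + rho) ^+ (n.+1 * m) by rewrite exprn_gt0; lra.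
rewrite -(ltr_pM2r p0) mul1r.
have -> : 2 * (2 * (n.+1 * m) + 1)%:R ^+ n * (1 - rho) ^+ (n.+1 * m) * (1 + rho) ^+ (n.+1 * m) =
    2 * (2 * (n.+1 * m) + 1)%:R ^+ n * ((1 - rho) * (1 + rho)) ^+ (n.+1 * m).
  by rewrite [in RHS]exprMn mulrA.
apply: le_lt_trans key; rewrite -[X in _ <= X]mulr1 ler_wpM2l ?mulr_ge0 ?exprn_ge0 //.
by apply: exprn_ile1 => //; rewrite mulr_ge0 //; lra.
Qed.

(** If the short relations of v are relations of y, the average along the line of a
power of the kernel centred at y is at least what the most frequent place of the walk
contributes, and this is too much for a line that stays away from y. *)
Lemma kronecker (y : 'I_n -> R) (d : R) : (0 < n)%N -> 0 < d -> d <= 2^-1 ->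
  exists N : nat, forall v : 'I_n -> int,
    (forall k : {ffun 'I_n -> int}, (forall i, (`|k i| <= N)%N) ->
       \sum_i k i * v i = 0 -> dot k y = 0) ->
    exists t : R, forall i, dist_int (t * (v i)%:~R - y i) < d.
Proof.
move=> n0 d0 d2; have pi0 := pi_gt0 R.
have n0' : 0 < n%:R :> R by rewrite ltr0n.
pose rho : R := (1 - cos (2 * pi * d)) / (4 * n%:R).
have r0 : 0 < rho.
  rewrite divr_gt0 ?mulr_gt0 // subr_gt0 -[X in _ < X](@cos0 R).
  rewrite ltr_cos ?in_itv /= ?lexx ?pi_ge0 ?mulr_gt0 //.
  by rewrite mulr_ge0 ?(ltW d0) ?mulr_ge0 // ?pi_ge0 //=; have := ler_wpM2l (ltW pi0) d2; lra.
have r1 : rho < 1.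
  rewrite ltr_pdivrMr ?mulr_gt0 // mul1r.
  have := cos_geN1 (2 * pi * d); have : 1 <= n%:R :> R by rewrite ler1n.
  lra.
have [K hK] := poly_geometric r0 r1; exists (2 * K)%N => v rel.
apply: contrapT => far.
have [ks ksW peak] := walk_peak K n0.
pose S := \sum_i (2 * K)%N%:Z * `|v i|.
(* More equidistant times than the size of any frequency along the line. *)
pose M := (1 + `|S|)%N.
have M0 : (0 < M)%N by [].
pose th (j : 'I_M) (i : 'I_n) : R := 2 * pi * (j%:R / M%:R * (v i)%:~R - y i).
have dotE k j : dot k (th j) =
    2 * pi * (j%:R / M%:R * (\sum_i k i * v i)%:~R) + - (2 * pi * dot k y).
  rewrite /dot /th rmorph_sum /= !mulr_sumr -sumrN -big_split; apply: eq_bigr => i _.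
  by rewrite /= intrM; ring.
have avg k : (forall i, (`|k i| <= 2 * K)%N) ->
    \sum_j cos (dot k (th j)) = if \sum_i k i * v i == 0 then M%:R else 0.
  move=> kK; case: eqP => [k0|/eqP k0].
    rewrite (eq_bigr (fun=> 1)) ?sumr_const ?card_ord // => j _.
    by rewrite dotE k0 mulr0 mulr0 add0r (rel k kK k0) mulr0 oppr0 cos0.
  under eq_bigr do rewrite dotE.
  apply: sum_cos_period => //; rewrite /M add1n ltnS.
  have le : `|\sum_i k i * v i| <= S.
    apply: le_trans (ler_norm_sum _ _ _) _; apply: ler_sum => i _.
    by rewrite normrM ler_wpM2r // -abszE lez_nat.
  by move: le; rewrite -abszE; clear; lia.
have avg0 k : (forall i, (`|k i| <= 2 * K)%N) -> 0 <= \sum_j cos (dot k (th j)).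
  by move=> /avg ->; case: ifP.
(* Weighting with cos (ks . th) does not increase the average of the kernel's
   power; twice the product of two cosines is the sum of the cosines at k + ks and
   k - ks, so that the visits to ks contribute M each and all other terms are
   nonnegative. *)
have low : M%:R * (count_mem ks (walk K))%:R <= 2 * \sum_j kernel (th j) ^+ K.
  have k0 j : 0 <= kernel (th j) ^+ K.
    apply/exprn_ge0/sumr_ge0 => i _.
    by have := cos_geN1 (th j i); lra.
  apply: (@le_trans _ _ (2 * \sum_j kernel (th j) ^+ K * cos (dot ks (th j)))); last first.
    rewrite ler_pM2l //; apply: ler_sum => j _.
    by rewrite -[X in _ <= X]mulr1 ler_wpM2l // cos_le1.
  have -> : 2 * \sum_j kernel (th j) ^+ K * cos (dot ks (th j)) =
      \sum_(k <- walk K) (\sum_j cos (dot (k + ks) (th j)) + \sum_j cos (dot (k - ks) (th j))).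
    under eq_bigr do rewrite -cos_sum_walk /cos_sum mulr_suml.
    rewrite exchange_big mulr_sumr; apply: eq_bigr => k _.
    rewrite mulr_sumr -big_split; apply: eq_bigr => j _ /=.
    by rewrite !dotD dotN cosD cosB; ring.
  have -> : M%:R * (count_mem ks (walk K))%:R = \sum_(k <- walk K) (k == ks)%:R * M%:R :> R.
    rewrite -mulr_suml mulrC; congr (_ * _).
    elim: (walk K) => [|k L IH]; first by rewrite big_nil.
    by rewrite big_cons -IH /= natrD.
  rewrite big_seq [X in _ <= X]big_seq; apply: ler_sum => k kW.
  have bW i : (`|k i| <= K)%N by apply: walk_bound.
  have bs i : (`|ks i| <= K)%N by apply: walk_bound.
  have h1 : 0 <= \sum_j cos (dot (k + ks) (th j)).
    by apply: avg0 => i; rewrite ffunE; move: (bW i) (bs i); move: (k i) (ks i) => a b; clear; lia.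
  have bm (i : 'I_n) : (`|(k - ks)%R i| <= 2 * K)%N.
    by rewrite !ffunE; move: (bW i) (bs i); move: (k i) (ks i) => a b; clear; lia.
  case: eqP => [kks|_]; last by rewrite mul0r addr_ge0 // avg0.
  rewrite mul1r (avg _ bm) kks subrr.
  rewrite [X in X == 0]big1 ?eqxx; last by move=> i _; rewrite ffunE mul0r.
  by rewrite lerDr; move: h1; rewrite kks.
(* At each time some coordinate is far from y, and the kernel is at most
   4n (1 - rho). *)
have up : \sum_j kernel (th j) ^+ K <= M%:R * (4 * n%:R * (1 - rho)) ^+ K.
  have -> : M%:R * (4 * n%:R * (1 - rho)) ^+ K = \sum_(j < M) (4 * n%:R * (1 - rho)) ^+ K.
    by rewrite sumr_const card_ord mulr_natl.
  apply: ler_sum => j _.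
  have [i hi] : exists i, d <= dist_int (j%:R / M%:R * (v i)%:~R - y i).
    apply: contrapT => H; apply: far; exists (j%:R / M%:R) => i.
    by rewrite ltNge; apply/negP => h; apply: H; exists i.
  have ker : kernel (th j) <= 4 * n%:R * (1 - rho).
    have rE : 4 * n%:R * (1 - rho) = 4 * n%:R - (1 - cos (2 * pi * d)).
      by rewrite /rho; field; rewrite gt_eqF.
    have ci : cos (th j i) <= cos (2 * pi * d) by apply: cos_far => //; apply: ltW.
    have rest : \sum_(i' < n | i' != i) (2 + 2 * cos (th j i')) <= \sum_(i' < n | i' != i) 4.
      by apply: ler_sum => i' _; have := cos_le1 (th j i'); lra.
    have tot : 4 * n%:R = 4 + \sum_(i' < n | i' != i) 4 :> R.
      have := sumr_const 'I_n (4 : R); rewrite (bigD1 i) //= => ->.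
      by rewrite card_ord mulr_natr.
    rewrite /kernel (bigD1 i) //= rE tot.
    have := cos_le1 (2 * pi * d); lra.
  rewrite lerXn2r ?nnegrE //.
    by apply: sumr_ge0 => i' _; have := cos_geN1 (th j i'); lra.
  by rewrite !mulr_ge0 //; lra.
have M0' : 0 < M%:R :> R by rewrite ltr0n.
have cnt : (count_mem ks (walk K))%:R <= 2 * ((4 * n%:R) ^+ K * (1 - rho) ^+ K) :> R.
  rewrite -(ler_pM2l M0') -exprMn; apply: le_trans low _.
  by rewrite [X in _ <= X]mulrCA ler_pM2l.
have peak' : (4 * n%:R) ^+ K <= (2 * K + 1)%:R ^+ n * (count_mem ks (walk K))%:R :> R.
  by rewrite -natrM -!natrX -natrM ler_nat.
have p0 : 0 < (4 * n%:R) ^+ K :> R by rewrite exprn_gt0 // mulr_gt0.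
suff : (4 * n%:R) ^+ K < (4 * n%:R) ^+ K :> R by rewrite ltxx.
apply: le_lt_trans peak' _.
apply: (@le_lt_trans _ _ ((2 * K + 1)%:R ^+ n * (2 * ((4 * n%:R) ^+ K * (1 - rho) ^+ K)))).
  by rewrite ler_wpM2l // exprn_ge0.
have -> : (2 * K + 1)%:R ^+ n * (2 * ((4 * n%:R) ^+ K * (1 - rho) ^+ K)) =
    (4 * n%:R) ^+ K * (2 * (2 * K + 1)%:R ^+ n * (1 - rho) ^+ K) :> R by ring.
by rewrite -[X in _ < X]mulr1 ltr_pM2l.
Qed.

End Kronecker.

(** * Loneliness of quintuples *)

Section Speeds.
Context {R : realType}.
Implicit Types (c t : R) (l : seq nat).

Lemma min_norm_ge (n : nat) (f : 'I_n -> R) c : c <= 2^-1 ->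
  (c <= min_norm f) <-> forall i, c <= f i.
Proof.
move=> c2; split=> [/bigmin_geP[_ h] i|h]; first exact: h.
by apply/bigmin_geP; split.
Qed.

Lemma min_norm_gt (n : nat) (f : 'I_n -> R) c : c < 2^-1 ->
  (c < min_norm f) <-> forall i, c < f i.
Proof.
move=> c2; split=> [/bigmin_gtP[_ h] i|h]; first exact: h.
by apply/bigmin_gtP; split.
Qed.

Lemma min_norm_half (n : nat) (f : 'I_n -> R) : min_norm f <= 2^-1.
Proof. exact: bigmin_le_id. Qed.

Lemma lonely_ML (v : 5.-tuple nat) c : c <= 2^-1 -> lonely c v -> c <= ML_speeds R v.
Proof.
move=> c2 [t ht].
apply: (@le_trans _ _ (min_norm (fun i => dist_int (t * (tnth v i)%:R)))).
  by apply/(min_norm_ge _ c2) => i; apply/ht/mem_tnth.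
apply: ub_le_sup; last by exists t.
by exists 2^-1 => _ [t' _ <-]; apply: min_norm_half.
Qed.

Lemma ML_lonely (v : 5.-tuple nat) c : c < 2^-1 -> ~ strictly_lonely c v ->
  ML_speeds R v <= c.
Proof.
move=> c2 nl; apply: ge_sup; first by exists (min_norm (fun i => dist_int (0 * (tnth v i)%:R))), 0.
move=> _ [t _ <-]; rewrite leNgt; apply/negP => /(min_norm_gt _ c2) h.
by apply: nl; exists t => a /tnthP[i ->]; apply: h.
Qed.

Lemma near_tight_lonely (v : 5.-tuple nat) : near_tight R v -> ~ lonely (5^-1 : R) v.
Proof.
rewrite /near_tight => nt /(@lonely_ML v 5^-1) h; move: nt; rewrite ltNge h //.
by rewrite lef_pV2 ?posrE ?ler_nat.
Qed.

(** The conclusion of the theorem for lists of speeds, in a form that is invariant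
under permutations and common factors. *)
Definition spectral l := exists s : nat, let c : R := s%:R / (5 * s + 1)%:R in
  [/\ (0 < s)%N, lonely c l & ~ strictly_lonely c l].

Lemma spectrum_lt (s : nat) : s%:R / (5 * s + 1)%:R < 5^-1 :> R.
Proof. by rewrite ltr_pdivrMr ?ltr0n ?addn1 // -[X in _ * X]natr1 natrM; lra. Qed.

Lemma spectral_in_spectrum (v : 5.-tuple nat) : spectral v -> in_spectrum R v.
Proof.
move=> [s [s0 lo nl]]; exists s; split=> //; have c5 := spectrum_lt s.
have i52 : 5^-1 < 2^-1 :> R by rewrite ltf_pV2 ?posrE ?ltr_nat.
have c2 := lt_trans c5 i52.
by apply: le_anti; rewrite ML_lonely // lonely_ML // ltW.
Qed.

Lemma spectral_eq l l' : l =i l' -> spectral l -> spectral l'.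
Proof.
move=> e [s [s0 lo nl]]; exists s; split=> //.
  by apply: lonely_sub lo => v; rewrite e.
by move=> h; apply: nl; apply: strictly_lonely_sub h => v; rewrite e.
Qed.

Lemma spectral_scale l g : (0 < g)%N -> spectral l -> spectral [seq (g * v)%N | v <- l].
Proof.
move=> g0 [s [s0 lo nl]]; exists s; split=> //; first exact: lonely_scale.
move=> [t ht]; apply: nl; exists (t * g%:R) => v vl.
by rewrite -mulrA -natrM; apply/ht/map_f.
Qed.

End Speeds.

(** * The sporadic quintuples *)

(** A point num / (v Q) of the line is moved to the right end of the interval around
it in which the runner of speed w is within P / Q of an integer, if there is one.
All points passed over belong to that interval. *)
Definition advance (P Q : nat) (x : nat * nat) (w : nat) : nat * nat :=
  let n := ((x.1 * w + P * x.2) %/ (Q * x.2))%N in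
  if (x.1 * w <= (n * Q + P) * x.2)%N then (n * Q + P, w)%N else x.

(** By symmetry it suffices to sweep the times between 0 and 1/2. *)
Definition swept P Q (ws : seq nat) : bool :=
  let x := foldl (advance P Q) (0, 1)%N ws in (x.2 * Q < 2 * x.1)%N.

(** The time a / (5s + 1) has loneliness s / (5s + 1), and the sweep shows that no
time has more. Eight rounds through the speeds suffice for the quintuples below. *)
Definition certificate (s a : nat) (l : seq nat) : bool :=
  let Q := (5 * s + 1)%N in
  all (fun v => (0 < v) && ~~ blocked_lt s Q Q ((a * v) %% Q))%N l &&
  swept s Q (flatten (nseq 8 l)).

(** Pairs (s, a) for the members of [sporadic5], in the same order. *)
Definition sporadic_times : seq (nat * nat) :=
  [:: (2, 3); (2, 5); (1, 1); (3, 7); (2, 5); (6, 14); (2, 4); (6, 14); (3, 3);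
      (4, 2); (3, 5); (4, 10); (4, 10)]%N.

Lemma sporadic_certificates :
  all2 (fun sa l => (0 < sa.1)%N && certificate sa.1 sa.2 l) sporadic_times sporadic5.
Proof. by vm_compute. Qed.

Section Certificates.
Context {R : realType}.
Implicit Types (c t : R) (l : seq nat).

Lemma advance_sound (P Q w : nat) (x : nat * nat) t :
  (0 < Q)%N -> (0 < x.2)%N -> (0 < w)%N ->
  x.1%:R / (x.2 * Q)%:R <= t ->
  t < (advance P Q x w).1%:R / ((advance P Q x w).2 * Q)%:R ->
  dist_int (t * w%:R) <= P%:R / Q%:R.
Proof.
move=> Q0 x0 w0 xt; rewrite /advance; set n := (_ %/ _)%N.
case: ifP => [_|_ h]; last by move: (le_lt_trans xt h); rewrite ltxx.
have nE : (n * (Q * x.2) <= x.1 * w + P * x.2)%N by apply: leq_divM.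
move=> /= tn; apply: le_trans (dist_int_le _ n) _.
have Q0' : 0 < Q%:R :> R by rewrite ltr0n.
have x0' : 0 < x.2%:R :> R by rewrite ltr0n.
have w0' : 0 < w%:R :> R by rewrite ltr0n.
move: tn xt; rewrite ltr_pdivlMr ?ler_pdivrMr ?ltr0n ?muln_gt0 ?w0 ?x0 //.
rewrite !natrM natrD natrM => h1 h2.
have nE' : n%:R * (Q%:R * x.2%:R) <= x.1%:R * w%:R + P%:R * x.2%:R :> R.
  by rewrite -!natrM -natrD ler_nat.
rewrite -[n%:Z%:~R]/(n%:R) ler_norml lerNl ler_pdivlMr // ler_pdivlMr // .
rewrite opprB; apply/andP; split; last lra.
rewrite -(ler_pM2r x0'); have := ler_wpM2r (ltW w0') h2; lra.
Qed.

Lemma advance_pos P Q w (x : nat * nat) :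
  (0 < x.2)%N -> (0 < w)%N -> (0 < (advance P Q x w).2)%N.
Proof. by rewrite /advance; case: ifP. Qed.

Lemma sweep_sound (P Q : nat) (ws : seq nat) (x : nat * nat) t :
  (0 < Q)%N -> (0 < x.2)%N -> all (fun w => 0 < w)%N ws ->
  x.1%:R / (x.2 * Q)%:R <= t ->
  t < (foldl (advance P Q) x ws).1%:R / ((foldl (advance P Q) x ws).2 * Q)%:R ->
  exists2 w, w \in ws & dist_int (t * w%:R) <= P%:R / Q%:R.
Proof.
move=> Q0; elim: ws x => [|w ws IH] x x0 /=.
  by move=> _ xt /(le_lt_trans xt); rewrite ltxx.
move=> /andP[w0 ws0] xt tx.
case: (ltP t ((advance P Q x w).1%:R / ((advance P Q x w).2 * Q)%:R)) => h.
  by exists w; rewrite ?mem_head //; apply: advance_sound xt h.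
have [w' w'ws w'P] := IH _ (advance_pos P Q x0 w0) ws0 h tx.
by exists w' => //; rewrite inE w'ws orbT.
Qed.

Lemma dist_int_fold t (v : nat) : dist_int (dist_int t * v%:R) = dist_int (t * v%:R).
Proof.
have [m ->] := dist_int_attained t.
have -> : dist_int (`|t - m%:~R| * v%:R) = dist_int ((t - m%:~R) * v%:R).
  have [h|h] := leP 0 (t - m%:~R); first by rewrite ger0_norm.
  by rewrite ltr0_norm // mulNr dist_intN.
have -> : (t - m%:~R) * v%:R = t * v%:R + (- m * v%:Z)%:~R.
  by rewrite intrM intrN mulrBl mulNr.
exact: dist_int_shift.
Qed.

Lemma swept_not_strict (P Q : nat) l : (0 < Q)%N -> all (fun v => 0 < v)%N l ->
  swept P Q (flatten (nseq 8 l)) -> ~ strictly_lonely (P%:R / Q%:R : R) l.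
Proof.
move=> Q0 l0 sw [t ht].
have ws0 : all (fun w => 0 < w)%N (flatten (nseq 8 l)).
  by apply/allP => w /flattenP[q /nseqP[-> _]]; apply/allP.
have x0 : (0 < (foldl (advance P Q) (0, 1)%N (flatten (nseq 8 l))).2)%N.
  elim/last_ind: (flatten _) ws0 => // ws w IH.
  by rewrite all_rcons foldl_rcons => /andP[w0 /IH]; move/advance_pos; apply.
have [|||w wl] := @sweep_sound P _ _ (0, 1)%N (dist_int t) Q0 _ ws0 => //.
- by rewrite mul0r dist_int_ge0.
- apply: le_lt_trans (dist_int_half t) _.
  rewrite ltr_pdivlMr ?ltr0n ?muln_gt0 ?x0 // mulrC ltr_pdivrMr //.
  by rewrite -natrM ltr_nat [X in (_ < X)%N]mulnC.
rewrite dist_int_fold leNgt => /negP; apply.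
by case/flattenP: wl => q /nseqP[-> _] /ht.
Qed.

Lemma certificate_spectral s a l : (0 < s)%N -> certificate s a l -> spectral (R := R) l.
Proof.
move=> s0 /andP[/allP good sw]; exists s; split=> //.
  by exists (a%:R / (5 * s + 1)%:R) => v /good/andP[_ gv]; apply: good_le gv; rewrite addn1.
apply: swept_not_strict sw; first by rewrite addn1.
by apply/allP => v /good/andP[].
Qed.

Lemma sporadic_spectral l : l \in sporadic5 -> spectral (R := R) l.
Proof.
have := sporadic_certificates; elim: sporadic5 sporadic_times => // q qs IH [|[s a] sas] //=.
move=> /andP[/andP[s0 cq] /IH h]; rewrite inE => /orP[/eqP ->|/h //].
exact: certificate_spectral cq.
Qed.

End Certificates.

(** * The two families *)

Section Families.
Context {R : realType}.
Implicit Types (c t : R) (l q : seq nat).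

Lemma int_split (m : int) (a : nat) :
  m%:~R <= a%:R :> R \/ a%:R + 1 <= m%:~R :> R.
Proof.
case: (lerP m a) => h; [left | right].
  by rewrite -[a%:R]/(a%:Z%:~R) ler_int.
have : (a%:Z + 1)%:~R <= m%:~R :> R by rewrite ler_int; lia.
by rewrite intrD.
Qed.

(** Just below the critical level the lonely times of the extremal quadruples
cluster around the nonzero fifths: an interval of times left free by the four
runners is empty or contains exactly one fifth. *)
Lemma near_fifth_1234 c t : 6^-1 <= c -> c < 5^-1 -> c < t -> t < 1 - c ->
  (forall k : nat, k \in [:: 2; 3; 4]%N -> c < dist_int (t * k%:R)) ->
  exists j : nat, `|t - j%:R / 5%:R| < 5^-1 - c.
Proof.
move=> c6 c5 tc t1 h; have c2 : c < 2^-1 by lra.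
have [m2 [a2 b2]] := (dist_int_itv_lt _ c2).1 (h 2%N erefl).
have [m3 [a3 b3]] := (dist_int_itv_lt _ c2).1 (h 3%N erefl).
have [m4 [a4 b4]] := (dist_int_itv_lt _ c2).1 (h 4%N erefl).
case: (int_split m4 0) => h1; first by exists 1%N; rewrite ltr_norml; lra.
case: (int_split m4 1) => h2.
  case: (int_split m3 0) => h3; first lra.
  case: (int_split m2 0) => h4; last lra.
  by exists 2%N; rewrite ltr_norml; lra.
case: (int_split m4 2) => h3; last by exists 4%N; rewrite ltr_norml; lra.
case: (int_split m3 1) => h4; last lra.
case: (int_split m2 0) => h5; first lra.
by exists 3%N; rewrite ltr_norml; lra.
Qed.

(** The bound 2/11 is sharp: the time 5/11 has loneliness 2/11 and is not close to a
fifth. *)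
Lemma near_fifth_1347 c t : 2 / 11 <= c -> c < 5^-1 -> c < t -> t < 1 - c ->
  (forall k : nat, k \in [:: 3; 4; 7]%N -> c < dist_int (t * k%:R)) ->
  exists j : nat, `|t - j%:R / 5%:R| < 5^-1 - c.
Proof.
move=> c6 c5 tc t1 h; have c2 : c < 2^-1 by lra.
have [m3 [a3 b3]] := (dist_int_itv_lt _ c2).1 (h 3%N erefl).
have [m4 [a4 b4]] := (dist_int_itv_lt _ c2).1 (h 4%N erefl).
have [m7 [a7 b7]] := (dist_int_itv_lt _ c2).1 (h 7%N erefl).
case: (int_split m7 0) => h1; first lra.
case: (int_split m7 1) => h2.
  case: (int_split m4 0) => h3; last lra.
  by exists 1%N; rewrite ltr_norml; lra.
case: (int_split m7 2) => h3.
  case: (int_split m3 0) => h4; first lra.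
  by exists 2%N; rewrite ltr_norml; lra.
case: (int_split m7 3) => h4; first by case: (int_split m4 1) => h5; lra.
case: (int_split m7 4) => h5.
  case: (int_split m3 1) => h6; last lra.
  by exists 3%N; rewrite ltr_norml; lra.
case: (int_split m7 5) => h6; last lra.
case: (int_split m4 2) => h7; first lra.
by exists 4%N; rewrite ltr_norml; lra.
Qed.

Lemma spectrum_gap (s : nat) : let c : R := s%:R / (5 * s + 1)%:R in
  5 * s%:R * (5^-1 - c) = c.
Proof. by rewrite /= natrD natrM; field; rewrite -natrM natr1 pnatr_eq0. Qed.

Lemma spectrum_ge (s r : nat) : (r <= s)%N ->
  r%:R / (5 * r + 1)%:R <= s%:R / (5 * s + 1)%:R :> R.
Proof.
move=> rs; rewrite ler_pdivrMr ?ltr0n ?addn1 // mulrAC ler_pdivlMr ?ltr0n //.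
by rewrite -!natrM ler_nat; lia.
Qed.

(** A time within 1/5 - c of a fifth is within 5s(1/5 - c) = c of an integer for
the runner of speed 5s. *)
Lemma family_not_strict (s : nat) q c : c = s%:R / (5 * s + 1)%:R :> R ->
  1%N \in q ->
  (forall t, c < t -> t < 1 - c -> (forall k : nat, k \in q -> c < dist_int (t * k%:R)) ->
    exists j : nat, `|t - j%:R / 5%:R| < 5^-1 - c) ->
  (0 < s)%N -> ~ strictly_lonely c (5 * s :: q)%N.
Proof.
move=> cE q1 near s0 [t ht].
have c5 : c < 5^-1 by rewrite cE; apply: spectrum_lt.
have c2 : c < 2^-1 by lra.
have := ht 1%N; rewrite inE q1 orbT mulr1 => /(_ isT)/(dist_int_itv_lt _ c2)[m [m1 m2]].
have shift (k : nat) : dist_int ((t - m%:~R) * k%:R) = dist_int (t * k%:R).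
  have -> : (t - m%:~R) * k%:R = t * k%:R + (- m * k%:Z)%:~R.
    by rewrite intrM intrN mulrBl mulNr.
  exact: dist_int_shift.
have [|||j hj] := near (t - m%:~R); try lra.
  by move=> k kq; rewrite shift; apply: ht; rewrite inE kq orbT.
have := ht (5 * s)%N (mem_head _ _); rewrite -shift ltNge => /negP; apply.
apply: le_trans (dist_int_le _ (s * j)%N) _.
have -> : (t - m%:~R) * (5 * s)%:R - (s * j)%N%:~R = 5 * s%:R * (t - m%:~R - j%:R / 5%:R).
  by rewrite -[(s * j)%N%:~R]/((s * j)%N%:R) !natrM; field.
have s0' : 0 < 5 * s%:R :> R by rewrite mulr_gt0 ?ltr0n.
rewrite normrM (gtr0_norm s0').
have gap := spectrum_gap s; rewrite /= -cE in gap.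
by rewrite -[X in _ <= X]gap ler_pM2l // ltW.
Qed.

(** At the time s / (5s + 1) the residues of the speeds 1, 2, 3, 4, 7 and 5s modulo
5s + 1 are s, 2s, 3s, 4s, 2s - 1 and 4s + 1. *)
Lemma family_lonely (s : nat) q : (0 < s)%N ->
  {subset q <= [:: 1; 2; 3; 4; 7]%N} ->
  lonely (s%:R / (5 * s + 1)%:R : R) (5 * s :: q)%N.
Proof.
move=> s0 qs; exists (s%:R / (5 * s + 1)%:R) => v vs.
apply: good_le; rewrite ?addn1 //.
have vE : v = (5 * s)%N \/ v \in [:: 1; 2; 3; 4; 7]%N.
  by move: vs; rewrite inE => /orP[/eqP->|/qs]; [left | right].
rewrite /blocked_lt -leqNgt mulnC leq_mul2l /= leq_min.
have mod_eq (k r : nat) : (s * v = k * (5 * s).+1 + r)%N -> (r < (5 * s).+1)%N ->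
    ((s * v) %% (5 * s).+1 = r)%N.
  by move=> -> rs; rewrite modnMDl modn_small.
case: vE => [vE|].
  have e : (s * (5 * s) = s.-1 * (5 * s).+1 + (4 * s + 1))%N by case: (s) s0 => // k _ /=; nia.
  by rewrite (@mod_eq s.-1 (4 * s + 1)%N) ?vE ?e //; clear e; lia.
rewrite !inE => /or4P[/eqP vE|/eqP vE|/eqP vE|/orP[]/eqP vE].
- by rewrite (@mod_eq 0 s) ?vE; lia.
- by rewrite (@mod_eq 0 (2 * s))%N ?vE; lia.
- by rewrite (@mod_eq 0 (3 * s))%N ?vE; lia.
- by rewrite (@mod_eq 0 (4 * s))%N ?vE; lia.
- by rewrite (@mod_eq 1 (2 * s - 1))%N ?vE; lia.
Qed.

(** The quintuple 1, 3, 4, 5, 7 does not follow the pattern of its family and is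
found among the sporadic ones. *)
Lemma family_spectral (b : nat) q : (0 < b)%N -> (5 %| b)%N ->
  perm_eq q [:: 1; 2; 3; 4]%N \/ perm_eq q [:: 1; 3; 4; 7]%N ->
  spectral (R := R) (b :: q).
Proof.
move=> b0 /dvdnP[s]; rewrite mulnC => bE; rewrite bE in b0 * => {bE b}.
have s0 : (0 < s)%N by lia.
case=> /perm_mem qE.
- apply: (@spectral_eq _ (5 * s :: [:: 1; 2; 3; 4])%N) => [v|]; first by rewrite !(inE, qE).
  exists s; split=> //; first by apply: family_lonely => // v; rewrite !inE => /or4P[] ->; rewrite ?orbT.
  apply: family_not_strict => // t tc t1 h; apply: near_fifth_1234 => //.
  + by apply: le_trans (spectrum_ge s0); rewrite mul1r.
  + exact: spectrum_lt.
  + by move=> k kq; apply: h; rewrite inE kq orbT.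
- apply: (@spectral_eq _ (5 * s :: [:: 1; 3; 4; 7])%N) => [v|]; first by rewrite !(inE, qE).
  case: (ltnP 1 s) => s1; last first.
    have -> : s = 1%N by lia.
    apply: (@spectral_eq _ [:: 1; 3; 4; 5; 7]%N) => [v|].
      by rewrite !inE; do !case: eqP.
    exact: sporadic_spectral.
  exists s; split=> //; first by apply: family_lonely => // v; rewrite !inE => /or4P[] ->; rewrite ?orbT.
  apply: family_not_strict => // t tc t1 h; apply: near_fifth_1347 => //.
  + exact: le_trans (spectrum_ge s1).
  + exact: spectrum_lt.
  + by move=> k kq; apply: h; rewrite inE kq orbT.
Qed.

(** Let a be the common factor of the extremal quadruple. At the times t with
t a = 1/5 modulo 1 its four members are good. If a is at least 2, one of these
times puts the fifth runner within 1/4 of 1/2; if a = 1, the time 1/5 is good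
unless 5 divides the fifth speed. *)
Lemma tight_family l b q : perm_eq l (b :: q) -> tight_quadruple q -> gcds l = 1%N ->
  (0 < b)%N -> ~ lonely (5^-1 : R) l -> spectral (R := R) l.
Proof.
move=> lbq [a [a0 qE]] gl b0 nl.
have [p [q5 p1 qp pE]] : exists p, [/\ {in p, forall k, ~~ (5 %| k)%N}, 1%N \in p,
    perm_eq q [seq (a * k)%N | k <- p] &
    p = [:: 1; 2; 3; 4]%N \/ p = [:: 1; 3; 4; 7]%N].
  case: qE => qp; eexists; split; try exact: qp; try by [left|right].
  2,4: by [].
  1,2: by apply/allP.
have lE : l =i (b :: [seq a * k | k <- p])%N.
  by move=> v; rewrite (perm_mem lbq) !inE (perm_mem qp).
have ab : coprimez a b.
  have d_l : (gcdn a b %| gcds l)%N.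
    rewrite dvd_gcds; apply/allP => v; rewrite lE inE => /orP[/eqP->|/mapP[k _ ->]].
      exact: dvdn_gcdr.
    by rewrite dvdn_mulr // dvdn_gcdl.
  by move: d_l; rewrite gl dvdn1 /coprimez /gcdz /= => /eqP->.
have fifth t (m : int) k : k \in p -> t * a%:R = 5^-1 + m%:~R ->
    5^-1 <= dist_int (t * (a * k)%:R : R).
  move=> kp ta; rewrite natrM mulrA ta mulrDl.
  rewrite -[k%:R in X in _ + X]/(k%:Z%:~R) -intrM dist_int_shift mulrC.
  rewrite dist_int_ratio // ler_pMl ?invr_gt0 // (ler_nat _ 1) leq_min.
  have := q5 _ kp; rewrite /dvdn; have := ltn_pmod k (isT : 0 < 5)%N; lia.
have a1 : a = 1%N.
  apply: contrapT => a1; apply: nl.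
  have a0' : (0 < a%:Z)%R by lia.
  have [t [m [n [ta tb]]]] := hit_vertical (5^-1 : R) 2^-1 a0' ab.
  exists t => v; rewrite lE inE => /orP[/eqP ->|/mapP[k kp ->]]; last exact: fifth ta.
  have a2 : 2 <= a%:Z%:~R :> R by rewrite -[_%:~R]/(a%:R) (ler_nat _ 2); lia.
  have ia : (2 * a%:Z%:~R)^-1 <= 4^-1 :> R by rewrite lef_pV2 ?posrE; lra.
  apply/dist_int_itv; first lra.
  exists n; move: tb; rewrite ler_norml => /andP[? ?]; split; lra.
have b5 : (5 %| b)%N.
  apply: contrapT => b5; apply: nl; exists 5^-1 => v; rewrite lE inE => /orP[/eqP ->|/mapP[k kp ->]].
    rewrite mulrC dist_int_ratio // ler_pMl ?invr_gt0 // (ler_nat _ 1) leq_min.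
    by move: b5; rewrite /dvdn; have := ltn_pmod b (isT : 0 < 5)%N; lia.
  by apply: (fifth _ 0) => //; rewrite a1 mulr1 addr0.
apply: (@spectral_eq _ (b :: p)) => [v|].
  by rewrite lE a1 (eq_map (g := id)) ?map_id // => k; rewrite mul1n.
by apply: family_spectral => //; case: pE => ->; [left | right].
Qed.

Lemma quintuples_130 (v : 5.-tuple nat) : speeds5 v -> all (fun k => k <= 130)%N v ->
  ~ lonely (5^-1 : R) v -> spectral (R := R) v.
Proof.
move=> /andP[uv v0] v130 nl.
have [] // := @primitive_part v; first by rewrite -size_eq0 size_tuple.
move=> g [l [g0 vE l0 gl]].
rewrite vE in uv v130 nl *; apply: spectral_scale => //.
have sl : size l = 5 by have := size_tuple v; rewrite vE size_map.
have ul : uniq l by apply: map_uniq uv.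
have nl' : ~ lonely (1%:R / 5%:R : R) l.
  by move=> h; apply: nl; apply: lonely_scale => //; rewrite mul1r in h.
have l130 : all (fun k => 0 < k <= 130)%N l.
  apply/allP => k kl; rewrite (allP l0) //=.
  have := allP v130 _ (map_f _ kl); apply: leq_trans.
  by rewrite leq_pmull.
have [//|] := small_quintuples (R := R) ul sl gl l130.
have pl : perm_eq l (sort leq l) by rewrite perm_sym perm_sort.
have ss : size (sort leq l) = 5 by rewrite size_sort.
rewrite /table5 => /orP[sp|/andP[tq d5]].
  apply: spectral_eq (sporadic_spectral sp) => k; exact: mem_sort.
apply: (@tight_family _ (nth 0 (sort leq l) 4)%N (take 4 (sort leq l))) => //.
- rewrite (perm_trans pl) // -{1}(cat_take_drop 4 (sort leq l)).
  by rewrite (drop_nth 0%N) ?ss // drop_oversize ?ss // cats1 perm_rcons.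
- exists 1%N; split=> //; rewrite !(eq_map (g := id)) ?map_id; try by move=> k; rewrite mul1n.
  by case/orP: tq => /eqP ->; [left | right].
- by rewrite (allP l0) // -(mem_sort leq) mem_nth // ss.
- by move: nl'; rewrite mul1r.
Qed.

End Families.

(** * Finiteness of the set of exceptional quintuples *)

Section Finiteness.
Context {R : realType}.
Implicit Types (v w : 5.-tuple nat) (A : 'M[rat]_5).

Lemma primitive5E v : primitive5 v = (gcds v == 1%N).
Proof. by rewrite /primitive5 /gcds foldrE big_tuple. Qed.

Lemma primitive_proportional v w : gcds v = 1%N -> gcds w = 1%N ->
  (forall i j, tnth v i * tnth w j = tnth v j * tnth w i)%N -> v = w.
Proof.
move=> gv gw vw; apply: eq_from_tnth => i.
have e : [seq (tnth v i * x)%N | x <- w] = [seq (tnth w i * x)%N | x <- v].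
  rewrite -(map_tnth_enum v) -(map_tnth_enum w) -!map_comp.
  by apply: eq_map => j /=; rewrite vw mulnC.
by move: (congr1 gcds e); rewrite !gcds_map gv gw !muln1.
Qed.

Definition exceptional v := [/\ all (fun k => 0 < k)%N v, gcds v = 1%N,
  ~ lonely (5^-1 : R) v & ~ spectral (R := R) v].

Definition int_coord v (i : 'I_5) : int := tnth v i.

(** If there is no strictly lonely point, then v itself belongs to one of the two
families and so has its value in the spectrum. *)
Lemma exceptional_plane v w i j : exceptional v -> tnth v i * tnth w j <> tnth v j * tnth w i ->
  exists x y : R, forall i,
    5^-1 < dist_int (x * (int_coord v i)%:~R + y * (int_coord w i)%:~R).
Proof.
move=> [/all_tnthP v0 gv nl ns] vw.
have [||//|[k [_ tq]]] := @five_coordinates R (int_coord v) (int_coord w).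
- by move=> k; have := v0 k; rewrite /int_coord; lia.
- by exists i, j; apply/eqP => e; apply: vw; move: e; rewrite /int_coord; lia.
case: ns; apply: (tight_family _ tq gv (v0 k) nl).
rewrite -{1}(map_tnth_enum v).
rewrite (perm_trans (perm_map _ (perm_to_rem (mem_enum 'I_5 k)))) //.
Qed.

Definition col_of v : 'cV[rat]_5 := \col_i (tnth v i)%:R.
Definition row_of (k : {ffun 'I_5 -> int}) : 'rV[rat]_5 := \row_i (k i)%:~R.

Lemma row_col k v : (row_of k <= kermx (col_of v))%MS = (\sum_i k i * int_coord v i == 0).
Proof.
apply/sub_kermxP/eqP => [/matrixP/(_ 0 0)|e]; last apply/matrixP => i j.
  rewrite !mxE => e; apply/eqP; rewrite -(intr_eq0 rat) rmorph_sum /=; apply/eqP.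
  by rewrite -[RHS]e; apply: eq_bigr => l _; rewrite !mxE intrM.
rewrite !mxE; transitivity ((\sum_l k l * int_coord v l)%:~R : rat); last by rewrite e.
by rewrite rmorph_sum; apply: eq_bigr => l _; rewrite !mxE /= intrM.
Qed.

(** Exceptional vectors that are proportional are equal, being primitive. Two others
annihilated by A span a plane that contains a strictly lonely point; by [kronecker]
every further exceptional vector annihilated by A satisfies one of finitely many
relations independent of A, and the rank increases. *)
Lemma exceptional_finite A : finite_set [set v | exceptional v /\ (A <= kermx (col_of v))%MS].
Proof.
have [d] := ubnP (5 - \rank A)%N; elim: d A => // d IH A rA.
have [[v0 [bv0 Av0]]|none] := pselect (exists v, exceptional v /\ (A <= kermx (col_of v))%MS); last first.
  suff -> : [set v | exceptional v /\ (A <= kermx (col_of v))%MS] = set0 by exact: finite_set0.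
  by apply/seteqP; split=> v //= h; apply: none; exists v.
have [[w [bw [Aw [i [j ij]]]]]|prop] := pselect (exists w, exceptional w /\ (A <= kermx (col_of w))%MS /\
    exists i j, tnth v0 i * tnth w j <> tnth v0 j * tnth w i); last first.
  apply: (@sub_finite_set _ _ [set v0]); last exact: finite_set1.
  move=> v /= [bv Av]; have [_ gv _ _] := bv; have [_ gv0 _ _] := bv0.
  apply/esym/primitive_proportional => // i j; apply: contrapT => h.
  by apply: prop; exists v; split=> //; split=> //; exists i, j.
have [x [y xy]] := exceptional_plane bv0 ij.
pose p i : R := x * (int_coord v0 i)%:~R + y * (int_coord w i)%:~R.
pose gap := \big[Num.min/2^-1]_i (dist_int (p i) - 5^-1).
have gap0 : 0 < gap.
  apply/bigmin_gtP; split=> [|i' _]; first by rewrite invr_gt0.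
  by rewrite subr_gt0 xy.
have gapE i' : gap <= dist_int (p i') - 5^-1 by apply: bigmin_le_cond.
have [N hN] := kronecker p (isT : 0 < 5)%N gap0 (bigmin_le_id _ _ _ _).
pose k (e : {ffun 'I_5 -> 'I_(2 * N).+1}) : {ffun 'I_5 -> int} :=
  [ffun i => (e i)%:Z - N%:Z].
pose indep := [set e | ~~ (row_of (k e) <= A)%MS].
apply: (@sub_finite_set _ _ (\bigcup_(e in indep)
    [set v | exceptional v /\ (A + row_of (k e) <= kermx (col_of v))%MS])); last first.
  apply: bigcup_finite => [|e /= ke]; first exact: finite_finset.
  apply: IH; move: rA.
  have : (\rank A < \rank (A + row_of (k e))%MS)%N.
    by apply: rank_ltmx; rewrite ltmxE addsmxSl addsmx_sub submx_refl.
  by have := rank_leq_col (A + row_of (k e))%MS; lia.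
move=> v /= [bv Av]; have [_ _ nl _] := bv.
have [e [eN [ev ep]]] : exists e : {ffun 'I_5 -> int}, (forall i, (`|e i| <= N)%N) /\
    \sum_i e i * int_coord v i = 0 /\ dot e p <> 0.
  apply: contrapT => none; apply: nl.
  have [|t ht] := hN (int_coord v).
    by move=> e eN ev; apply: contrapT => ep; apply: none; exists e.
  exists t => _ /tnthP[i' ->]; have := ht i'; have := gapE i'.
  have [m ->] := dist_int_attained (t * (int_coord v i')%:~R - p i').
  have := dist_int_lip (p i' + m%:~R) (t * (int_coord v i')%:~R).
  rewrite dist_int_shift -normrN opprB opprD addrA /int_coord.
  by rewrite -[_%:Z%:~R]/((tnth v i')%:R); lra.
pose c : {ffun 'I_5 -> 'I_(2 * N).+1} := [ffun i => inord `|(e i + N%:Z)%R|%N].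
have kc : k c = e.
  apply/ffunP => l; rewrite !ffunE; move: (eN l); move: (e l) => a {}eN.
  by rewrite inordK; lia.
exists c; last by split=> //=; rewrite addsmx_sub Av kc row_col ev eqxx.
rewrite /indep /= kc; apply/negP => eA; apply: ep.
have := submx_trans eA Av0; have := submx_trans eA Aw.
rewrite !row_col => /eqP ew /eqP ev0.
have -> : dot e p = x * (\sum_i e i * int_coord v0 i)%:~R + y * (\sum_i e i * int_coord w i)%:~R.
  rewrite /dot /p !rmorph_sum /= !mulr_sumr -big_split; apply: eq_bigr => l _ /=.
  by rewrite !intrM; ring.
by rewrite ev0 ew !mulr0 addr0.
Qed.

Lemma finitely_many_exceptional : finite_set [set v : 5.-tuple nat |
  [/\ speeds5 v, primitive5 v, near_tight R v & ~ in_spectrum R v]].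
Proof.
apply: sub_finite_set (exceptional_finite 0) => v /= [/andP[_ v0] pv nt ns].
rewrite sub0mx; split=> //; split=> //.
- by apply/eqP; rewrite -primitive5E.
- exact: near_tight_lonely.
- by move/spectral_in_spectrum.
Qed.

End Finiteness.

(** * Tori *)

Section Tori.
Context {R : realType} {n : nat}.
Implicit Types (a b x : 'rV[R]_n) (u w : 'rV[int]_n) (c : R) (U : set (torus R n)).

Lemma span2P a b x :
  reflect (exists s t : R, x = s *: a + t *: b) (x \in <<[:: a; b]>>%VS).
Proof.
rewrite span_cons span_seq1; apply: (iffP memv_addP) => [[_ /vlineP[s ->] [_ /vlineP[t ->] ->]]|[s [t ->]]].
  by exists s, t.
by exists (s *: a); [apply/vlineP; exists s | exists (t *: b) => //; apply/vlineP; exists t].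
Qed.

Lemma plane_torusP u w (X : torus R n) :
  plane_torus R u w X <-> exists s t : R, X = to_torus (s *: real_vec R u + t *: real_vec R w).
Proof.
split=> [[x /= /span2P[s [t ->]] <-]|[s [t ->]]]; first by exists s, t.
by exists (s *: real_vec R u + t *: real_vec R w) => //=; apply/span2P; exists s, t.
Qed.

Lemma free2P u w : free [:: real_vec R u; real_vec R w] <->
  exists i j, u 0 i * w 0 j != u 0 j * w 0 i.
Proof.
split=> [fr|[i [j ij]]].
  apply: contrapT => none; move: fr; rewrite free_cons seq1_free => /andP[uw w0].
  have [j wj] : exists j, w 0 j != 0.
    apply: contrapT => z; move/eqP: w0; apply; apply/rowP => j; rewrite !mxE.
    by have [->//|wj] := eqVneq (w 0 j) 0; case: z; exists j.
  move/negP: uw; apply; rewrite span_seq1; apply/vlineP.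
  exists ((u 0 j)%:~R / (w 0 j)%:~R); apply/rowP => i; rewrite !mxE.
  have -> : (u 0 j)%:~R / (w 0 j)%:~R * (w 0 i)%:~R = (u 0 j * w 0 i)%:~R / (w 0 j)%:~R :> R.
    by rewrite intrM mulrAC.
  have -> : u 0 j * w 0 i = u 0 i * w 0 j.
    by apply/eqP; rewrite eq_sym; apply: contrapT => /negP h; apply: none; exists i, j.
  by rewrite intrM mulfK // intr_eq0.
apply/(@freeP _ _ _ [tuple real_vec R u; real_vec R w]) => k.
rewrite !big_ord_recl big_ord0 addr0 /= => e.
have e' l : k ord0 * (u 0 l)%:~R + k (lift ord0 ord0) * (w 0 l)%:~R = 0.
  by have := congr1 (fun x : 'rV[R]_n => x 0 l) e; rewrite !mxE.
have d0 : (u 0 i * w 0 j - u 0 j * w 0 i)%:~R != 0 :> R by rewrite intr_eq0 subr_eq0.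
have k0 : k ord0 = 0.
  apply/(mulIf d0); rewrite mul0r.
  have -> : k ord0 * (u 0 i * w 0 j - u 0 j * w 0 i)%:~R =
    (k ord0 * (u 0 i)%:~R + k (lift ord0 ord0) * (w 0 i)%:~R) * (w 0 j)%:~R -
    (k ord0 * (u 0 j)%:~R + k (lift ord0 ord0) * (w 0 j)%:~R) * (w 0 i)%:~R.
    by rewrite intrB !intrM; ring.
  by rewrite !e' !mul0r subr0.
have k1 : k (lift ord0 ord0) = 0.
  apply/(mulIf d0); rewrite mul0r.
  have -> : k (lift ord0 ord0) * (u 0 i * w 0 j - u 0 j * w 0 i)%:~R =
    (k ord0 * (u 0 j)%:~R + k (lift ord0 ord0) * (w 0 j)%:~R) * (u 0 i)%:~R -
    (k ord0 * (u 0 i)%:~R + k (lift ord0 ord0) * (w 0 i)%:~R) * (u 0 j)%:~R.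
    by rewrite intrB !intrM; ring.
  by rewrite !e' !mul0r subr0.
by move=> l; case: (unliftP ord0 l) => [l' ->|->] //; rewrite (ord1 l').
Qed.

Lemma plane_coord u w (s t : R) r :
  (s *: real_vec R u + t *: real_vec R w) 0 r = s * (u 0 r)%:~R + t * (w 0 r)%:~R.
Proof. by rewrite !mxE. Qed.

Lemma norm_torus x r : circle_norm ((to_torus x) 0 r) = dist_int (x 0 r).
Proof. by rewrite mxE circle_normE. Qed.

Lemma ML_ge U X c : c <= 2^-1 -> U X -> (forall r, c <= circle_norm (X 0 r)) -> c <= ML U.
Proof.
move=> c2 UX h.
apply: (@le_trans _ _ (min_norm (fun r => circle_norm (X 0 r)))); first exact/min_norm_ge.
apply: ub_le_sup; last by exists X.
by exists 2^-1 => _ [Y _ <-]; apply: min_norm_half.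
Qed.

Lemma ML_le U X c : c < 2^-1 -> U X ->
  (forall Y, U Y -> exists r, circle_norm (Y 0 r) <= c) -> ML U <= c.
Proof.
move=> c2 UX h; apply: ge_sup.
  by exists (min_norm (fun r => circle_norm (X 0 r))), X.
move=> _ [Y UY <-]; have [r Yr] := h Y UY; rewrite leNgt; apply/negP.
by move=> /(min_norm_gt _ c2)/(_ r); rewrite ltNge Yr.
Qed.

Lemma proper_of_point U X : U X -> (forall r, 0 < circle_norm (X 0 r)) -> proper_subtorus U.
Proof.
move=> UX h sub; have [r _ /= Xr] := sub X UX; have := h r; rewrite Xr.
have -> : 0 = to_circle 0 :> circle R by rewrite /to_circle raddf0.
rewrite circle_normE; have := dist_int_le (0 : R) 0; rewrite subrr normr0.
by move=> h0 /lt_le_trans/(_ h0); rewrite ltxx.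
Qed.

Lemma D_value U : D U = 3 / 10 <-> ML U = 5^-1.
Proof. by rewrite /D; split=> h; lra. Qed.

(** The action of signed permutations on coordinates in any group, of which
[signed_perm] is the case of the circle. *)
Definition signed_row {V : zmodType} (s : 'S_n) (e : {ffun 'I_n -> bool}) (x : 'rV[V]_n) : 'rV[V]_n :=
  \row_j (if e j then - x 0 (s j) else x 0 (s j)).

Lemma signed_torus s e x : signed_perm s e (to_torus x) = to_torus (signed_row s e x).
Proof.
by apply/rowP => j; rewrite !mxE; case: (e j) => //; rewrite /to_circle raddfN.
Qed.

Lemma signed_real s e u : real_vec R (signed_row s e u) = signed_row s e (real_vec R u).
Proof. by apply/rowP => j; rewrite !mxE; case: (e j) => //; rewrite intrN. Qed.

Lemma signed_linear s e (p q : R) a b :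
  signed_row s e (p *: a + q *: b) = p *: signed_row s e a + q *: signed_row s e b.
Proof. by apply/rowP => j; rewrite !mxE; case: (e j) => //; ring. Qed.

Lemma signed_plane s e u w :
  signed_perm s e @` plane_torus R u w = plane_torus R (signed_row s e u) (signed_row s e w).
Proof.
apply/seteqP; split=> X.
  move=> [_ /plane_torusP[p [q ->]] <-]; apply/plane_torusP; exists p, q.
  by rewrite signed_torus signed_linear !signed_real.
move=> /plane_torusP[p [q ->]]; rewrite !signed_real -signed_linear -signed_torus.
by eexists; last reflexivity; apply/plane_torusP; exists p, q.
Qed.

Lemma plane_torus_eq u w u' w' :
  free [:: real_vec R u; real_vec R w] ->
  real_vec R u \in <<[:: real_vec R u'; real_vec R w']>>%VS ->
  real_vec R w \in <<[:: real_vec R u'; real_vec R w']>>%VS ->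
  plane_torus R u w = plane_torus R u' w'.
Proof.
move=> fr us ws; rewrite /plane_torus.
suff -> : (<<[:: real_vec R u; real_vec R w]>> = <<[:: real_vec R u'; real_vec R w']>>)%VS by [].
apply/eqP; rewrite eqEdim; apply/andP; split.
  by apply/span_subvP => x; rewrite !inE => /orP[] /eqP ->.
by rewrite (eqP fr); apply: dim_span.
Qed.

(** Shears serve to make all coordinates of the first generator nonzero. *)
Lemma plane_torus_shear (N : int) u w : plane_torus R (u + N *: w) w = plane_torus R u w.
Proof.
have rE : real_vec R (u + N *: w) = real_vec R u + N%:~R *: real_vec R w.
  by apply/rowP => j; rewrite !mxE intrD intrM.
apply/seteqP; split=> X /plane_torusP[s [t ->]]; apply/plane_torusP; rewrite rE.
  by exists s, (s * N%:~R + t); rewrite scalerDr scalerA scalerDl addrA.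
exists s, (t - s * N%:~R); congr to_torus.
by apply/rowP => j; rewrite !mxE; ring.
Qed.

End Tori.

(** * The extremal subtori *)

Section Extremal.
Context {R : realType}.
Implicit Types (p : seq nat) (s : 'S_5) (e : {ffun 'I_5 -> bool}).

Definition extremal p := p = [:: 1; 2; 3; 4]%N \/ p = [:: 1; 3; 4; 7]%N.
Definition pattern_row p : 'rV[int]_5 := row5 (rcons [seq v%:Z | v <- p] 0).
Definition last_unit : 'rV[int]_5 := row5 [:: 0; 0; 0; 0; 1].

Lemma last_unitE (r : 'I_5) : last_unit 0 r = (r == ord_max)%:Z.
Proof. by rewrite mxE; case: r => [[|[|[|[|[|]]]]]]. Qed.

Lemma pattern_rowE p (r : 'I_5) : size p = 4 -> pattern_row p 0 r = (nth 0 p r)%N%:Z.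
Proof.
move=> sp; rewrite mxE nth_rcons size_map sp; case: ltnP => r4; first by rewrite (nth_map 0)%N ?sp.
by rewrite (nth_default _ (n := r)) ?sp //; case: eqP.
Qed.

Lemma extremal_size p : extremal p -> size p = 4.
Proof. by case=> ->. Qed.

Lemma extremal_not_strict p : extremal p -> ~ strictly_lonely (5^-1 : R) p.
Proof.
by case=> ->; rewrite -[5^-1]mul1r; apply: (@swept_not_strict R 1 5) => //; vm_compute.
Qed.

Lemma extremal_fifth p k : extremal p -> k \in p -> 5^-1 <= dist_int (5^-1 * k%:R : R).
Proof.
move=> ep kp; rewrite mulrC dist_int_ratio // ler_pMl ?invr_gt0 // (ler_nat _ 1).
by case: ep kp => -> ; rewrite !inE => /or4P[] /eqP ->.
Qed.

Lemma extremal_coord p (x y : R) (r : 'I_5) : size p = 4 ->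
  (x *: real_vec R (pattern_row p) + y *: real_vec R last_unit) 0 r =
  if r == ord_max then y else x * (nth 0 p r)%N%:R.
Proof.
move=> sp; have := pattern_rowE r sp; have := last_unitE r.
rewrite plane_coord => -> ->; case: eqP => [->|_]; last by rewrite mulr0 addr0.
by rewrite nth_default ?sp // mulr0 add0r mulr1.
Qed.

Lemma ord5_lt4 (r : 'I_5) : r != ord_max -> (r < 4)%N.
Proof. by move=> r4; have := ltn_ord r; rewrite ltnS leq_eqVlt => /orP[/eqP e|//]; case/eqP: r4; apply: val_inj. Qed.

(** The value 1/5 is attained with the quadruple at time 1/5 and the free coordinate
at 1/2. *)
Lemma extremal_plane p s e : extremal p ->
  let U := signed_perm s e @` plane_torus R (pattern_row p) last_unit in
  subtorus2 U /\ proper_subtorus U /\ D U = 3 / 10.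
Proof.
move=> ep U; have sp := extremal_size ep.
pose X : torus R 5 := signed_perm s e (to_torus (5^-1 *: real_vec R (pattern_row p)
  + 2^-1 *: real_vec R last_unit)).
have UX : U X.
  by eexists; last reflexivity; apply/plane_torusP; exists 5^-1, 2^-1.
have norm_signed (x : 'rV[R]_5) r :
    circle_norm (signed_perm s e (to_torus x) 0 r) = dist_int (x 0 (s r)).
  by rewrite signed_torus norm_torus mxE; case: (e r) => //; apply: dist_intN.
have i52 : 5^-1 < 2^-1 :> R by rewrite ltf_pV2 ?posrE ?ltr_nat.
have X5 r : 5^-1 <= circle_norm (X 0 r).
  rewrite norm_signed extremal_coord //; case: eqP => [_|/eqP r4].
    by apply/dist_int_itv; [lra | exists 0; lra].
  by apply: extremal_fifth ep _; rewrite mem_nth // sp ord5_lt4.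
split; [|split].
- exists (signed_row s e (pattern_row p)), (signed_row s e last_unit).
  split; last exact: signed_plane.
  apply/free2P; exists ((s^-1)%g ord0), ((s^-1)%g ord_max).
  rewrite ![signed_row _ _ _ _ _]mxE !permKV !last_unitE !pattern_rowE //.
  by case: ep => ->; do 2!case: (e _).
- by apply: proper_of_point UX _ => r; apply: lt_le_trans (X5 r); rewrite invr_gt0.
- apply/D_value/le_anti; rewrite (ML_ge (ltW i52) UX X5) andbT.
  apply: (ML_le i52 UX) => _ [_ /plane_torusP[x [y ->]] <-].
  apply: contrapT => none; apply: (extremal_not_strict ep); exists x => v /(nthP 0%N)[k kp <-].
  rewrite sp in kp; have k5 : (k < 5)%N by apply: leq_trans kp _.
  rewrite ltNge; apply/negP => h; apply: none; exists ((s^-1)%g (Ordinal k5)).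
  rewrite norm_signed permKV extremal_coord //; case: eqP => // /(congr1 val) /= k4.
  by rewrite k4 in kp.
Qed.

(** The converse: after a shear no coordinate vanishes on the first generator, and
without a strictly lonely point the two generators are proportional off one
coordinate, where they are multiples of an extremal quadruple. *)
Lemma plane_extremal (U : set (torus R 5)) :
  subtorus2 U -> proper_subtorus U -> D U = 3 / 10 ->
  exists s e p, extremal p /\
    U = signed_perm s e @` plane_torus R (pattern_row p) last_unit.
Proof.
move=> [u [w [fr ->]]] pr /D_value ML5.
have col r : u 0 r != 0 \/ w 0 r != 0.
  apply/orP/negPn/negP; rewrite negb_or !negbK => /andP[/eqP ur /eqP wr].
  apply: pr => X /plane_torusP[x [y ->]]; exists r => //=.
  by rewrite !mxE ur wr !mulr0 addr0 /to_circle raddf0.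
have [N hN] : exists N : int, forall r, u 0 r + N * w 0 r != 0.
  (* A factor larger than every coordinate of u. *)
  exists (1 + \sum_r `|u 0 r|) => r.
  have : `|u 0 r| <= \sum_r `|u 0 r|.
    by rewrite (bigD1 r) //= lerDl sumr_ge0.
  move: (col r); move: (u 0 r) (w 0 r) (\sum_r `|u 0 r|) => a b S; clear.
  by case: (ltrgtP b 0) => [b0|b0|->] h1 h2; [nia | nia | lia].
rewrite -(plane_torus_shear N) in pr ML5 *.
pose v := u + N *: w; rewrite -/v in pr ML5 *.
have vE r : v 0 r = u 0 r + N * w 0 r by rewrite !mxE.
have v0 r : v 0 r != 0 by rewrite vE.
have minor : exists i j, v 0 i * w 0 j != v 0 j * w 0 i.
  have [i [j ij]] := (free2P u w).1 fr; exists i, j; rewrite !vE -subr_eq0.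
  have -> : (u 0 i + N * w 0 i) * w 0 j - (u 0 j + N * w 0 j) * w 0 i =
    u 0 i * w 0 j - u 0 j * w 0 i by ring.
  by rewrite subr_eq0.
have fr' : free [:: real_vec R v; real_vec R w] by apply/free2P.
have i52 : 5^-1 < 2^-1 :> R by rewrite ltf_pV2 ?posrE ?ltr_nat.
have [[x [y xy]]|[i [par [m [m0 tq]]]]] := @five_coordinates R _ _ v0 minor.
  pose X : torus R 5 := to_torus (x *: real_vec R v + y *: real_vec R w).
  have UX : plane_torus R v w X by apply/plane_torusP; exists x, y.
  have := ML_ge (min_norm_half _) UX ((min_norm_ge _ (min_norm_half _)).1 (lexx _)).
  rewrite ML5 leNgt => /negP[]; apply/(min_norm_gt _ i52) => r.
  by rewrite norm_torus plane_coord.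
have [p [ep pE]] : exists p, extremal p /\
    perm_eq [seq (m * k)%N | k <- p] [seq `|v 0%R j|%N | j <- rem i (enum 'I_5)].
  by case: tq => h; eexists; (split; last by rewrite perm_sym; exact: h); [left|right].
have sp := extremal_size ep; have [r' r'E mapE] := perm_map_inv pE.
pose q := rcons r' i.
have qE : perm_eq q (enum 'I_5).
  rewrite perm_rcons (perm_trans _ (_ : perm_eq (i :: rem i (enum 'I_5)) _)) ?perm_cons //.
  by rewrite perm_sym perm_to_rem // mem_enum.
have sr' : size r' = 4 by have := congr1 size mapE; rewrite !size_map sp.
have uq : uniq q by rewrite (perm_uniq qE) enum_uniq.
pose g (k : 'I_5) := nth i q k.
have g_inj : injective g.
  move=> k l /eqP; rewrite /g nth_uniq ?size_rcons ?sr' //.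
  by move/eqP/val_inj.
(* The permutation sends each coordinate to its place in the quadruple, and the
   free coordinate i to the last place. *)
pose s := ((perm g_inj)^-1)%g.
have gs j : g (s j) = j by rewrite -(permE g_inj) /s permKV.
have g_max : g ord_max = i by rewrite /g /q nth_rcons sr'.
have s_max j : (s j == ord_max) = (j == i).
  by rewrite -(inj_eq g_inj) gs g_max.
pose e := [ffun j => v 0 j < 0].
exists s, e, p; split=> //; rewrite signed_plane.
set P := signed_row s e (pattern_row p); set Q := signed_row s e last_unit.
have vP j : j != i -> v 0 j = m%:Z * P 0 j.
  rewrite -s_max => /ord5_lt4 s4; rewrite [P 0 j]mxE pattern_rowE // ffunE.
  have : (m * nth 0 p (s j))%N = `|v 0%R j|%N.
    rewrite -{2}(gs j) /g /q nth_rcons sr' s4 -(nth_map i 0%N (fun j => `|v 0%R j|%N)) ?sr' //.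
    by rewrite -mapE (nth_map 0%N) ?sp.
  by move: (v 0 j) (nth _ _ _) => a k; clear; case: (ltrP a 0) => a0 h; rewrite ?mulrN -PoszM h; lia.
have Pi : P 0 i = 0.
  have /eqP si : s i == ord_max by rewrite s_max.
  by rewrite mxE si pattern_rowE // nth_default ?sp //; case: ifP.
have QE j : Q 0 j = (if e j then -1 else 1) * (j == i)%:Z.
  by rewrite mxE last_unitE s_max; case: (e j); case: (j == i).
apply: plane_torus_eq fr' _ _; apply/span2P.
  exists m%:R, ((if e i then -1 else 1) * (v 0 i)%:~R); apply/rowP => j.
  rewrite plane_coord [LHS]mxE QE; case: eqP => [->|/eqP/vP ->].
    by rewrite Pi; case: (e i); rewrite /= ?mulr0z; ring.
  by rewrite mulr0 mulr0z mulr0 addr0 intrM.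
pose j0 := lift i ord0.
have j0i : j0 != i by rewrite eq_sym neq_lift.
have P0 : P 0 j0 != 0.
  by have := v0 j0; rewrite vP // mulf_eq0 negb_or => /andP[].
exists ((w 0 j0)%:~R / (P 0 j0)%:~R), ((if e i then -1 else 1) * (w 0 i)%:~R); apply/rowP => j.
rewrite plane_coord [LHS]mxE QE; case: eqP => [->|/eqP ji].
  by rewrite Pi; case: (e i); rewrite /= ?mulr0z; ring.
rewrite mulr0 mulr0z mulr0 addr0.
have h : P 0 j0 * w 0 j = P 0 j * w 0 j0.
  by have := par _ _ j0i ji; rewrite !vP // -!mulrA => /mulfI; apply; clear - m0; lia.
by rewrite mulrAC -intrM [w 0 j0 * _]mulrC -h intrM mulrC mulKf // intr_eq0.
Qed.

End Extremal.

Theorem theoremD (R : realType) :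
  (forall U : set (torus R 5),
     (subtorus2 U /\ proper_subtorus U /\ D U = 3 / 10) <->
     (exists (s : 'S_5) (e : {ffun 'I_5 -> bool}),
        U = signed_perm s e @`
              plane_torus R (row5 [:: 1; 2; 3; 4; 0])
                            (row5 [:: 0; 0; 0; 0; 1]) \/
        U = signed_perm s e @`
              plane_torus R (row5 [:: 1; 3; 4; 7; 0])
                            (row5 [:: 0; 0; 0; 0; 1])))
  /\
  (exists E5 : set (5.-tuple nat),
     finite_set E5 /\
     (forall v : 5.-tuple nat, E5 v ->
        speeds5 v /\ primitive5 v /\ near_tight R v) /\
     (forall v : 5.-tuple nat,
        speeds5 v -> primitive5 v -> near_tight R v -> ~ E5 v ->
        in_spectrum R v))
  /\
  (forall v : 5.-tuple nat,
     speeds5 v -> all (fun k => k <= 130)%N v -> near_tight R v ->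
     in_spectrum R v).
Proof.
split; [|split].
- move=> U; split=> [[sU [pU dU]]|[s [e UE]]].
    have [s [e [p [ep ->]]]] := plane_extremal sU pU dU.
    by exists s, e; case: ep => ->; [left | right].
  by case: UE => ->; [apply: (extremal_plane s e (or_introl erefl))
                     | apply: (extremal_plane s e (or_intror erefl))].
- exists [set v | [/\ speeds5 v, primitive5 v, near_tight R v & ~ in_spectrum R v]].
  split; [exact: finitely_many_exceptional | split=> v; first by case].
  move=> v5 pv nt nE; apply: contrapT => ns; exact: nE.
- move=> v v5 v130 /near_tight_lonely nl.
  exact/spectral_in_spectrum/quintuples_130.
Qed.
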